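(* The lengths and potentials $\{(l_j,q_j): j=1,\dots,4\}$ on the metric graph $\Omega$ are uniquely determined by the spectral data $$\{\omega_n^2,\ \partial\varphi^n_1(v_1),\ \partial\varphi^n_3(v_2) : n\in\mathbb{N}\}.$$ That is: let $\{(l_j,q_j)\}_{j=1}^4$ and $\{(\tilde l_j,\tilde q_j)\}_{j=1}^4$ be two admissible configurations, with $l_j,\tilde l_j>0$ and with $q_j$ on $(0,l_j)$ and $\tilde q_j$ on $(0,\tilde l_j)$ bounded, continuous and real valued. Suppose that for some choice of eigenvalue enumerations and orthonormal bases of eigenfunctions $\{(\omega_n^2,\varphi^n)\}$ and $\{(\tilde\omega_n^2,\tilde\varphi^n)\}$ of the two corresponding eigenvalue problems one has, for all $n\in\mathbb{N}$, $$\omega_n^2=\tilde\omega_n^2,\qquad \partial\varphi_1^n(v_1)=\partial\tilde\varphi_1^n(v_1),\qquad \partial\varphi_3^n(v_2)=\partial\tilde\varphi_3^n(v_2).$$ Then $l_j=\tilde l_j$ and $q_j=\tilde q_j$ on $(0,l_j)$ for $j=1,2,3,4$.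
   Context: The metric graph $\Omega=\{V,E\}$ has vertices $V=\{v_1,v_2,v_3,v_4\}$ and edges $E=\{e_1,e_2,e_3,e_4\}$, where $e_1$ joins $v_1$ to $v_2$, both $e_2$ and $e_3$ join $v_2$ to $v_3$ (so $e_2\cup e_3$ is a ring), and $e_4$ joins $v_3$ to $v_4$. The boundary is $\Gamma=\{v_1,v_4\}$; $v_2,v_3$ are internal vertices. The edge $e_j$ has length $l_j>0$ and is identified with the interval $(0,l_j)$ by arclength $x$; fix the identification so that $x=0$ corresponds to $v_1$ on $e_1$, to $v_2$ on $e_2$ and $e_3$, and to $v_3$ on $e_4$. The potential $q$ on $\Omega$ has restriction $q_j$ to $e_j$, a bounded, continuous, real valued function. The restriction of a function $\phi$ on $\Omega$ to $e_j$ is denoted $\phi_j$. For a vertex $v_i$, $J(v_i)$ is the set of indices of edges incident to $v_i$, and $\partial\phi_j(v_i)$ is the derivative of $\phi$ at $v_i$ along $e_j$, pointing away from $v_i$. The eigenvalue problem on $\Omega$ is: $$-\frac{d^2\varphi^n}{dx^2}+q(x)\varphi^n=\omega_n^2\varphi^n \ \text{ on } \Omega\setminus V,\qquad \varphi^n \text{ continuous on } \Omega,$$ $$\sum_{j\in J(v_i)}\partial\varphi^n_j(v_i)=0 \ \text{ for } v_i\in\{v_2,v_3\},\qquad \varphi^n|_{\Gamma}=0.$$ The eigenvalues $\omega_n^2$ are real numbers, enumerated for $n\ge1$ in nondecreasing order and repeated according to multiplicity, and $\{\varphi^n\}$ is a corresponding (real) orthonormal basis of eigenfunctions in $L^2(\Omega)$.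 *)

(* Defs.v *)
From HB Require Import structures.
From mathcomp Require Export all_boot all_order all_algebra.
From mathcomp Require Export all_classical all_reals all_analysis.
Export Order.TTheory GRing.Theory Num.Theory.
Export numFieldNormedType.Exports.

Set Implicit Arguments.
Unset Strict Implicit.
Unset Printing Implicit Defensive.

Local Open Scope classical_set_scope.
Local Open Scope ring_scope.

Definition vertex := 'I_4.
Definition edge := 'I_4.

Definition v1 : vertex := @Ordinal 4 0 isT.
Definition v2 : vertex := @Ordinal 4 1 isT.
Definition v3 : vertex := @Ordinal 4 2 isT.
Definition v4 : vertex := @Ordinal 4 3 isT.

Definition e1 : edge := @Ordinal 4 0 isT.
Definition e2 : edge := @Ordinal 4 1 isT.
Definition e3 : edge := @Ordinal 4 2 isT.
Definition e4 : edge := @Ordinal 4 3 isT.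

(* The edge j is identified with (0, l j); x = 0 is its source, x = l j its
   target. *)
Definition src (j : edge) : vertex := tnth [tuple v1; v2; v2; v3] j.
Definition tgt (j : edge) : vertex := tnth [tuple v2; v3; v3; v4] j.

Definition incident (v : vertex) : {set edge} :=
  [set j | (src j == v) || (tgt j == v)]%SET.

Definition internal_vertices : {set vertex} := [set v2; v3]%SET.
Definition boundary_vertices : {set vertex} := [set v1; v4]%SET.

Section Graph.
Context {R : realType}.

Implicit Types (l : edge -> R) (q f g phi : edge -> R -> R) (lam : nat -> R).

(* A function on the metric graph is a family of functions R -> R indexed by
   the edges; only the values of the j-th one on [0, l j] are meaningful. *)

Definition admissible l q : Prop :=
  forall j : edge,
    [/\ 0 < l j,
        {in `]0, l j[, continuous (q j)} &
        [bounded q j x | x in `]0, l j[ ] ].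

(* Coordinate on the edge j of its endpoint v, and direction pointing away
   from v (only meaningful for j \in incident v; the graph has no loops). *)
Definition endpoint l (v : vertex) (j : edge) : R :=
  if src j == v then 0 else l j.
Definition away (v : vertex) (j : edge) : R :=
  if src j == v then 1 else -1.

Definition diff_quotient l phi (j : edge) (v : vertex) (h : R) : R :=
  h^-1 * (phi j (endpoint l v j + away v j * h) - phi j (endpoint l v j)).

(* The derivative of phi at v along the edge j, pointing away from v. *)
Definition vertex_deriv l phi (j : edge) (v : vertex) : R :=
  lim (diff_quotient l phi j v h @[h --> 0^'+]).

Definition graph_continuous l phi : Prop :=
  (forall j : edge, {within `[0, l j], continuous (phi j)}) /\
  (forall (v : vertex) (j k : edge), j \in incident v -> k \in incident v ->
     phi j (endpoint l v j) = phi k (endpoint l v k)).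

(* phi is a solution, possibly zero, of the eigenvalue problem with eigenvalue
   mu. The existence of the one-sided derivatives at the vertices is a
   consequence of the other conditions when q is bounded; it is recorded so
   that vertex_deriv is visibly an actual limit. *)
Record eigen_solution l q (mu : R) phi : Prop := {
  eigen_eqn : forall (j : edge) (x : R), x \in `]0, l j[ ->
    [/\ derivable (phi j) x 1,
        derivable (derive1 (phi j)) x 1 &
        - derive1 (derive1 (phi j)) x + q j x * phi j x = mu * phi j x];
  eigen_cont : graph_continuous l phi;
  eigen_vertex_derivable : forall (v : vertex) (j : edge), j \in incident v ->
    cvg (diff_quotient l phi j v h @[h --> 0^'+]);
  eigen_kirchhoff : forall v : vertex, v \in internal_vertices ->
    \sum_(j in incident v) vertex_deriv l phi j v = 0;
  eigen_dirichlet : forall (v : vertex) (j : edge), v \in boundary_vertices ->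
    j \in incident v -> phi j (endpoint l v j) = 0
}.

Definition in_L2 l f : Prop :=
  forall j : edge, (f j \_ `]0, l j[) \in Lfun lebesgue_measure 2%:E.

Definition L2dot l f g : R :=
  \sum_(j : edge) \int[lebesgue_measure]_(x in `]0, l j[) (f j x * g j x).

Definition fourier_sum l (phi : nat -> edge -> R -> R) f (N : nat)
    : edge -> R -> R :=
  fun j x => \sum_(n < N) L2dot l f (phi n) * phi n j x.

Definition orthonormal_basis l (phi : nat -> edge -> R -> R) : Prop :=
  [/\ forall n, in_L2 l (phi n),
      forall m n, L2dot l (phi m) (phi n) = (m == n)%:R &
      forall f, in_L2 l f ->
        let r N := fun j x => f j x - fourier_sum l phi f N j x in
        L2dot l (r N) (r N) @[N --> \oo] --> 0].

(* lam n stands for omega_n ^ 2, which is real but may be negative. Sequences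
   start at 0 instead of 1. Eigenfunctions are nonzero since they have norm 1.
   Since phi is a complete orthonormal system of eigenfunctions of a symmetric
   problem, every eigenvalue occurs in lam exactly as many times as its
   multiplicity. *)
Record spectral_system l q lam (phi : nat -> edge -> R -> R) : Prop := {
  spectral_nondecreasing : forall n, lam n <= lam n.+1;
  spectral_eigen : forall n, eigen_solution l q (lam n) (phi n);
  spectral_basis : orthonormal_basis l phi
}.

End Graph.

(* Main.v *)
(** For [lam = - k ^ 2] with [k] large, the boundary value problem on the graph with
    Dirichlet datum [f] at [v1] and jump [g] at [v2] along [e3] is uniquely solvable.
    By Green's formula the Fourier coefficients of its solution are
    [(f a_n + g b_n) / (lam_n - lam)], where [a_n] and [b_n] are the two given
    derivatives.  Parseval's identity and Green's formula then show that the spectral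
    data determine, up to additive constants, the responses [(u_1'(v1), u_3'(v2))] to
    all [(f, g)], and the asymptotics for large [k] fix the constants.

    The logarithmic derivative at one end of an edge determines the potential (local
    Borg-Marchenko) and the length (a Kirchhoff vertex of degree three or a Dirichlet
    vertex is visible in the logarithmic derivative at the other end).  The response at
    [v1] thus gives [e1]; since the flux into [e3] is part of the data, what remains at
    [v2] is the response matrix of the star with centre [v3] at the free ends of [e2]
    and [e3], which gives these two edges, and finally [e4].

    Only real [k] are used.  Borg-Marchenko: if [psi], [psi~] are the solutions decaying
    like [exp (- k x)], then [integral (q - q~) psi psi~] over [(0, a)] is
    [O (k exp (- 2 k a))].  Up to the factor [exp (- 2 k x)], [psi psi~] is [1] plus the
    Laplace transform of a bounded density, and inverting the Laplace transform at [2 b]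
    by a Mikusinski-type sum over [k = n, 2 n, ...] bounds [|q - q~| (b)] by a multiple
    of [integral |q - q~|] over [(0, b)]. *)

(* The ring is the main obstacle: seen from [v1] alone, [e2] and [e3] act only together. The jump at
   [v2] along [e3] is a second control; combined with the source at [v1] it prescribes the values at
   the two ends of [e2] and [e3] near [v2] independently, which amounts to cutting the ring open.

   Responses are compared at two spectral parameters because the formal series for a single one,
   with terms such as [a_n ^ 2 / (lam_n - lam)], does not converge in general, while an inner
   product of two solutions has a convergent expansion.

   The length of an edge is visible because three edges meeting at its far end force a logarithmic
   derivative near [- 2 * k] there and a Dirichlet condition an infinite one, whereas a mere
   continuation of the edge would give a value near [- k].

   The potentials may have no limits at the vertices. Solutions are therefore pairs of functions
   continuous on the whole line that satisfy the equation on the open edge, and integral estimates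
   become comparisons of increments. *)
Require Import Defs.
From mathcomp Require Import ring lra.

Set Implicit Arguments.
Unset Strict Implicit.
Unset Printing Implicit Defensive.

Local Open Scope classical_set_scope.
Local Open Scope ring_scope.

(** * Calculus *)

Section Calculus.
Context {R : realType}.
Implicit Types (f g F G u v : R -> R) (a b c l x y M : R).

Lemma derM f g x a b : is_derive x 1 f a -> is_derive x 1 g b ->
  is_derive x 1 (fun t => f t * g t) (a * g x + f x * b).
Proof.
move=> df dg.
have := is_deriveM df dg; rewrite (_ : f * g = fun t => f t * g t)//.
by move=> /is_derive_eq; apply; rewrite /GRing.scale/=; ring.
Qed.

Lemma derD f g x a b : is_derive x 1 f a -> is_derive x 1 g b ->
  is_derive x 1 (fun t => f t + g t) (a + b).
Proof. exact: is_deriveD. Qed.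

Lemma derB f g x a b : is_derive x 1 f a -> is_derive x 1 g b ->
  is_derive x 1 (fun t => f t - g t) (a - b).
Proof. exact: is_deriveB. Qed.

Lemma derN f x a : is_derive x 1 f a -> is_derive x 1 (fun t => - f t) (- a).
Proof. exact: is_deriveN. Qed.

Lemma derc c x : is_derive x 1 (fun _ : R => c) 0.
Proof. exact: is_derive_cst. Qed.

Lemma derZ f x a c : is_derive x 1 f a ->
  is_derive x 1 (fun t => c * f t) (c * a).
Proof. exact: is_deriveZ. Qed.

Lemma der_lin x c : is_derive x 1 (fun t => c * t) c.
Proof. by have := derZ c (is_derive_id x 1); rewrite mulr1. Qed.

Lemma der_exp f x a : is_derive x 1 f a ->
  is_derive x 1 (fun t => expR (f t)) (a * expR (f x)).
Proof.
move=> df; rewrite mulrC; exact: (is_derive1_comp (is_derive_expR (f x)) df).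
Qed.

Lemma der_affine f x c d a : is_derive (d + c * x) 1 f a ->
  is_derive x 1 (fun t => f (d + c * t)) (c * a).
Proof.
move=> df; rewrite mulrC.
apply: (is_derive1_comp (f := f) (g := fun t => d + c * t)) => //.
by have := derD (is_derive_cst d x 1) (der_lin x c); rewrite add0r.
Qed.

Lemma der_sum (n : nat) (h : nat -> R -> R) (d : nat -> R) x :
  (forall i : nat, is_derive x 1 (h i) (d i)) ->
  is_derive x 1 (fun t => \sum_(i < n) h i t) (\sum_(i < n) d i).
Proof.
move=> dh; elim: n => [|n IH].
  rewrite big_ord0 (_ : (fun _ => _) = cst 0); first exact: is_derive_cst.
  by apply/funext => t; rewrite big_ord0.
rewrite big_ord_recr (_ : (fun _ => _) =
  (fun t => \sum_(i < n) h i t + h n t)); first exact: derD.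
by apply/funext => t; rewrite big_ord_recr.
Qed.

Lemma contM f g : continuous f -> continuous g ->
  continuous (fun x => f x * g x).
Proof. by move=> cf cg x; apply: continuousM; [exact: cf|exact: cg]. Qed.

Lemma contD f g : continuous f -> continuous g ->
  continuous (fun x => f x + g x).
Proof. by move=> cf cg x; apply: continuousD; [exact: cf|exact: cg]. Qed.

Lemma contB f g : continuous f -> continuous g ->
  continuous (fun x => f x - g x).
Proof. by move=> cf cg x; apply: continuousB; [exact: cf|exact: cg]. Qed.

Lemma contc c : continuous (fun _ : R => c).
Proof. by move=> x; exact: cvg_cst. Qed.

Lemma cont_comp f g : continuous f -> continuous g ->
  continuous (fun x => f (g x)).
Proof. by move=> cf cg x; apply: continuous_comp; [exact: cg|exact: cf]. Qed.

Lemma contN f : continuous f -> continuous (fun x => - f x).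
Proof. by move=> cf; apply: cont_comp cf => x; exact: opp_continuous. Qed.

Lemma cont_norm f : continuous f -> continuous (fun x => `|f x|).
Proof. by move=> cf; apply: cont_comp cf => x; exact: norm_continuous. Qed.

Lemma cont_lin c : continuous (fun x : R => c * x).
Proof. by apply: contM; [exact: contc|move=> x; exact: cvg_id]. Qed.

Lemma cont_exp f : continuous f -> continuous (fun x => expR (f x)).
Proof. by move=> cf; apply: cont_comp cf => x; exact: continuous_expR. Qed.

Lemma cont_affine f c d : continuous f -> continuous (fun x => f (d + c * x)).
Proof.
move=> cf; apply: cont_comp => //; apply: contD; [exact: contc|exact: cont_lin].
Qed.

Lemma cont_sum (n : nat) (h : nat -> R -> R) :
  (forall i, continuous (h i)) -> continuous (fun t => \sum_(i < n) h i t).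
Proof.
move=> ch; elim: n => [|n IH].
  rewrite (_ : (fun _ => _) = cst 0); first exact: contc.
  by apply/funext => t; rewrite big_ord0.
rewrite (_ : (fun _ => _) =
  (fun t => \sum_(i < n) h i t + h n t)); first exact: contD.
by apply/funext => t; rewrite big_ord_recr.
Qed.

(** The mean value theorem for [G - F]. Estimates of integrals are phrased through such increments,
    so that derivatives matter only on the open interval, where the potential is controlled. *)
Lemma le_increment F G f g a b : a <= b -> continuous F -> continuous G ->
  (forall x, a < x < b -> is_derive x 1 F (f x)) ->
  (forall x, a < x < b -> is_derive x 1 G (g x)) ->
  (forall x, a < x < b -> f x <= g x) -> F b - F a <= G b - G a.
Proof.
rewrite le_eqVlt => /predU1P[->|ab] cF cG dF dG fg; first by rewrite !subrr.
have [| |c cab E] := @MVT _ (fun x => G x - F x) (fun x => g x - f x) a b ab.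
- by move=> x; rewrite in_itv => xab; apply: derB; [apply: dG|apply: dF].
- by apply: continuous_subspaceT => x; exact: (contB cG cF).
have fgc := fg c; rewrite in_itv in cab; move/(_ cab) in fgc.
have : 0 <= (g c - f c) * (b - a) by rewrite mulr_ge0 ?subr_ge0 // ltW.
by rewrite -E; lra.
Qed.

Lemma norm_increment F G f g a b : a <= b -> continuous F -> continuous G ->
  (forall x, a < x < b -> is_derive x 1 F (f x)) ->
  (forall x, a < x < b -> is_derive x 1 G (g x)) ->
  (forall x, a < x < b -> `|f x| <= g x) -> `|F b - F a| <= G b - G a.
Proof.
move=> ab cF cG dF dG fg; rewrite ler_norml; apply/andP; split; last first.
  apply: le_increment (dF) (dG) _ => // x xab.
  exact: le_trans (ler_norm _) (fg x xab).
have := @le_increment (fun x => - F x) G (fun x => - f x) g a b ab.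
rewrite lerNl opprB => H; rewrite (_ : F a - F b = - F b - - F a); last lra.
apply: H => //; [exact: contN|by move=> x xab; apply: derN; exact: dF|].
move=> x xab; apply: le_trans (fg x xab); rewrite -normrN; exact: ler_norm.
Qed.

Lemma lipschitz_increment F f a b M : a <= b -> continuous F ->
  (forall x, a < x < b -> is_derive x 1 F (f x)) ->
  (forall x, a < x < b -> `|f x| <= M) -> `|F b - F a| <= M * (b - a).
Proof.
move=> ab cF dF fM; rewrite mulrBr.
apply: (norm_increment (G := fun x => M * x) (g := fun=> M) ab cF) dF _ fM.
  exact: cont_lin.
by move=> x _; exact: der_lin.
Qed.

Lemma constant_increment F a b : a <= b -> continuous F ->
  (forall x, a < x < b -> is_derive x 1 F 0) -> F b = F a.
Proof.
move=> ab cF dF; apply/eqP; rewrite -subr_eq0 -normr_le0.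
rewrite -(mul0r (b - a)); apply: lipschitz_increment cF dF _ => // x _.
by rewrite normr0.
Qed.

(** The projection onto [[0, l]]. Composing with it makes a function that is continuous on the
    segment continuous on the line, and all later continuity conditions are global. *)
Definition clamp l x : R := Num.max 0 (Num.min l x).

Lemma clamp_itv l x : 0 <= l -> 0 <= clamp l x <= l.
Proof.
by move=> l0; rewrite /clamp le_max lexx/= ge_max l0/= ge_min lexx.
Qed.

Lemma clamp_id l x : 0 <= x <= l -> clamp l x = x.
Proof. by move=> /andP[x0 xl]; rewrite /clamp (min_r xl) (max_r x0). Qed.

Lemma clamp_cont l : continuous (clamp l).
Proof.
move=> x; apply: continuous_max; first exact: cvg_cst.
by apply: continuous_min; [exact: cvg_cst|exact: cvg_id].
Qed.

Lemma clamp_ext_cont f l : 0 <= l -> {within `[0, l], continuous f} ->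
  continuous (fun x => f (clamp l x)).
Proof.
move=> l0 cf x; apply/cvgrPdist_le => e e0.
have cx : [set` `[0, l]] (clamp l x) by rewrite /= in_itv/=; exact: clamp_itv.
have : f t @[t --> within [set` `[0, l]] (nbhs (clamp l x))] --> f (clamp l x).
  by move/subspace_continuousP : cf; exact.
move=> /cvgrPdist_le/(_ e e0) H.
have K : \forall t \near x, [set` `[0, l]] (clamp l t) ->
    `|f (clamp l x) - f (clamp l t)| <= e := @clamp_cont l x _ H.
apply: filterS K => t; apply.
by rewrite /= in_itv/=; exact: clamp_itv.
Qed.

Lemma near_itv_oo a b x : a < x < b -> \forall t \near x, a < t < b.
Proof.
move=> xab; have /(@near_in_itvoo R a b) : x \in `]a, b[ by rewrite in_itv.
by apply: filterS => t; rewrite in_itv.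
Qed.

Lemma der_near f g x a : (\forall t \near x, f t = g t) ->
  is_derive x 1 f a -> is_derive x 1 g a.
Proof. exact: near_eq_is_derive. Qed.

(** Boundedness makes [f] Lebesgue integrable up to the end points, where it may have no limit; the
    indefinite integral is then extended by constants through [clamp]. *)
Lemma exists_primitive l f M : 0 < l ->
  (forall x, 0 < x < l -> {for x, continuous f}) ->
  (forall x, 0 < x < l -> `|f x| <= M) ->
  exists F, [/\ continuous F, F 0 = 0 &
    forall x, 0 < x < l -> is_derive x 1 F (f x)].
Proof.
move=> l0 cf fM.
pose f0 := f \_ `]0, l[.
have intf : lebesgue_measure.-integrable `]0, l[ (EFin \o f).
  apply: measurable_bounded_integrable => //.
  - by rewrite /= lebesgue_measure_itv/= lte_fin l0 -EFinB ltry.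
  - apply: measurable_realfun.open_continuous_measurable_fun; first exact: interval_open.
    by move=> x; rewrite inE/= in_itv/= => xl; apply: cf.
  - exists M; split; first exact: num_real.
    move=> K MK x /=; rewrite in_itv/= => xl.
    exact: le_trans (fM x xl) (ltW MK).
have intf0 : lebesgue_measure.-integrable `[0, l] (EFin \o f0).
  rewrite -restrict_EFin; apply/integrable_restrict => //=.
  by rewrite setIidr//; exact: subset_itv_oo_cc.
pose F := parameterized_integral lebesgue_measure 0 ^~ f0.
have cF : {within `[0, l], continuous F}.
  exact: parameterized_integral_continuous (ltW l0) intf0.
exists (fun x => F (clamp l x)); split.
- exact: clamp_ext_cont (ltW l0) cF.
- by rewrite clamp_id ?lexx ?ltW// /F /parameterized_integral set_itv1 Rintegral_set1.
- move=> x xl; have [x0 xl'] := andP xl.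
  apply: (@der_near F).
    have := near_itv_oo xl; apply: filterS => t /andP[t0 tl].
    by rewrite clamp_id// !ltW.
  have cf0 : {for x, continuous f0}.
    have E : \forall t \near x, f t = f0 t.
      have := near_itv_oo xl; apply: filterS => t tl.
      by rewrite /f0 patchE mem_set//= in_itv.
    rewrite /prop_for /continuous_at.
    rewrite -(nbhs_singleton E).
    by apply: cvg_trans (cf x xl); exact: near_eq_cvg.
  have f0x : f0 x = f x by rewrite /f0 patchE mem_set//= in_itv.
  have [dF F'] := @continuous_FTC1 R f0 (BLeft 0) x l xl' intf0 x0 cf0.
  apply: DeriveDef; first exact: dF.
  by rewrite -f0x -F' derive1E.
Qed.

End Calculus.

(** * Existence for linear second order equations *)

Section ODE.
Context {R : realType}.
Implicit Types (f g F u v q : R -> R) (a b c d l x y C e G M Q mu : R).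

Lemma bounded_on_segment l u : 0 <= l -> continuous u ->
  exists2 A, 0 <= A & forall x, 0 <= x <= l -> `|u x| <= A.
Proof.
move=> l0 cu.
have [c _ cmax] := EVT_max l0 (continuous_subspaceT (cont_norm cu)).
exists `|u c| => // x xl; apply: cmax; by rewrite in_itv.
Qed.

(** The intervals of radius [2 * C * 2^-1 ^+ n] around [a_ n] are nested, and the supremum of their
    left ends lies in all of them. The explicit rate makes the limit uniform when [a_] depends on a
    point. *)
Lemma geometric_limit (a_ : nat -> R) (C : R) :
  (forall n, `|a_ n.+1 - a_ n| <= C * 2^-1 ^+ n) ->
  exists L : R, forall n, `|L - a_ n| <= 2 * C * 2^-1 ^+ n.
Proof.
move=> aC.
pose lo n := a_ n - 2 * C * 2^-1 ^+ n; pose hi n := a_ n + 2 * C * 2^-1 ^+ n.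
have C0 : 0 <= C by have := aC 0%N; rewrite expr0 mulr1; apply: le_trans.
have e0 n : 0 <= C * 2^-1 ^+ n by rewrite mulr_ge0// exprn_ge0// invr_ge0.
have lohi n : lo n <= hi n by have := e0 n; rewrite /lo /hi; lra.
have lom : {homo lo : m n / (m <= n)%N >-> m <= n}.
  apply/nondecreasing_seqP => n; have := aC n.
  by rewrite /lo exprS ler_norml; have := e0 n; lra.
have him : {homo hi : m n / (m <= n)%N >-> n <= m}.
  apply/nonincreasing_seqP => n; have := aC n.
  by rewrite /hi exprS ler_norml; have := e0 n; lra.
have lohi2 m n : lo m <= hi n.
  apply: (le_trans (lom _ _ (leq_maxl m n))).
  apply: (le_trans (lohi _)); exact: him (leq_maxr _ _).
exists (sup (range lo)) => n.
have h1 : lo n <= sup (range lo).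
  apply: ub_le_sup; last by exists n.
  by exists (hi 0%N) => _ [m _ <-].
have h2 : sup (range lo) <= hi n.
  apply: ge_sup; first by exists (lo 0%N), 0%N.
  by move=> _ [m _ <-].
by rewrite ler_norml; move: h1 h2; rewrite /lo /hi; lra.
Qed.

Lemma half_pow_small (C e : R) : 0 < e -> exists n : nat, C * 2^-1 ^+ n <= e.
Proof.
move=> e0.
have H : (fun n => C * 2^-1 ^+ n : R) @ \oo --> C * 0.
  apply: cvgM; first exact: cvg_cst.
  by apply: cvg_expr; rewrite ger0_norm ?invr_ge0 // invf_lt1 // ltr1n.
have /cvgrPdist_le/(_ e e0)[N _ /(_ N (leqnn N))] /= := H.
rewrite mulr0 sub0r normrN => HN; exists N.
exact: le_trans (ler_norm _) HN.
Qed.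

Lemma eq0_of_half_pow (a C : R) :
  (forall n : nat, `|a| <= C * 2^-1 ^+ n) -> a = 0.
Proof.
move=> H; apply/eqP; rewrite -normr_le0; apply/ler_addgt0Pl => e e0.
have [n Hn] := half_pow_small C e0.
by rewrite addr0 (le_trans (H n)).
Qed.

Lemma geometric_limit_fun (u_ : nat -> R -> R) (C : R) :
  (forall n, continuous (u_ n)) ->
  (forall n x, `|u_ n.+1 x - u_ n x| <= C * 2^-1 ^+ n) ->
  exists2 u, continuous u & forall n x, `|u x - u_ n x| <= 2 * C * 2^-1 ^+ n.
Proof.
move=> cu uC.
have /choice[u Hu] : forall x, exists L, forall n, `|L - u_ n x| <= 2 * C * 2^-1 ^+ n.
  by move=> x; exact: geometric_limit.
exists u => // x; apply/cvgrPdist_le => e e0.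
have e3 : 0 < e / 3 by rewrite divr_gt0.
have [n Hn] := half_pow_small (2 * C) e3.
have /cvgrPdist_le/(_ _ e3) := cu n x.
apply: filterS => t Ht.
have := le_trans (Hu x n) Hn; have := le_trans (Hu t n) Hn.
move: Ht; rewrite !ler_norml; lra.
Qed.

(** The equation [u'' = g u] as a first order system: carrying [v] as a continuous function gives
    the derivative a value at both ends of the edge. *)
Definition sol l g u v := [/\ continuous u, continuous v,
  forall x, 0 < x < l -> is_derive x 1 u (v x) &
  forall x, 0 < x < l -> is_derive x 1 v (g x * u x)].

Definition cont_bounded l Q q := forall x, 0 < x < l ->
  {for x, continuous q} /\ `|q x| <= Q.

(** Integrating [expR (mu * t)] gains a factor [1 / mu]: in the sup norm weighted by
    [expR (- mu * x)], integration is a contraction for large [mu], on an interval of any length. *)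
Lemma exp_weight_increment F f A mu x : 0 < mu -> 0 <= x -> continuous F ->
  (forall t, 0 < t < x -> is_derive t 1 F (f t)) ->
  (forall t, 0 < t < x -> `|f t| <= A * expR (mu * t)) -> 0 <= A ->
  `|F x - F 0| <= A / mu * expR (mu * x).
Proof.
move=> mu0 x0 cF dF fA A0.
have := @norm_increment R F (fun t => A / mu * expR (mu * t)) f
  (fun t => A * expR (mu * t)) 0 x x0 cF.
rewrite mulr0 expR0 mulr1 => H.
apply: le_trans (H _ dF _ fA) _.
- by apply: contM; [exact: contc|exact/cont_exp/cont_lin].
- move=> t _; have := derZ (A / mu) (der_exp (der_lin t mu)).
  by move=> /is_derive_eq; apply; field; exact: lt0r_neq0.
- by rewrite gerBl divr_ge0// ltW.
Qed.

(** Picard iteration, convergent on the whole edge at once thanks to the exponential weight. *)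
Lemma ode_exists l g G c d : 0 < l -> cont_bounded l G g ->
  exists u v, [/\ sol l g u v, u 0 = c & v 0 = d].
Proof.
move=> l0 gG.
have l2 : 0 < l / 2 < l by lra.
have G0 : 0 <= G by have [_] := gG _ l2; apply: le_trans.
have hbd (h : R -> R) : continuous h -> exists M, forall x, 0 < x < l -> `|h x| <= M.
  move=> ch; have [M M0 HM] := bounded_on_segment (ltW l0) ch.
  by exists M => x /andP[x0 xl]; apply: HM; rewrite !ltW.
(* Primitives are chosen for all functions simultaneously; for a discontinuous [h] the value is a
   placeholder. *)
have /choice[P HP] : forall h : R -> R, exists F, continuous h ->
    [/\ continuous F, F 0 = 0 &
      forall x, 0 < x < l -> is_derive x 1 F (g x * h x)].
  move=> h; have [ch|] := pselect (continuous h); last by move=> n; exists h.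
  have [M HM] := hbd h ch.
  have [||F HF] := @exists_primitive R l (fun x => g x * h x) (G * M) l0.
  - by move=> x xl; apply: continuousM; [exact: (gG x xl).1|exact: ch].
  - by move=> x xl; rewrite normrM ler_pM//; [exact: (gG x xl).2|exact: HM].
  by exists F.
have /choice[P1 HP1] : forall h : R -> R, exists F, continuous h ->
    [/\ continuous F, F 0 = 0 & forall x, 0 < x < l -> is_derive x 1 F (h x)].
  move=> h; have [ch|] := pselect (continuous h); last by move=> n; exists h.
  have [M HM] := hbd h ch.
  have [x _|//|F HF] := @exists_primitive R l h M l0; first exact: ch.
  by exists F.
pose step u := fun x => c + P1 (fun y => d + P u y) x.
pose un n := iter n step (fun=> 0).
pose vn n := fun y => d + P (un n) y.
have cstep u : continuous u -> continuous (fun y => d + P u y).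
  by move=> cu; apply: contD; [exact: contc|have [] := HP u cu].
have cun n : continuous (un n).
  elim: n => [|n IH]; first exact: contc.
  rewrite /un iterS -/(un n) /step.
  by apply: contD; [exact: contc|have [] := HP1 _ (cstep _ IH)].
have cvn n : continuous (vn n) by exact: cstep.
have dvn n x : 0 < x < l -> is_derive x 1 (vn n) (g x * un n x).
  move=> xl; have [_ _ /(_ x xl) H] := HP _ (cun n).
  by have := derD (is_derive_cst d x 1) H; rewrite add0r.
have dun n x : 0 < x < l -> is_derive x 1 (un n.+1) (vn n x).
  move=> xl; have [_ _ /(_ x xl) H] := HP1 _ (cvn n).
  by have := derD (is_derive_cst c x 1) H; rewrite add0r.
have vn0 n : vn n 0 = d by rewrite /vn; have [_ -> _] := HP _ (cun n); rewrite addr0.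
have un0 n : un n.+1 0 = c.
  by rewrite /un iterS /step; have [_ -> _] := HP1 _ (cvn n); rewrite addr0.
(* One round consists of two integrations and one factor [G]; this weight gives
   [G / mu ^ 2 <= 1 / 2]. *)
pose mu := 1 + 2 * G.
have mu0 : 0 < mu by rewrite /mu; lra.
have [A A0 HA] := bounded_on_segment (ltW l0) (contB (cun 1%N) (cun 0%N)).
have sub01 x t : 0 <= x <= l -> 0 < t < x -> 0 < t < l.
  by move=> /andP[? ?] /andP[? ?]; lra.
have pw n : 0 <= A * 2^-1 ^+ n by rewrite mulr_ge0// exprn_ge0// invr_ge0.
have vstep n B : 0 <= B ->
    (forall x, 0 <= x <= l -> `|un n.+1 x - un n x| <= B * expR (mu * x)) ->
    forall x, 0 <= x <= l -> `|vn n.+1 x - vn n x| <= G * B / mu * expR (mu * x).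
  move=> B0 HB x xl.
  have -> : vn n.+1 x - vn n x =
    (vn n.+1 x - vn n x) - (vn n.+1 0 - vn n 0) by rewrite !vn0; lra.
  apply: (exp_weight_increment (F := fun x => vn n.+1 x - vn n x)
    (f := fun x => g x * (un n.+1 x - un n x))) => //; last 2 first.
  - move=> t tx; have tl := sub01 _ _ xl tx.
    rewrite normrM -mulrA ler_pM//; first exact: (gG t tl).2.
    by apply: HB; case/andP: tl => *; rewrite !ltW.
  - exact: mulr_ge0.
  - by case/andP: xl.
  - exact: contB.
  - by move=> t tx; rewrite mulrBr; apply: derB; apply: dvn; exact: sub01 xl tx.
have ustep n B : 0 <= B ->
    (forall x, 0 <= x <= l -> `|vn n.+1 x - vn n x| <= B * expR (mu * x)) ->
    forall x, 0 <= x <= l -> `|un n.+2 x - un n.+1 x| <= B / mu * expR (mu * x).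
  move=> B0 HB x xl.
  have -> : un n.+2 x - un n.+1 x =
    (un n.+2 x - un n.+1 x) - (un n.+2 0 - un n.+1 0) by rewrite !un0; lra.
  apply: (exp_weight_increment (F := fun x => un n.+2 x - un n.+1 x)
    (f := fun x => (vn n.+1 x - vn n x))) => //.
  - by case/andP: xl.
  - exact: contB.
  - by move=> t tx; apply: derB; apply: dun; exact: sub01 xl tx.
  - by move=> t tx; apply: HB; case/andP: (sub01 _ _ xl tx) => *; rewrite !ltW.
have ubd n : forall x, 0 <= x <= l ->
    `|un n.+1 x - un n x| <= A * 2^-1 ^+ n * expR (mu * x).
  elim: n => [|n IH] x xl.
    rewrite expr0 mulr1; apply: (le_trans (HA x xl)).
    have /andP[x0 _] := xl; have ? := ltW mu0.
    by rewrite ler_peMr// -[1]expR0 ler_expR mulr_ge0.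
  have := ustep n _ _ (vstep n _ (pw n) IH) x xl.
  move=> /(_ _)/le_trans; apply; first by rewrite divr_ge0 ?mulr_ge0// ?ltW.
  rewrite ler_wpM2r ?expR_ge0//.
  rewrite ler_pdivrMr// ler_pdivrMr// exprS.
  have := pw n; rewrite (_ : A * (2^-1 * 2^-1 ^+ n) * mu * mu =
    A * 2^-1 ^+ n * (mu * mu / 2)); last by field.
  move=> p0; rewrite mulrC ler_wpM2l// /mu; nra.
have vbd n : forall x, 0 <= x <= l ->
    `|vn n.+1 x - vn n x| <= G * (A * 2^-1 ^+ n) / mu * expR (mu * x).
  exact: vstep (pw n) (ubd n).
pose E := expR (mu * l).
have leE x : 0 <= x <= l -> expR (mu * x) <= E.
  by move=> /andP[_ xl]; rewrite ler_expR ler_wpM2l// ltW.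
have cl x : 0 <= clamp l x <= l by apply: clamp_itv; exact: ltW.
have [|u cu Hu] := @geometric_limit_fun (fun n x => un n (clamp l x)) (A * E)
  (fun n => cont_comp (cun n) (@clamp_cont R l)).
  move=> n x; apply: (le_trans (ubd n _ (cl x))).
  rewrite -mulrA [_ * expR _]mulrC mulrA ler_wpM2r ?exprn_ge0 ?invr_ge0//.
  by rewrite ler_wpM2l// leE.
have [|v cv Hv] := @geometric_limit_fun (fun n x => vn n (clamp l x))
  (G * A / mu * E) (fun n => cont_comp (cvn n) (@clamp_cont R l)).
  move=> n x; apply: (le_trans (vbd n _ (cl x))).
  rewrite (_ : G * A / mu * E * 2^-1 ^+ n = G * (A * 2^-1 ^+ n) / mu * E).
    by rewrite ler_wpM2l ?leE// divr_ge0 ?mulr_ge0// ltW.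
  ring.
have Hu' n x : 0 <= x <= l -> `|u x - un n x| <= 2 * (A * E) * 2^-1 ^+ n.
  by move=> xl; have := Hu n x; rewrite (clamp_id xl).
have Hv' n x : 0 <= x <= l -> `|v x - vn n x| <= 2 * (G * A / mu * E) * 2^-1 ^+ n.
  by move=> xl; have := Hv n x; rewrite (clamp_id xl).
(* The integral equation survives the limit: its defect is compared with the one at stage [n], hence
   is [O(2^-1 ^+ n)] for every [n]. *)
have Eu x : 0 <= x <= l -> u x = c + P1 v x.
  move=> xl; have [cw w0 dw] := HP1 v cv; have [x0 xl'] := andP xl.
  apply/eqP; rewrite -subr_eq0; apply/eqP.
  apply: (@eq0_of_half_pow _ (A * E + 2 * (G * A / mu * E) * l)) => n.
  have h1 : `|(un n.+1 x - P1 v x) - (un n.+1 0 - P1 v 0)| <=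
      2 * (G * A / mu * E) * 2^-1 ^+ n * x.
    rewrite -[X in _ * X]subr0.
    apply: (lipschitz_increment (F := fun x => un n.+1 x - P1 v x)
      (f := fun t => vn n t - v t)) => //; first exact: contB.
      by move=> t tx; have tl := sub01 _ _ xl tx; apply: derB; [exact: dun|exact: dw].
    move=> t tx; rewrite distrC; apply: Hv'.
    by case/andP: (sub01 _ _ xl tx) => *; rewrite !ltW.
  rewrite un0 w0 subr0 in h1.
  have h2 := Hu' n.+1 x xl.
  have h3 : 2 * (G * A / mu * E) * 2^-1 ^+ n * x <= 2 * (G * A / mu * E) * 2^-1 ^+ n * l.
    by rewrite ler_wpM2l// !mulr_ge0// ?exprn_ge0 ?invr_ge0 ?expR_ge0// ltW.
  move: h1 h2; rewrite exprS !ler_norml; lra.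
have Ev x : 0 <= x <= l -> v x = d + P u x.
  move=> xl; have [cw w0 dw] := HP u cu; have [x0 xl'] := andP xl.
  apply/eqP; rewrite -subr_eq0; apply/eqP.
  apply: (@eq0_of_half_pow _ (2 * (G * A / mu * E) + G * (2 * (A * E)) * l)) => n.
  have h1 : `|(vn n x - P u x) - (vn n 0 - P u 0)| <=
      G * (2 * (A * E) * 2^-1 ^+ n) * x.
    rewrite -[X in _ * X]subr0.
    apply: (lipschitz_increment (F := fun x => vn n x - P u x)
      (f := fun t => g t * (un n t - u t))) => //; first exact: contB.
      move=> t tx; have tl := sub01 _ _ xl tx.
      by rewrite mulrBr; apply: derB; [exact: dvn|exact: dw].
    move=> t tx; have tl := sub01 _ _ xl tx.
    rewrite normrM ler_pM//; first exact: (gG t tl).2.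
    by rewrite distrC; apply: Hu'; case/andP: tl => *; rewrite !ltW.
  rewrite vn0 w0 subr0 in h1.
  have h2 := Hv' n x xl.
  have h3 : G * (2 * (A * E) * 2^-1 ^+ n) * x <= G * (2 * (A * E) * 2^-1 ^+ n) * l.
    by rewrite ler_wpM2l// !mulr_ge0// ?exprn_ge0 ?invr_ge0 ?expR_ge0// ltW.
  move: h1 h2; rewrite !ler_norml; lra.
have l00 : 0 <= (0 : R) <= l by rewrite lexx ltW.
exists u, v; split; last 2 first.
- by rewrite Eu//; have [_ -> _] := HP1 v cv; rewrite addr0.
- by rewrite Ev//; have [_ -> _] := HP u cu; rewrite addr0.
split=> // x xl.
  have [_ _ /(_ x xl) H] := HP1 v cv.
  apply: (@der_near _ (fun x => c + P1 v x)); last first.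
    by have := derD (is_derive_cst c x 1) H; rewrite add0r.
  have := near_itv_oo xl; apply: filterS => t /andP[t0 tl].
  by rewrite -Eu// !ltW.
have [_ _ /(_ x xl) H] := HP u cu.
apply: (@der_near _ (fun x => d + P u x)); last first.
  by have := derD (is_derive_cst d x 1) H; rewrite add0r.
have := near_itv_oo xl; apply: filterS => t /andP[t0 tl].
by rewrite -Ev// !ltW.
Qed.

End ODE.

(** * Exponentially growing and decaying solutions *)

Section Solutions.
Context {R : realType}.
Implicit Types (f g u v q Y w : R -> R) (a b c d k l x y C M Q mu : R).

Lemma expR_oppE a : expR (- a) = (expR a)^-1.
Proof. exact: expRN. Qed.

Lemma expR_2E a : expR (2 * a) = expR a ^+ 2.
Proof. by rewrite expRM_natl. Qed.

Lemma expR_neq0 a : expR a != 0.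
Proof. by rewrite gt_eqF// expR_gt0. Qed.

Definition wronskian u1 v1 u2 v2 : R -> R := fun x => u1 x * v2 x - v1 x * u2 x.

Lemma wronskian_cont l g1 g2 u1 v1 u2 v2 : sol l g1 u1 v1 -> sol l g2 u2 v2 ->
  continuous (wronskian u1 v1 u2 v2).
Proof. by move=> [? ? _ _] [? ? _ _]; apply: contB; apply: contM. Qed.

Lemma wronskian_der l g1 g2 u1 v1 u2 v2 x : sol l g1 u1 v1 -> sol l g2 u2 v2 ->
  0 < x < l ->
  is_derive x 1 (wronskian u1 v1 u2 v2) ((g2 x - g1 x) * (u1 x * u2 x)).
Proof.
move=> [_ _ du1 dv1] [_ _ du2 dv2] xl.
have := derB (derM (du1 x xl) (dv2 x xl)) (derM (dv1 x xl) (du2 x xl)).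
by move=> /is_derive_eq; apply; ring.
Qed.

Lemma sol_sub l m g u v : m <= l -> sol l g u v -> sol m g u v.
Proof.
by move=> ml [? ? du dv]; split=> // x /andP[x0 xm];
  [apply: du|apply: dv]; rewrite x0 (lt_le_trans xm).
Qed.

Lemma sol_ext l g g' u v : (forall x, 0 < x < l -> g x = g' x) ->
  sol l g u v -> sol l g' u v.
Proof.
move=> gg' [? ? du dv]; split=> // x xl; rewrite -gg'//; exact: dv.
Qed.

Lemma sol_comb l g u1 v1 u2 v2 a b : sol l g u1 v1 -> sol l g u2 v2 ->
  sol l g (fun x => a * u1 x + b * u2 x) (fun x => a * v1 x + b * v2 x).
Proof.
move=> [cu1 cv1 du1 dv1] [cu2 cv2 du2 dv2]; split.
- by apply: contD; apply: contM => //; exact: contc.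
- by apply: contD; apply: contM => //; exact: contc.
- by move=> x xl; apply: derD; apply: derZ; [exact: du1|exact: du2].
- move=> x xl; have := derD (derZ a (dv1 x xl)) (derZ b (dv2 x xl)).
  by move=> /is_derive_eq; apply; ring.
Qed.

Lemma sol_refl l g u v : sol l g u v ->
  sol l (fun x => g (l - x)) (fun x => u (l - x)) (fun x => - v (l - x)).
Proof.
move=> [cu cv du dv].
have E f : (fun x => f (l - x)) = (fun x => f (l + (-1) * x)).
  by apply/funext => x; rewrite mulN1r.
split.
- by rewrite (E u); exact: cont_affine.
- by apply: contN; rewrite (E v); exact: cont_affine.
- move=> x xl; rewrite (E u).
  have := @der_affine R u x (-1) l (v (l + (-1) * x)).
  rewrite !mulN1r; apply; apply: du; move/andP: xl => [? ?]; lra.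
- move=> x xl.
  have := @der_affine R v x (-1) l (g (l + (-1) * x) * u (l + (-1) * x)).
  rewrite !mulN1r -(E v) => H.
  have xl' : 0 < l - x < l by move/andP: xl => [? ?]; lra.
  by have := derN (H (dv _ xl')); rewrite opprK.
Qed.

(** The energy [u ^ 2 + v ^ 2] grows at rate at most [1 + G], so that [expR (- (1 + G) * t)] times
    it is nonincreasing, and it starts at zero. The rate is verified by writing the derivative as
    minus a sum of squares with weights [1], [(G - g) / 2] and [(G + g) / 2]. *)
Lemma sol_zero l g G u v : cont_bounded l G g -> sol l g u v ->
  u 0 = 0 -> v 0 = 0 -> forall x, 0 <= x <= l -> u x = 0 /\ v x = 0.
Proof.
move=> gG [cu cv du dv] u0 v0 x /andP[x0 xl].
pose E t := u t * u t + v t * v t.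
pose F t := expR (- (1 + G) * t) * E t.
have cE : continuous E by apply: contD; apply: contM.
have cF : continuous F by apply: contM => //; exact/cont_exp/cont_lin.
pose dE t := v t * u t + u t * v t + (g t * u t * v t + v t * (g t * u t)).
have dEt t : 0 < t < x -> is_derive t 1 E (dE t).
  move=> /andP[t0 tx]; have tl : 0 < t < l by rewrite t0 (lt_le_trans tx).
  by apply: derD; apply: derM; [exact: du|exact: du|exact: dv|exact: dv].
have := @le_increment R F (fun=> 0) (fun t => - (1 + G) *
  expR (- (1 + G) * t) * E t + expR (- (1 + G) * t) * dE t) (fun=> 0) 0 x x0 cF.
move=> /(_ (@contc R 0)) H.
have F0 : F 0 = 0 by rewrite /F /E u0 v0; ring.
have : F x - F 0 <= 0 - 0.
  apply: H.
  - by move=> t tx; apply: derM; [exact/der_exp/der_lin|exact: dEt].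
  move=> t /andP[t0 tx]; have tl : 0 < t < l by rewrite t0 (lt_le_trans tx).
  rewrite [X in X * _]mulrC -mulrA -mulrDr mulr_ge0_le0 ?expR_ge0//.
  have [_] := gG t tl; rewrite ler_norml => /andP[g1 g2].
  rewrite /E /dE.
  have -> : - (1 + G) * (u t * u t + v t * v t) + (v t * u t + u t * v t +
    (g t * u t * v t + v t * (g t * u t))) = - ((u t - v t) ^+ 2) -
    ((G - g t) / 2 * (u t + v t) ^+ 2 + (G + g t) / 2 * (u t - v t) ^+ 2) by field.
  rewrite -opprD oppr_le0 !addr_ge0 ?sqr_ge0// mulr_ge0 ?sqr_ge0//; lra.
rewrite F0 !subr0 => Fx.
have Ex : E x = 0.
  apply/eqP; rewrite eq_le addr_ge0 -?expr2 ?sqr_ge0// andbT.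
  by move: Fx; rewrite /F pmulr_rle0 ?expR_gt0.
move/eqP: Ex; rewrite /E -!expr2 paddr_eq0 ?sqr_ge0// !sqrf_eq0.
by move=> /andP[/eqP-> /eqP->].
Qed.

Lemma sol_unique l g G u1 v1 u2 v2 : cont_bounded l G g ->
  sol l g u1 v1 -> sol l g u2 v2 -> u1 0 = u2 0 -> v1 0 = v2 0 ->
  forall x, 0 <= x <= l -> u1 x = u2 x /\ v1 x = v2 x.
Proof.
move=> gG s1 s2 u0 v0 x xl.
have := sol_zero gG (sol_comb 1 (-1) s1 s2).
rewrite u0 v0 => /(_ _ _ x xl)[||]; [lra|lra|] => h1 h2; split; lra.
Qed.

Lemma cont_bounded_shift l Q q k : cont_bounded l Q q ->
  cont_bounded l (Q + k ^+ 2) (fun x => q x + k ^+ 2).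
Proof.
move=> qQ x xl; have [cq bq] := qQ x xl; split.
  by apply: continuousD => //; exact: cvg_cst.
by rewrite (le_trans (ler_normD _ _))// lerD// ger0_norm ?sqr_ge0.
Qed.

Lemma cont_bounded_refl l Q q : cont_bounded l Q q ->
  cont_bounded l Q (fun x => q (l - x)).
Proof.
move=> qQ x /andP[x0 xl]; have [|cq bq] := qQ (l - x); first lra.
split => //; apply: continuous_comp; last exact: cq.
by apply: continuousB; [exact: cvg_cst|exact: cvg_id].
Qed.

Lemma cont_bounded_ge0 l Q q : 0 < l -> cont_bounded l Q q -> 0 <= Q.
Proof.
move=> l0 qQ; have [|_] := qQ (l / 2); first lra.
exact: le_trans.
Qed.

(* [expR (k * x) * Y x] is the solution with Cauchy data [(1, k)] at [0], and
   [w x = expR (2 * k * x) * Y' x]. *)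
Definition growing l q k Y w := [/\ continuous Y /\ continuous w,
  Y 0 = 1, w 0 = 0,
  forall x, 0 < x < l -> is_derive x 1 Y (expR (- (2 * k) * x) * w x) &
  forall x, 0 < x < l -> is_derive x 1 w (expR (2 * k * x) * (q x * Y x))].

Lemma growing_exists l Q q k : 0 < l -> cont_bounded l Q q ->
  exists Y w, growing l q k Y w.
Proof.
move=> l0 qQ.
have [U [V [[cU cV dU dV] U0 V0]]] :=
  ode_exists 1 k l0 (cont_bounded_shift k qQ).
exists (fun x => expR (- k * x) * U x), (fun x => expR (k * x) * (V x - k * U x)).
split.
- split; first by apply: contM => //; exact/cont_exp/cont_lin.
  apply: contM; first exact/cont_exp/cont_lin.
  by apply: contB => //; apply: contM => //; exact: contc.
- by rewrite mulr0 expR0 mul1r.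
- by rewrite mulr0 expR0 V0 U0; ring.
- move=> x xl; have := derM (der_exp (der_lin x (- k))) (dU x xl).
  move=> /is_derive_eq; apply.
  rewrite !mulNr -!mulrA expR_oppE expR_oppE expR_2E.
  by field; exact: expR_neq0.
- move=> x xl; have := derM (der_exp (der_lin x k))
    (derB (dV x xl) (derZ k (dU x xl))).
  move=> /is_derive_eq; apply.
  rewrite !mulNr -!mulrA expR_oppE expR_2E.
  by field; exact: expR_neq0.
Qed.

Lemma growing_sol l q k Y w : growing l q k Y w ->
  sol l (fun x => q x + k ^+ 2) (fun x => expR (k * x) * Y x)
    (fun x => expR (k * x) * (k * Y x + expR (- (2 * k) * x) * w x)).
Proof.
move=> [[cY cw] Y0 w0 dY dw].
have ce c : continuous (fun x => expR (c * x)) by exact/cont_exp/cont_lin.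
split.
- exact: contM.
- by apply: contM => //; apply: contD; apply: contM => //; exact: contc.
- move=> x xl; have := derM (der_exp (der_lin x k)) (dY x xl).
  by move=> /is_derive_eq; apply; ring.
- move=> x xl; have := derM (der_exp (der_lin x k)) (derD (derZ k (dY x xl))
    (derM (der_exp (der_lin x (- (2 * k)))) (dw x xl))).
  move=> /is_derive_eq; apply.
  rewrite !mulNr -!mulrA expR_oppE expR_2E.
  by field; exact: expR_neq0.
Qed.

(** A bootstrap on the maximum [M] of [|Y|]: the two equations give [|Y'| <= Q * M / (2 * k)], hence
    [|Y - 1| <= M / 2] when [Q * l <= k], hence [M <= 2]; the stated bounds follow by inserting this
    value. *)
Lemma growing_bounds l Q q k Y w : 0 < l -> cont_bounded l Q q -> 0 < k ->
  Q * l <= k -> growing l q k Y w -> forall x, 0 <= x <= l ->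
  [/\ `|Y x - 1| <= Q * l / k, `|Y x| <= 2 &
    `|expR (- (2 * k) * x) * w x| <= Q / k].
Proof.
move=> l0 qQ k0 Qk [[cY cw] Y0 w0 dY dw].
have Q0 := cont_bounded_ge0 l0 qQ.
have [c cl cmax] := EVT_max (ltW l0) (continuous_subspaceT (cont_norm cY)).
have {}cl : 0 <= c <= l by move: cl; rewrite in_itv.
set M := `|Y c| in cmax.
have YM x : 0 <= x <= l -> `|Y x| <= M by move=> xl; apply: cmax; rewrite in_itv.
have M0 : 0 <= M by exact: normr_ge0.
have wM x : 0 <= x <= l -> `|expR (- (2 * k) * x) * w x| <= Q * M / (2 * k).
  move=> /andP[x0 xl].
  have : `|w x - w 0| <= Q * M / (2 * k) * expR (2 * k * x).
    apply: (exp_weight_increment (f := fun x => expR (2 * k * x) * (q x * Y x)))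
      => //; [lra| | |exact: mulr_ge0].
    - move=> t /andP[t0 tx]; apply: dw; rewrite t0; exact: lt_le_trans xl.
    - move=> t /andP[t0 tx]; have tl : t < l by exact: lt_le_trans xl.
      rewrite normrM ger0_norm ?expR_ge0// mulrC ler_wpM2r ?expR_ge0//.
      rewrite normrM ler_pM//; first by apply: (qQ t _).2; rewrite t0.
      by apply: YM; rewrite !ltW.
  rewrite w0 subr0 => H.
  rewrite normrM (ger0_norm (expR_ge0 _)) mulNr expR_oppE mulrC.
  by rewrite ler_pdivrMr ?expR_gt0.
have YM1 x : 0 <= x <= l -> `|Y x - 1| <= Q * M / (2 * k) * l.
  move=> xl; have [x0 xl'] := andP xl; rewrite -[X in `|_ - X|]Y0.
  have := @lipschitz_increment R Y (fun x => expR (- (2 * k) * x) * w x)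
    0 x (Q * M / (2 * k)) x0 cY.
  rewrite subr0 => H; apply: le_trans (H _ _) _.
  - move=> t /andP[t0 tx]; apply: dY; rewrite t0; exact: lt_le_trans xl'.
  - move=> t /andP[t0 tx]; apply: wM; rewrite ltW//=; exact/ltW/(lt_le_trans tx).
  - by rewrite ler_wpM2l// divr_ge0 ?mulr_ge0// ltW.
have M2 : M <= 2.
  have h1 := YM1 c cl.
  have h2 : Q * M / (2 * k) * l <= M / 2.
    rewrite (_ : Q * M / (2 * k) * l = M / 2 * (Q * l / k)); last first.
      by field; exact: lt0r_neq0.
    by rewrite ler_piMr ?divr_ge0// ler_pdivrMr// mul1r.
  have h3 : M <= `|Y c - 1| + 1.
    by rewrite /M -[in leLHS](subrK 1 (Y c)) (le_trans (ler_normD _ _))// normr1.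
  lra.
have QM : Q * M / (2 * k) <= Q / k.
  rewrite (_ : Q * M / (2 * k) = Q / k * (M / 2)); last by field; exact: lt0r_neq0.
  by rewrite ler_piMr ?divr_ge0 ?(ltW k0)// ler_pdivrMr// mul1r.
move=> x xl; split.
- apply: (le_trans (YM1 x xl)).
  by rewrite [in leRHS]mulrAC ler_wpM2r// ltW.
- exact: le_trans (YM x xl) M2.
- exact: le_trans (wM x xl) QM.
Qed.

End Solutions.

(** * The Dirichlet-to-Neumann map of an edge *)

Section EdgeDN.
Context {R : realType}.
Implicit Types (f g u v q Y w : R -> R) (a b c d k l x y C K M Q : R).

(** The growing solution of the reflected potential, read backwards and scaled by [expR (- k * l)].
    Its logarithmic derivative at [l] is exactly [- k]. *)
Lemma decaying_sol l q k Y w : growing l (fun x => q (l - x)) k Y w ->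
  sol l (fun x => q x + k ^+ 2) (fun x => expR (- k * x) * Y (l - x))
    (fun x => - (expR (- k * x) *
      (k * Y (l - x) + expR (- (2 * k) * (l - x)) * w (l - x)))).
Proof.
move=> gY; have s := sol_refl (growing_sol gY).
have {}s := sol_ext (g' := fun x => q x + k ^+ 2) (fun x _ =>
  congr1 (fun y => q y + k ^+ 2) (subKr l x)) s.
have := sol_comb (expR (- k * l)) 0 s s.
have E x : expR (- k * l) * expR (k * (l - x)) = expR (- k * x).
  by rewrite -expRD; congr expR; ring.
congr (sol _ _ _ _); apply/funext => x; rewrite -(E x); ring.
Qed.

Lemma expR_le_inv x : 0 < x -> expR (- x) <= x^-1.
Proof.
move=> x0; rewrite expR_oppE lef_pV2 ?posrE ?expR_gt0//.
by have := expR_ge1Dx x; lra.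
Qed.

Lemma expR_le_inv2 k l : 0 < k -> 0 < l ->
  k * expR (- k * l) <= 4 / l ^+ 2 / k.
Proof.
move=> k0 l0; have kl : 0 < k * l / 2 by rewrite divr_gt0// mulr_gt0.
have h := expR_le_inv kl.
rewrite (_ : expR (- k * l) = expR (- (k * l / 2)) ^+ 2); last first.
  by rewrite -expR_2E; congr expR; field.
apply: (@le_trans _ _ (k * ((k * l / 2)^-1 ^+ 2))).
  by rewrite ler_wpM2l ?(ltW k0)// lerXn2r// nnegrE ?expR_ge0 ?invr_ge0 ?ltW.
by rewrite le_eqVlt; apply/orP; left; apply/eqP; field; rewrite !lt0r_neq0.
Qed.

(** Derivatives are taken in the direction of increasing [x], whence the signs. A single [be] for
    both ends expresses the symmetry of the Dirichlet-to-Neumann matrix. When [g] is the constant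
    [k ^ 2], [al = ga = k coth (k l)] and [be = k / sinh (k l)]. *)
Definition dn_map l g al be ga := forall A B, exists u v,
  [/\ sol l g u v, u 0 = A, u l = B, v 0 = - al * A + be * B &
      v l = - be * A + ga * B].

(** The exponential bound on [be] feeds the local uniqueness argument, the bound [C / k] the linear
    algebra at the vertices. *)
Definition dn_bounds l k C al be ga := [/\ `|al - k| <= C / k,
  `|ga - k| <= C / k, 0 < be, be <= C * k * expR (- k * l) & be <= C / k].

(** The decaying solution [psi] and the growing solution [chi], scaled to be about [1] at [l], form
    a basis with end values close to the identity matrix; inverting that matrix, of determinant [D],
    gives the coefficients. *)
Lemma edge_dn l Q q : 0 < l -> cont_bounded l Q q ->
  exists C K, [/\ 0 < C, 0 < K & forall k, K <= k -> exists al be ga,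
    dn_map l (fun x => q x + k ^+ 2) al be ga /\ dn_bounds l k C al be ga].
Proof.
move=> l0 qQ; have Q0 := cont_bounded_ge0 l0 qQ.
(* For [k] beyond [K], the amplitudes [y0], [yl] lie within [1 / 4] of [1] and [e <= 1 / 4], so that
   the determinant is at least [(3 / 4) ^ 2 - (1 / 4) ^ 2 = 1 / 2]. The term [4 / l ^ 2] in [C]
   comes from bounding [k * e] by [4 / l ^ 2 / k]. *)
pose K := 1 + 4 * (Q * l) + 4 * Q + 4 / l.
pose C := (5 + 5 * Q) * (1 + 4 / l ^+ 2).
have Ql0 : 0 <= Q * l by rewrite mulr_ge0// ltW.
have il0 : 0 < 4 / l by rewrite divr_gt0.
have il2 : 0 < 4 / l ^+ 2 by rewrite divr_gt0// exprn_gt0.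
exists C, K; split; [by rewrite mulr_gt0//; lra|rewrite /K; lra|].
move=> k Kk; have k0 : 0 < k by move: Kk; rewrite /K; lra.
have k1 : 1 <= k by move: Kk; rewrite /K; lra.
have Qlk : 4 * (Q * l) <= k by move: Kk; rewrite /K; lra.
have Qk4 : 4 * Q <= k by move: Kk; rewrite /K; lra.
have lk : 4 / l <= k by move: Kk; rewrite /K; lra.
have kl4 : 4 <= k * l by rewrite -ler_pdivrMr.
have [Y [w gY]] := growing_exists k l0 qQ.
have [Yr [wr gYr]] := growing_exists k l0 (cont_bounded_refl qQ).
have Qlk' : Q * l <= k by lra.
have ll : 0 <= l <= l by rewrite lexx ltW.
have [Yl1 _ dl] := growing_bounds l0 qQ k0 Qlk' gY ll.
have [Yr1 _ dr] := growing_bounds l0 (cont_bounded_refl qQ) k0 Qlk' gYr ll.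
have sp := decaying_sol gYr.
have sc := sol_comb (expR (- k * l)) 0 (growing_sol gY) (growing_sol gY).
have [[cY cw] Y0 w0 _ _] := gY; have [[cYr cwr] Yr0 wr0 _ _] := gYr.
set psi := fun x => expR (- k * x) * Yr (l - x) in sp.
set dpsi := fun x => - _ in sp.
set chi := fun x => _ + 0 * _ in sc.
set dchi := fun x => _ + 0 * _ in sc.
pose e := expR (- k * l).
pose y0 := Yr l; pose yl := Y l.
pose d0 := expR (- (2 * k) * l) * wr l; pose d1 := expR (- (2 * k) * l) * w l.
have ee : e * expR (k * l) = 1 by rewrite -expRD mulNr addNr expR0.
have psi0 : psi 0 = y0 by rewrite /psi mulr0 expR0 subr0 mul1r.
have dpsi0 : dpsi 0 = - (k * y0 + d0) by rewrite /dpsi mulr0 expR0 subr0 mul1r.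
have psil : psi l = e by rewrite /psi subrr Yr0 mulr1.
have dpsil : dpsi l = - (k * e) by rewrite /dpsi subrr Yr0 wr0 -/e; ring.
have chi0 : chi 0 = e by rewrite /chi mulr0 expR0 Y0 -/e; ring.
have dchi0 : dchi 0 = k * e by rewrite /dchi !mulr0 expR0 Y0 w0 -/e; ring.
have chil : chi l = yl by rewrite /chi -/e mulrA ee /yl; ring.
have dchil : dchi l = k * yl + d1 by rewrite /dchi -/e mulrA ee /yl /d1; ring.
(* The Wronskian of [psi] and [chi] at the two ends; this makes the off-diagonal coefficients
   agree. *)
have We : e * (2 * k * yl + d1) = e * (2 * k * y0 + d0).
  have cW := wronskian_cont sp sc.
  have := @constant_increment R _ 0 l (ltW l0) cW.
  rewrite /wronskian psi0 dpsi0 chi0 dchi0 psil dpsil chil dchil => H.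
  have : e * (k * yl + d1) - - (k * e) * yl = y0 * (k * e) - - (k * y0 + d0) * e.
    apply: H => x xl; have := wronskian_der sp sc xl.
    by move=> /is_derive_eq; apply; ring.
  by move=> {}H; lra.
have e0 : 0 < e by exact: expR_gt0.
have Qlk4 : Q * l / k <= 1 / 4 by rewrite ler_pdivrMr//; lra.
have y0b : 3 / 4 <= y0 <= 5 / 4.
  by move: (le_trans Yr1 Qlk4); rewrite ler_norml -/y0; lra.
have ylb : 3 / 4 <= yl <= 5 / 4.
  by move: (le_trans Yl1 Qlk4); rewrite ler_norml -/yl; lra.
have e4 : e <= 1 / 4.
  rewrite /e mulNr; apply: (le_trans (expR_le_inv _)); first by rewrite mulr_gt0.
  by rewrite div1r lef_pV2 ?posrE// mulr_gt0.
have D2 : 1 / 2 <= y0 * yl - e ^+ 2 by rewrite expr2; nra.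
pose D := y0 * yl - e ^+ 2.
have D0 : D != 0 by rewrite gt_eqF// (lt_le_trans _ D2)// divr_gt0.
pose al := (yl * (k * y0 + d0) + k * e ^+ 2) / D.
pose ga := (y0 * (k * yl + d1) + k * e ^+ 2) / D.
pose be := e * (2 * k * y0 + d0) / D.
exists al, be, ga; split.
  move=> A B; pose a := (yl * A - e * B) / D; pose b := (y0 * B - e * A) / D.
  exists (fun x => a * psi x + b * chi x), (fun x => a * dpsi x + b * dchi x).
  split.
  - exact: sol_comb.
  - by rewrite psi0 chi0 /a /b /D; field.
  - by rewrite psil chil /a /b /D; field.
  - by rewrite dpsi0 dchi0 /a /b /al /be /D; field.
  - rewrite dpsil dchil /ga /be -We /a /b /D; field; exact: D0.
have Di : 0 < D^-1 <= 2.
  rewrite invr_gt0 -[X in _ <= X]invrK lef_pV2 ?posrE ?invr_gt0//.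
    by rewrite (lt_le_trans _ D2) ?divr_gt0//= -div1r.
  by rewrite (lt_le_trans _ D2) ?divr_gt0.
have [Di0 Di2] := andP Di.
have Qk0 : 0 <= Q / k by rewrite divr_ge0// ltW.
have ke := expR_le_inv2 k0 l0; rewrite -/e in ke.
have ke2 : k * e ^+ 2 <= 4 / l ^+ 2 / k / 4.
  rewrite expr2 mulrA (_ : _ / 4 = 4 / l ^+ 2 / k * (1 / 4)).
    by rewrite ler_pM// ?mulr_ge0// ltW.
  by rewrite div1r.
have ke20 : 0 <= k * e ^+ 2 by rewrite mulr_ge0 ?sqr_ge0// ltW.
have Qt0 : 0 <= Q * (4 / l ^+ 2) by rewrite mulr_ge0// ltW.
have Ck : (5 / 4 * (Q / k) + 4 / l ^+ 2 / k / 2) * 2 <= C / k.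
  rewrite [leLHS](_ : _ = (5 / 2 * Q + 4 / l ^+ 2) / k); last first.
    by rewrite mulrDl; field; rewrite !lt0r_neq0.
  rewrite ler_wpM2r ?invr_ge0 ?(ltW k0)// /C.
  by move: Q0 Qt0 il2; clear; lra.
have key y d : 3 / 4 <= y <= 5 / 4 -> `|d| <= Q / k ->
    `|(y * d + 2 * (k * e ^+ 2)) / D| <= C / k.
  move=> /andP[y3 y5] dQ; rewrite normrM (ger0_norm (ltW Di0)).
  apply: le_trans Ck.
  have h1 : `|y * d + 2 * (k * e ^+ 2)| <= 5 / 4 * (Q / k) + 4 / l ^+ 2 / k / 2.
    have y0' : 0 <= y by apply: le_trans y3; rewrite divr_ge0.
    apply: (le_trans (ler_normD _ _)); apply: lerD.
      by rewrite normrM ler_pM// ger0_norm.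
    by rewrite ger0_norm; [clear - ke2; lra|rewrite mulr_ge0].
  by apply: ler_pM => //; exact: ltW.
have Qk : Q / k <= Q by rewrite ler_pdivrMr// ler_peMr.
have [d0a d0b] : - Q <= d0 /\ d0 <= Q.
  by move: (le_trans dr Qk); rewrite -/d0 ler_norml => /andP[].
have [y03 y05] := andP y0b.
have ky1 : k * (3 / 4) <= k * y0 by rewrite ler_wpM2l// ltW.
have ky2 : k * y0 <= k * (5 / 4) by rewrite ler_wpM2l// ltW.
have z0 : 0 < 2 * k * y0 + d0 by clear - ky1 d0a Qk4 k1; lra.
have z1 : 2 * k * y0 + d0 <= (5 / 2 + Q) * k.
  have : Q <= Q * k by rewrite ler_peMr.
  clear - ky2 d0b; lra.
have be0 : 0 < be by rewrite /be mulr_gt0// mulr_gt0.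
have beb : be <= (5 + 2 * Q) * (k * e).
  rewrite (_ : (5 + 2 * Q) * (k * e) = e * ((5 / 2 + Q) * k) * 2); last by field.
  by rewrite ler_pM// ?mulr_ge0 ?(ltW e0) ?(ltW z0) ?(ltW Di0)// ler_wpM2l// ltW.
have Q5 : 0 <= 5 + 2 * Q by clear - Q0; lra.
have ke0 : 0 <= k * e by rewrite mulr_ge0// ltW.
split => //.
- rewrite (_ : al - k = (yl * d0 + 2 * (k * e ^+ 2)) / D); first exact: key.
  by rewrite /al /D; field.
- rewrite (_ : ga - k = (y0 * d1 + 2 * (k * e ^+ 2)) / D); first exact: key.
  by rewrite /ga /D; field.
- apply: (le_trans beb); rewrite -mulrA ler_wpM2r// /C.
  by move: Q0 Qt0 il2; clear; lra.
- apply: (le_trans beb); apply: (le_trans (ler_wpM2l Q5 ke)).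
  rewrite mulrA ler_wpM2r ?invr_ge0 ?(ltW k0)// /C.
  by move: Q0 Qt0 il2; clear; lra.
Qed.

End EdgeDN.

(** * Laplace densities by duality *)

Section Density.
Context {R : realType}.
Implicit Types (f g u v q : R -> R) (a b k l x y C K M Q s t : R).
Implicit Types (Y w : nat -> R -> R) (c ks : nat -> R) (om dom : R -> R).

(* A finite linear combination of point evaluations in the variable [k], at the
   nodes [ks i]. *)
Definition pairing (n : nat) c (F : nat -> R) := \sum_(i < n) c i * F i.

Definition laplace n c ks s := pairing n c (fun i => expR (- ks i * s)).

(** [om] plays the part of a primitive of [|laplace|]: its increments bound the L1 norm of the
    Laplace sum over subintervals, the norm to which bounded densities are dual. *)
Definition majorizes n c ks om dom (L : R) :=
  forall s, 0 < s < L -> is_derive s 1 om (dom s) /\ `|laplace n c ks s| <= dom s.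

Lemma majorizes_incr n c ks om dom L s t : continuous om ->
  majorizes n c ks om dom L -> 0 <= s -> s <= t -> t <= L -> om s <= om t.
Proof.
move=> com H s0 st tL.
have := @le_increment R (fun=> 0) om (fun=> 0) dom s t st (@contc R 0) com.
rewrite subrr subr_ge0; apply.
  by move=> x /andP[sx xt]; apply: (H x _).1; rewrite (le_lt_trans s0 sx) (lt_le_trans xt).
move=> x /andP[sx xt]; apply: le_trans (normr_ge0 _) (H x _).2.
by rewrite (le_lt_trans s0 sx) (lt_le_trans xt).
Qed.

Lemma laplace_shift n c ks s t :
  laplace n (fun i => c i * expR (- ks i * t)) ks s = laplace n c ks (s + t).
Proof.
apply: eq_bigr => i _; rewrite -mulrA -expRD; congr (_ * expR _); ring.
Qed.

(* The bound is uniform in the functional: it says that, as a function of the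
   spectral variable [k], [Y - 1] is the Laplace transform of a density bounded by
   [C] and supported in [[0, 2 * x]]; the norm is computed by duality, so no
   transformation kernel is needed. *)
Lemma growing_density l Q q : 0 < l -> cont_bounded l Q q ->
  exists C, 0 <= C /\ forall n c ks Y w om dom, continuous om ->
  (forall i : nat, 0 < ks i /\ Q * l <= ks i) ->
  (forall i, growing l q (ks i) (Y i) (w i)) ->
  majorizes n c ks om dom (2 * l) -> forall x, 0 <= x <= l ->
  `|pairing n c (fun i => Y i x - 1)| <= C * (om (2 * x) - om 0).
Proof.
move=> l0 qQ; have Q0 := cont_bounded_ge0 l0 qQ.
pose mu := 1 + 2 * Q; have mu0 : 0 < mu by rewrite /mu; lra.
have Ql0 : 0 <= Q * l by rewrite mulr_ge0// ltW.
exists (expR (mu * l) * (Q * l)); split; first by rewrite mulr_ge0 ?expR_ge0.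
move=> n c ks Y w om dom com ksP gr maj.
have incr := majorizes_incr com maj.
pose nn x t := pairing n c (fun i => expR (- ks i * t) * (Y i x - 1)).
pose B := \sum_(i < n) `|c i| * 3.
have B0 : 0 <= B by apply: sumr_ge0 => i _; rewrite mulr_ge0.
(* Another Picard iteration with exponential weight. The bound [B] depends on the functional, but
   its contribution is halved in each round and disappears in the limit. All translates [t] are
   treated together because the integrations below move [t]. *)
have claim j : forall x t, 0 <= x -> 0 <= t -> t + 2 * x <= 2 * l ->
    `|nn x t| <= expR (mu * x) *
      (Q * l * (om (t + 2 * x) - om t) + B * 2^-1 ^+ j).
  elim: j => [|j IH] x t x0 t0 tx.
    have xl : 0 <= x <= l by lra.
    have h1 : `|nn x t| <= B.
      apply: le_trans (ler_norm_sum _ _ _) _; apply: ler_sum => i _.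
      rewrite normrM ler_wpM2l// normrM ger0_norm ?expR_ge0//.
      have [ki Qk] := ksP i.
      have [_ Y2 _] := growing_bounds l0 qQ ki Qk (gr i) xl.
      rewrite -[3]mul1r ler_pM ?expR_ge0//.
        by rewrite -[leRHS]expR0 ler_expR mulNr oppr_le0 mulr_ge0// ltW.
      by rewrite (le_trans (ler_normB _ _))// normr1; lra.
    apply: (le_trans h1); rewrite expr0 mulr1.
    have h2 : B <= Q * l * (om (t + 2 * x) - om t) + B.
      by rewrite lerDr mulr_ge0// subr_ge0; apply: incr => //; lra.
    apply: (le_trans h2); rewrite ler_peMl//.
      exact: le_trans B0 h2.
    by rewrite -[leLHS]expR0 ler_expR mulr_ge0// ltW.
  pose W := om (t + 2 * x) - om t.
  pose H := Q * l * W + B * 2^-1 ^+ j.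
  have W0 : 0 <= W by rewrite subr_ge0; apply: incr => //; lra.
  have H0 : 0 <= H.
    by rewrite addr_ge0 ?mulr_ge0 ?exprn_ge0 ?invr_ge0// ltW.
  pose vv r := pairing n c (fun i => expR (- ks i * (t + 2 * r)) * w i r).
  (* The factor [expR (2 * k * z)] in the equation for [w] becomes a translation by [- 2 * z]; the
     translated argument [sg - 2 * z] stays between [t] and [t + 2 * r], where the induction
     hypothesis applies. *)
  have vvE r : 0 < r < x -> `|vv r| <= Q / 2 * W + Q * H / mu * expR (mu * r).
    move=> /andP[r0 rx]; pose sg := t + 2 * r.
    have := @norm_increment R
      (fun z => pairing n c (fun i => expR (- ks i * sg) * w i z))
      (fun z => - (Q / 2) * om (sg + (-2) * z) + Q * H / mu * expR (mu * z))
      (fun z => q z * (laplace n c ks (sg + (-2) * z) + nn z (sg + (-2) * z)))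
      (fun z => Q * dom (sg + (-2) * z) + Q * H * expR (mu * z)) 0 r (ltW r0).
    move=> /(_ _ _ _ _ _) H1.
    have w00 : pairing n c (fun i => expR (- ks i * sg) * w i 0) = 0.
      by apply: big1 => i _; have [_ _ -> _ _] := gr i; rewrite !mulr0.
    have {H1} : `|vv r - 0| <=
        - (Q / 2) * om (sg + (-2) * r) + Q * H / mu * expR (mu * r) -
        (- (Q / 2) * om (sg + (-2) * 0) + Q * H / mu * expR (mu * 0)).
      rewrite -{1}w00; apply: H1.
      - apply: (@cont_sum R n (fun i z => c i * (expR (- ks i * sg) * w i z))) => i.
        apply: contM; first exact: contc.
        by apply: contM; [exact: contc|have [[_ ?] _ _ _ _] := gr i].
      - apply: contD; apply: contM; try exact: contc; first exact: cont_affine.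
        exact/cont_exp/cont_lin.
      - move=> z /andP[z0 zr]; have zl : 0 < z < l by lra.
        have := @der_sum R n (fun i z => c i * (expR (- ks i * sg) * w i z))
          (fun i => c i * (expR (- ks i * sg) *
             (expR (2 * ks i * z) * (q z * Y i z)))) z.
        move=> /(_ _)/is_derive_eq; apply.
          by move=> i; do 2 apply: derZ; have [_ _ _ _] := gr i; exact.
        rewrite /laplace /nn /pairing -big_split/= mulr_sumr.
        apply: eq_bigr => i _.
        have -> : expR (- ks i * (sg + -2 * z)) =
            expR (- ks i * sg) * expR (2 * ks i * z).
          by rewrite -expRD; congr expR; ring.
        ring.
      - move=> z /andP[z0 zr].
        have dz : 0 < sg + (-2) * z < 2 * l by rewrite /sg; lra.
        have [d1 _] := maj _ dz.
        have := derD (derZ (- (Q / 2)) (der_affine d1))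
          (derZ (Q * H / mu) (der_exp (der_lin z mu))).
        by move=> /is_derive_eq; apply; field; exact: lt0r_neq0.
      - move=> z /andP[z0 zr]; have zl : 0 < z < l by lra.
        have dz : 0 < sg + (-2) * z < 2 * l by rewrite /sg; lra.
        have [_ d1] := maj _ dz.
        rewrite normrM -mulrA -mulrDr ler_pM//; first exact: (qQ z zl).2.
        apply: (le_trans (ler_normD _ _)); apply: lerD => //.
        have [dz1 dz2] := andP dz.
        apply: le_trans (IH z _ (ltW z0) (ltW dz1) _) _; first by rewrite /sg; lra.
        rewrite mulrC ler_wpM2r ?expR_ge0// lerD2r ler_wpM2l//.
        by apply: lerB; apply: incr; rewrite /sg; lra.
    rewrite subr0 => H1; apply: (le_trans H1).
    have h1 : om t <= om (t + 2 * r) by apply: incr => //; lra.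
    have h2 : om (t + 2 * r) <= om (t + 2 * x) by apply: incr; lra.
    rewrite mulr0 addr0 mulr0 expR0 (_ : sg + -2 * r = t); last by rewrite /sg; lra.
    have h3 : 0 <= Q * H / mu by rewrite divr_ge0 ?mulr_ge0// ltW.
    rewrite -/sg in h1 h2 *.
    have h4 : Q / 2 * (om sg - om t) <= Q / 2 * W.
      by rewrite ler_wpM2l ?divr_ge0// lerD2r.
    clear - h3 h4; lra.
  have Hx : `|nn x t - nn 0 t| <=
      (Q / 2 * W * x + Q * H / mu / mu * expR (mu * x)) -
      (Q / 2 * W * 0 + Q * H / mu / mu * expR (mu * 0)).
    apply: (@norm_increment R (nn^~ t)
      (fun r => Q / 2 * W * r + Q * H / mu / mu * expR (mu * r))
      vv (fun r => Q / 2 * W + Q * H / mu * expR (mu * r))) => //.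
    - apply: (@cont_sum R n (fun i z => c i * (expR (- ks i * t) * (Y i z - 1)))) => i.
      apply: contM; first exact: contc.
      apply: contM; first exact: contc.
      by apply: contB; [have [[? _] _ _ _ _] := gr i|exact: contc].
    - apply: contD; first exact: cont_lin.
      by apply: contM; [exact: contc|exact/cont_exp/cont_lin].
    - move=> r /andP[r0 rx]; have rl : 0 < r < l by lra.
      have := @der_sum R n (fun i z => c i * (expR (- ks i * t) * (Y i z - 1)))
        (fun i => c i * (expR (- ks i * t) *
          (expR (- (2 * ks i) * r) * w i r - 0))) r.
      move=> /(_ _)/is_derive_eq; apply.
        move=> i; do 2 apply: derZ; apply: derB.
        by have [_ _ _ + _] := gr i; exact.
      apply: eq_bigr => i _; rewrite subr0.
      have -> : expR (- ks i * (t + 2 * r)) =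
          expR (- ks i * t) * expR (- (2 * ks i) * r).
        by rewrite -expRD; congr expR; ring.
      ring.
    - move=> r rx; apply: derD; first exact: der_lin.
      have := derZ (Q * H / mu / mu) (der_exp (der_lin r mu)).
      by move=> /is_derive_eq; apply; field; exact: lt0r_neq0.
  have nn0 : nn 0 t = 0.
    by apply: big1 => i _; have [_ -> _ _ _] := gr i; rewrite subrr !mulr0.
  rewrite nn0 subr0 in Hx; apply: (le_trans Hx).
  rewrite !mulr0 expR0 mulr1 add0r.
  have e1 : 1 <= expR (mu * x) by rewrite -[leLHS]expR0 ler_expR mulr_ge0// ltW.
  have h3 : 0 <= Q * H / mu / mu by rewrite !divr_ge0 ?mulr_ge0// ltW.
  have h4 : Q * H / mu / mu <= H / 2.
    rewrite !ler_pdivrMr// -mulrA mulrC [H / 2 * _]mulrAC -!mulrA ler_wpM2l//.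
    by rewrite /mu; clear - Q0; nra.
  have h5 : Q / 2 * W * x <= expR (mu * x) * (Q / 2 * l * W).
    have : Q / 2 * W * x <= Q / 2 * l * W.
      by rewrite mulrAC ler_wpM2r// ler_wpM2l ?divr_ge0//; lra.
    move=> /le_trans; apply; rewrite ler_peMl// !mulr_ge0 ?divr_ge0// ltW//.
  have h6 : Q * H / mu / mu * expR (mu * x) <= expR (mu * x) * (H / 2).
    by rewrite mulrC ler_wpM2l// expR_ge0.
  have -> : expR (mu * x) * (Q * l * (om (t + 2 * x) - om t) + B * 2^-1 ^+ j.+1)
     = expR (mu * x) * (Q / 2 * l * W) + expR (mu * x) * (H / 2).
    by rewrite /H exprS -/W; field.
  by clear - h3 h5 h6; lra.
move=> x /andP[x0 xl].
have E : pairing n c (fun i => Y i x - 1) = nn x 0.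
  by apply: eq_bigr => i _; rewrite mulr0 expR0 mul1r.
rewrite E; apply/ler_addgt0Pr => e e0.
have [j Hj] := half_pow_small (expR (mu * x) * B) e0.
have : `|nn x 0| <= _ := claim j x 0 x0 (lexx 0) _.
rewrite add0r => /(_ _)/le_trans; apply; first lra.
rewrite mulrDr mulrA [in leLHS]mulrA lerD// ?mulrA//.
rewrite -!mulrA ler_wpM2r//.
  by rewrite !mulr_ge0 ?(ltW l0)// subr_ge0; apply: incr => //; lra.
by rewrite ler_expR ler_wpM2l// ltW.
Qed.

End Density.

(** * Partial sums of the exponential series *)

Section ExpSums.
Context {R : realType}.
Implicit Types (x B e C : R).

Lemma exp_series_cvg x : (fun n => \sum_(j < n) x ^+ j / j`!%:R) @ \oo --> expR x.
Proof.
rewrite (_ : (fun n => \sum_(j < n) x ^+ j / j`!%:R) = series (exp_coeff x)).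
  exact: (is_cvg_series_exp_coeff x).
by apply/funext => n; rewrite /series/= big_mkord.
Qed.

Lemma exp_sum_le B n : 0 <= B -> \sum_(j < n) B ^+ j / j`!%:R <= expR B.
Proof.
move=> B0.
have h : nondecreasing_seq (fun n => \sum_(j < n) B ^+ j / j`!%:R).
  apply/nondecreasing_seqP => m; rewrite big_ord_recr/= lerDl.
  by rewrite divr_ge0// exprn_ge0.
have := nondecreasing_cvgn_le h (cvgP _ (exp_series_cvg (x := B))) n.
by rewrite (cvg_lim _ (exp_series_cvg (x := B))).
Qed.

(** On [[0, B]] the tails of the alternating series are dominated by the tail of the series of
    [expR B], so one number of terms serves all [x]. *)
Lemma exp_sum_approx B e : 0 <= B -> 0 < e -> exists n, forall x, 0 <= x <= B ->
  `|\sum_(j < n) (- x) ^+ j / j`!%:R - expR (- x)| <= e.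
Proof.
move=> B0 e0.
have /cvgrPdist_le/(_ e e0)[n _ /(_ n (leqnn n))/= Hn] := exp_series_cvg (x := B).
exists n => x /andP[x0 xB].
have H m : (n <= m)%N ->
    `|\sum_(j < n) (- x) ^+ j / j`!%:R - \sum_(j < m) (- x) ^+ j / j`!%:R| <= e.
  move=> nm.
  have D (F : nat -> R) : \sum_(j < n) F j - \sum_(j < m) F j =
      - \sum_(n <= j < m) F j.
    rewrite -!(big_mkord xpredT F) (big_cat_nat (leq0n n) nm)/=.
    by rewrite opprD addrA subrr add0r.
  rewrite (D (fun j => (- x) ^+ j / j`!%:R)) normrN; apply: le_trans Hn.
  apply: le_trans (ler_norm _); rewrite lerBrDl.
  apply: le_trans (exp_sum_le m B0).
  rewrite -!(big_mkord xpredT (fun j => B ^+ j / j`!%:R)).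
  rewrite (big_cat_nat (leq0n n) nm)/= lerD2l.
  apply: le_trans (ler_norm_sum _ _ _) _; apply: ler_sum => i _.
  rewrite normrM normrX normrN (ger0_norm x0) ger0_norm ?invr_ge0//.
  by rewrite ler_wpM2r ?invr_ge0// lerXn2r// nnegrE.
apply/ler_addgt0Pr => d d0.
have /cvgrPdist_le/(_ d d0)[m _ Hm] := exp_series_cvg (x := - x).
have := H _ (leq_maxl n m); have := Hm _ (leq_maxr n m) => /=.
move: (\sum_(j < maxn n m) _) => S; rewrite !ler_norml; lra.
Qed.

End ExpSums.

(** * Densities of products and approximate inversion of the Laplace transform *)

Section BorgMarchenko.
Context {R : realType}.
Implicit Types (f g u v q : R -> R) (a b k l x y A C K M Q s t : R).
Implicit Types (Y w : nat -> R -> R) (c ks : nat -> R) (om dom : R -> R).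

(** With [Yi = 1 + yi], the product minus [1] is [y1 * y2 + y1 + y2]. The convolution [y1 * y2] is
    tested by absorbing [y2] into the coefficients and applying the bound for [y1] to the new
    functional. *)
Lemma product_density l1 Q1 q1 l2 Q2 q2 : 0 < l1 -> 0 < l2 ->
  cont_bounded l1 Q1 q1 -> cont_bounded l2 Q2 q2 ->
  exists C, 0 <= C /\ forall n c ks Y1 w1 Y2 w2 om dom, continuous om ->
  (forall i : nat, [/\ 0 < ks i, Q1 * l1 <= ks i & Q2 * l2 <= ks i]) ->
  (forall i, growing l1 q1 (ks i) (Y1 i) (w1 i)) ->
  (forall i, growing l2 q2 (ks i) (Y2 i) (w2 i)) ->
  majorizes n c ks om dom (2 * (l1 + l2)) ->
  forall x1 x2, 0 <= x1 <= l1 -> 0 <= x2 <= l2 ->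
  `|pairing n c (fun i => Y1 i x1 * Y2 i x2 - 1)| <=
    C * (om (2 * (l1 + l2)) - om 0).
Proof.
move=> l10 l20 qQ1 qQ2.
have [C1 [C10 H1]] := growing_density l10 qQ1.
have [C2 [C20 H2]] := growing_density l20 qQ2.
exists (C1 * (C2 * (2 * l1)) + C1 + C2); split.
  by rewrite !addr_ge0// !mulr_ge0// ltW.
move=> n c ks Y1 w1 Y2 w2 om dom com ksP g1 g2 maj x1 x2 x1l x2l.
have incr := majorizes_incr com maj.
have [x10 x1l'] := andP x1l; have [x20 x2l'] := andP x2l.
have majS L : L <= 2 * (l1 + l2) -> majorizes n c ks om dom L.
  by move=> LL s /andP[s0 sL]; apply: maj; rewrite s0 (lt_le_trans sL).
have ks1 i : 0 < ks i /\ Q1 * l1 <= ks i by have [] := ksP i.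
have ks2 i : 0 < ks i /\ Q2 * l2 <= ks i by have [] := ksP i.
set D := om (2 * (l1 + l2)) - om 0.
have B1 : `|pairing n c (fun i => Y1 i x1 - 1)| <= C1 * D.
  apply: le_trans (H1 n c ks Y1 w1 om dom com ks1 g1 _ x1 x1l) _.
    by apply: majS; lra.
  by rewrite ler_wpM2l// lerD2r; apply: incr; lra.
have B2 : `|pairing n c (fun i => Y2 i x2 - 1)| <= C2 * D.
  apply: le_trans (H2 n c ks Y2 w2 om dom com ks2 g2 _ x2 x2l) _.
    by apply: majS; lra.
  by rewrite ler_wpM2l// lerD2r; apply: incr; lra.
have D0 : 0 <= D by rewrite subr_ge0; apply: incr; lra.
(* The Laplace sum of the new functional at [s] is the pairing of [y2] with the functional
   translated by [s], hence bounded by the constant [C2 * D]; its majorant is therefore linear. *)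
have B3 : `|pairing n (fun i => c i * (Y2 i x2 - 1)) (fun i => Y1 i x1 - 1)| <=
    C1 * (C2 * (2 * l1)) * D.
  apply: le_trans (H1 n _ ks Y1 w1 (fun s => C2 * D * s) (fun=> C2 * D)
    (@cont_lin R _) ks1 g1 _ x1 x1l) _; last first.
    rewrite mulr0 subr0 -!mulrA ler_wpM2l// ler_wpM2l// [leLHS]mulrC.
    by rewrite mulrA ler_wpM2r//; lra.
  move=> s /andP[s0 sl]; split; first exact: der_lin.
  have -> : laplace n (fun i => c i * (Y2 i x2 - 1)) ks s =
      pairing n (fun i => c i * expR (- ks i * s)) (fun i => Y2 i x2 - 1).
    by apply: eq_bigr => i _; ring.
  apply: le_trans (H2 n _ ks Y2 w2 (fun r => om (s + 1 * r))
    (fun r => 1 * dom (s + 1 * r)) _ ks2 g2 _ x2 x2l) _.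
  - exact: cont_affine.
  - move=> r /andP[r0 rl]; have rs : 0 < s + 1 * r < 2 * (l1 + l2) by lra.
    have [d1 d2] := maj _ rs.
    split; first exact: der_affine.
    rewrite laplace_shift [leRHS]mul1r (_ : r + s = s + 1 * r)//; ring.
  - by rewrite ler_wpM2l//; apply: lerB; apply: incr; lra.
have -> : pairing n c (fun i => Y1 i x1 * Y2 i x2 - 1) =
    pairing n (fun i => c i * (Y2 i x2 - 1)) (fun i => Y1 i x1 - 1) +
    pairing n c (fun i => Y1 i x1 - 1) + pairing n c (fun i => Y2 i x2 - 1).
  by rewrite /pairing -!big_split/=; apply: eq_bigr => i _; ring.
rewrite [leRHS]mulrDl [X in _ <= X + _]mulrDl.
apply: le_trans (ler_normD _ _) _; apply: lerD => //.
by apply: le_trans (ler_normD _ _) _; apply: lerD.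
Qed.

Lemma le_of_le_inv_nat a b C : (exists n0 : nat, forall n : nat, (n0 <= n)%N ->
  a <= b + C / n.+1%:R) -> a <= b.
Proof.
move=> [n0 H]; apply/ler_addgt0Pr => e e0.
have [n Hn] : exists n : nat, C / e <= n%:R.
  exists (Num.bound `|C / e|).
  exact: le_trans (ler_norm _) (ltW (archi_boundP (normr_ge0 _))).
apply: le_trans (H _ (leq_maxl n0 n)) _; rewrite lerD2l ler_pdivrMr//.
rewrite mulrC -ler_pdivrMr//; apply: (le_trans Hn).
by rewrite ler_nat (leq_trans (leq_maxr n0 n)).
Qed.

Lemma expR_le_inv3 t a : 0 < t -> 0 < a ->
  t ^+ 2 * expR (- (t * a)) <= 27 / a ^+ 3 / t.
Proof.
move=> t0 a0; have ta : 0 < t * a / 3 by rewrite divr_gt0// mulr_gt0.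
have h := expR_le_inv ta.
rewrite (_ : expR (- (t * a)) = expR (- (t * a / 3)) ^+ 3); last first.
  by rewrite -expRM_natl; congr expR; field.
apply: (@le_trans _ _ (t ^+ 2 * ((t * a / 3)^-1 ^+ 3))).
  by rewrite ler_wpM2l ?sqr_ge0// lerXn2r// nnegrE ?expR_ge0 ?invr_ge0 ?(ltW ta).
by rewrite le_eqVlt; apply/orP; left; apply/eqP; field; rewrite !lt0r_neq0.
Qed.

(* These functionals approximate the inverse Laplace transform at [2 * b]: by the
   exponential series, their value at [s] is close to [t * X * expR (- X)] with
   [X = expR (t * (2 * b - s))], the [s]-derivative of the smoothed step
   [expR (- X)]. *)
Definition post_coef t b (j : nat) : R :=
  t * (-1) ^+ j / j`!%:R * expR (j.+1%:R * t * (2 * b)).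
Definition post_node t (j : nat) : R := j.+1%:R * t.
Definition smooth_step t b s : R := expR (- expR (t * (2 * b - s))).
Definition smooth_step' t b s : R :=
  t * expR (t * (2 * b - s)) * smooth_step t b s.

Lemma smooth_step_der t b s :
  is_derive s 1 (smooth_step t b) (smooth_step' t b s).
Proof.
have E : smooth_step t b = (fun s => expR (- expR (t * (2 * b) + (- t) * s))).
  by apply/funext => r; rewrite /smooth_step; congr (expR (- expR _)); ring.
rewrite E; have := der_exp (derN (der_exp (derD (derc (t * (2 * b)) s) (der_lin s (- t))))).
move=> /is_derive_eq; apply.
rewrite /smooth_step' E (_ : t * (2 * b - s) = t * (2 * b) + - t * s); ring.
Qed.

Lemma smooth_step_cont t b : continuous (smooth_step t b).
Proof.
move=> s; apply: differentiable_continuous.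
by apply/derivable1_diffP; exact: (@ex_derive _ _ _ _ _ _ _ (smooth_step_der t b s)).
Qed.

Lemma smooth_step_bounds t b s : 0 < smooth_step t b s <= 1.
Proof. by rewrite expR_gt0 -[leRHS]expR0 ler_expR oppr_le0 expR_ge0. Qed.

(** Here and on the right only the rate [1 / t] is retained, although the true decay is much faster:
    [expR (- x) <= x^-1] then suffices, and all errors of the inversion have the same order. *)
Lemma smooth_step_left t b y : 0 < t -> 0 < y ->
  smooth_step t b (2 * (b - y)) <= 1 / (2 * y) / t.
Proof.
move=> t0 y0; apply: (le_trans (expR_le_inv (expR_gt0 _))).
have yt : 0 < 2 * y * t by rewrite !mulr_gt0.
rewrite div1r -invfM lef_pV2 ?posrE ?expR_gt0//.
apply: le_trans _ (expR_ge1Dx _).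
by rewrite (_ : t * _ = 2 * y * t); [lra|ring].
Qed.

Lemma smooth_step_right t b y : 0 < t -> 0 < y ->
  1 - smooth_step t b (2 * (b + y)) <= 1 / (2 * y) / t.
Proof.
move=> t0 y0; have yt : 0 < 2 * y * t by rewrite !mulr_gt0.
have := expR_le_inv yt; rewrite div1r -invfM.
have := expR_ge1Dx (- expR (- (2 * y * t))).
rewrite /smooth_step (_ : t * (2 * b - 2 * (b + y)) = - (2 * y * t)); last ring.
lra.
Qed.

(** Since [s >= 0], the variable [X] stays in [[0, expR (t * (2 * b))]], where the exponential
    series converges uniformly. The number of terms depends on [t] and [b], not on [s]. *)
Lemma post_laplace t b : 1 <= t -> 0 <= b -> exists n, forall s, 0 <= s ->
  `|laplace n (post_coef t b) (post_node t) s - smooth_step' t b s| <= 1 / t.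
Proof.
move=> t1 b0; have t0 : 0 < t by lra.
pose B := expR (t * (2 * b)).
have B0 : 0 < B by exact: expR_gt0.
have e0 : 0 < 1 / (t * t * B) by rewrite divr_gt0// !mulr_gt0.
have [n Hn] := exp_sum_approx (ltW B0) e0.
exists n => s s0; pose X := expR (t * (2 * b - s)).
have XB : 0 <= X <= B.
  by rewrite expR_ge0/= ler_expR ler_wpM2l ?(ltW t0)//; lra.
have E : laplace n (post_coef t b) (post_node t) s =
    t * X * \sum_(j < n) (- X) ^+ j / j`!%:R.
  rewrite mulr_sumr; apply: eq_bigr => j _.
  rewrite /post_coef /post_node -mulrA -expRD.
  rewrite (_ : _ + _ = j.+1%:R * (t * (2 * b - s))); last ring.
  rewrite expRM_natl -/X exprS [(- X) ^+ j]exprNn; ring.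
rewrite E /smooth_step' /smooth_step -/X -mulrBr normrM.
have [X0 XB'] := andP XB.
rewrite ger0_norm ?mulr_ge0// ?(ltW t0)//.
apply: (@le_trans _ _ (t * B * (1 / (t * t * B)))); last first.
  by rewrite le_eqVlt; apply/orP; left; apply/eqP; field; rewrite !lt0r_neq0.
by apply: ler_pM => //; [rewrite mulr_ge0// ltW|rewrite ler_wpM2l// ltW|exact: Hn].
Qed.

End BorgMarchenko.

(** * Local Borg-Marchenko uniqueness *)

Section LocalUniqueness.
Context {R : realType}.
Implicit Types (f g u v q : R -> R) (a b k l x y A C K M Q s t : R).

(** Because [b < a], the decay at [2 * a] beats the growth of the coefficients, of exponent [2 * b].
    Each term keeps a factor [t ^ 2 * expR (- (t * (2 * (a - b))))], and [j + 1 <= 2 ^ j] leaves the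
    series of [expR 2]. The bound is uniform in the number of terms, over which there is no
    control. *)
Lemma post_error n t b a A (J : nat -> R) : 1 <= t -> 0 <= b -> b < a ->
  (forall j, `|J j| <= A * post_node t j * expR (- (2 * post_node t j) * a)) ->
  `|pairing n (post_coef t b) J| <=
    A * expR 2 * (27 / (2 * (a - b)) ^+ 3) / t.
Proof.
move=> t1 b0 ba HJ; have t0 : 0 < t by lra.
have A0 : 0 <= A.
  have := le_trans (normr_ge0 _) (HJ 0%N); rewrite /post_node mul1r -mulrA.
  by rewrite pmulr_lge0// mulr_gt0// expR_gt0.
pose e := expR (- (t * (2 * (a - b)))).
apply: (@le_trans _ _ (\sum_(j < n) A * (t ^+ 2 * e) * (2 ^+ j / j`!%:R))).
  apply: le_trans (ler_norm_sum _ _ _) _; apply: ler_sum => j _.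
  rewrite normrM /post_coef.
  have -> : `|t * (-1) ^+ j / j`!%:R * expR (j.+1%:R * t * (2 * b))| =
      t / j`!%:R * expR (j.+1%:R * t * (2 * b)).
    rewrite !normrM normrX normrN1 expr1n mulr1 (ger0_norm (ltW t0)).
    by rewrite !ger0_norm ?expR_ge0 ?invr_ge0.
  apply: le_trans (ler_wpM2l _ (HJ j)) _.
    by rewrite mulr_ge0 ?expR_ge0// divr_ge0// ltW.
  rewrite /post_node.
  have -> : t / j`!%:R * expR (j.+1%:R * t * (2 * b)) *
      (A * (j.+1%:R * t) * expR (- (2 * (j.+1%:R * t)) * a)) =
      A * (t ^+ 2 * expR (- (j.+1%:R * (t * (2 * (a - b)))))) * (j.+1%:R / j`!%:R).
    have -> : expR (- (j.+1%:R * (t * (2 * (a - b))))) =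
       expR (j.+1%:R * t * (2 * b)) * expR (- (2 * (j.+1%:R * t)) * a).
      by rewrite -expRD; congr expR; ring.
    by field; rewrite pnatr_eq0 -lt0n fact_gt0.
  apply: ler_pM.
  - by rewrite mulr_ge0// mulr_ge0 ?sqr_ge0 ?expR_ge0.
  - by rewrite divr_ge0.
  - rewrite ler_wpM2l// ler_wpM2l ?sqr_ge0// ler_expR lerN2.
    by rewrite ler_peMl ?ler1n// mulr_ge0 ?mulr_ge0 ?subr_ge0// ltW.
  - rewrite ler_wpM2r ?invr_ge0// -natrX ler_nat; exact: ltn_expl.
rewrite -mulr_sumr.
have ab0 : 0 < 2 * (a - b) by lra.
have te := expR_le_inv3 t0 ab0; rewrite -/e in te.
have -> : A * expR 2 * (27 / (2 * (a - b)) ^+ 3) / t =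
   A * (27 / (2 * (a - b)) ^+ 3 / t) * expR 2 by ring.
apply: ler_pM; last exact: exp_sum_le.
- by rewrite mulr_ge0// mulr_ge0 ?sqr_ge0 ?expR_ge0.
- by apply: sumr_ge0 => j _; rewrite divr_ge0// exprn_ge0.
- by rewrite ler_wpM2l.
Qed.

(** Applied to [J], the inversion functional produces a bump of mass [1 / 2] at [x = b] against
    [p = q1 - q2], plus a remainder due to the densities. As the increment of [J] is negligible for
    [b < a], the bump gives [|p b|] bounded by a multiple of the integral of [|p|] over [(0, b)],
    and Gronwall concludes. *)
Lemma local_borg_marchenko l1 Q1 q1 l2 Q2 q2 a A K0 : 0 < a -> a <= l1 -> a <= l2 ->
  cont_bounded l1 Q1 q1 -> cont_bounded l2 Q2 q2 ->
  (forall k, K0 <= k -> exists Y1 w1 Y2 w2 J,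
    [/\ growing l1 (fun x => q1 (l1 - x)) k Y1 w1,
        growing l2 (fun x => q2 (l2 - x)) k Y2 w2, continuous J,
        forall x, 0 < x < a -> is_derive x 1 J ((q1 x - q2 x) *
          (expR (- (2 * k) * x) * (Y1 (l1 - x) * Y2 (l2 - x)))) &
        `|J a - J 0| <= A * k * expR (- (2 * k) * a)]) ->
  forall x, 0 < x < a -> q1 x = q2 x.
Proof.
move=> a0 al1 al2 qQ1 qQ2 HJ.
have l10 : 0 < l1 by exact: lt_le_trans al1.
have l20 : 0 < l2 by exact: lt_le_trans al2.
(* The choice ranges over all [k]; below [K0] the functions are placeholders. *)
have /choice[Y1 /choice[w1 /choice[Y2 /choice[w2 /choice[J HJ']]]]] :
    forall k, exists Y1 w1 Y2 w2 J, K0 <= k ->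
    [/\ growing l1 (fun x => q1 (l1 - x)) k Y1 w1,
        growing l2 (fun x => q2 (l2 - x)) k Y2 w2, continuous J,
        forall x, 0 < x < a -> is_derive x 1 J ((q1 x - q2 x) *
          (expR (- (2 * k) * x) * (Y1 (l1 - x) * Y2 (l2 - x)))) &
        `|J a - J 0| <= A * k * expR (- (2 * k) * a)].
  move=> k; have [Kk|nKk] := leP K0 k.
    by have [y1 [v1 [y2 [v2 [j ?]]]]] := HJ k Kk; exists y1, v1, y2, v2, j.
  by exists id, id, id, id, id.
clear HJ.
pose p x := q1 x - q2 x; pose P := Q1 + Q2.
have xla x : 0 < x < a -> 0 < x < l1 /\ 0 < x < l2.
  by move=> /andP[x0 xa]; rewrite x0 !(lt_le_trans xa).
have pP x : 0 < x < a -> `|p x| <= P.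
  move=> xa; have [x1 x2] := xla x xa.
  apply: le_trans (ler_normB _ _) _; apply: lerD.
    exact: (qQ1 x x1).2.
  exact: (qQ2 x x2).2.
have cp x : 0 < x < a -> {for x, continuous p}.
  move=> xa; have [x1 x2] := xla x xa.
  by apply: continuousB; [exact: (qQ1 x x1).1|exact: (qQ2 x x2).1].
have P0 : 0 <= P by apply: le_trans (normr_ge0 _) (pP (a / 2) _); lra.
have [N [cN N0 dN]] : exists N, [/\ continuous N, N 0 = 0 &
    forall x, 0 < x < a -> is_derive x 1 N `|p x|].
  apply: (@exists_primitive R a (fun x => `|p x|) P) => //.
  - by move=> x xa; apply: continuous_comp; [exact: cp|exact: norm_continuous].
  - by move=> x xa; rewrite normr_id; exact: pP.
pose L := l1 + l2; have L0 : 0 < L by rewrite addr_gt0.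
have [C [C0 HC]] :=
  product_density l10 l20 (cont_bounded_refl qQ1) (cont_bounded_refl qQ2).
pose C1 := C * (1 + 2 * L).
have C10 : 0 <= C1 by rewrite mulr_ge0//; clear - L0; lra.
(* [eta] is the half-width of the window around [b] on which [p] is replaced by [p b]. Both [eps]
   and [eta] are fixed while [t] tends to infinity, and only afterwards tend to zero. *)
have main b eps eta : 0 < eps -> 0 < eta -> eta < b -> b + eta < a ->
    (forall x, b - eta < x < b + eta -> `|p x - p b| <= eps) ->
    1 / 2 * `|p b| <= eps / 2 + C1 * N (b + eta).
  move=> eps0 eta0 etab ba Hp.
  have b0 : 0 < b by exact: lt_trans etab.
  have pb : `|p b| <= P by apply: pP; clear - b0 ba eta0; lra.
  pose beta := 1 / 2 * p b.
  (* All errors of order [1 / t]: the tails of the step at the edges of the window, the increment of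
     [J], and the truncation and density errors on the three pieces of [(0, a)]. *)
  pose Z := 1 / 2 * P * (1 / (2 * eta)) + 1 / 2 * P * (1 / (2 * eta)) +
    A * expR 2 * (27 / (2 * (a - b)) ^+ 3) +
    (1 / 2 * P * (1 / (2 * eta)) + P * a) + P * a +
    (1 / 2 * P * (1 / (2 * eta)) + P * a +
      P * C * (1 / (2 * eta) + 2 * L) * a).
  apply: (@le_of_le_inv_nat _ _ _ Z).
  exists (Num.bound (`|K0| + `|Q1 * l1| + `|Q2 * l2|)) => n nb.
  pose t : R := n.+1%:R.
  have t1 : 1 <= t by rewrite /t ler1n.
  have t0 : 0 < t by rewrite /t.
  have tK : `|K0| + `|Q1 * l1| + `|Q2 * l2| <= t.
    apply: le_trans (ltW (archi_boundP _)) _; first by rewrite !addr_ge0.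
    by rewrite /t ler_nat (leq_trans nb).
  have [tK0 tQ1 tQ2] : [/\ K0 <= t, Q1 * l1 <= t & Q2 * l2 <= t].
    move: tK (normr_ge0 K0) (normr_ge0 (Q1 * l1)) (normr_ge0 (Q2 * l2)).
    move: (ler_norm K0) (ler_norm (Q1 * l1)) (ler_norm (Q2 * l2)).
    by clear; split; lra.
  have tks j : t <= post_node t j by rewrite /post_node ler_peMl ?ler1n// ltW.
  have [m Hm] := post_laplace t1 (ltW b0).
  pose E x := smooth_step t b (2 * x).
  pose E' x := 2 * smooth_step' t b (2 * x).
  have dE x : is_derive x 1 E (E' x).
    have := @der_affine R (smooth_step t b) x 2 0 (smooth_step' t b (0 + 2 * x)).
    by rewrite /E /E' add0r; under eq_fun do rewrite add0r; apply; exact: smooth_step_der.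
  have cE : continuous E.
    by apply: (cont_comp (f := smooth_step t b)); [exact: smooth_step_cont|exact: cont_lin].
  have E'0 x : 0 <= E' x by rewrite mulr_ge0// !mulr_ge0 ?expR_ge0// ltW.
  have E01 x : 0 < E x <= 1 by exact: smooth_step_bounds.
  pose Om x := pairing m (post_coef t b) (fun j => J (post_node t j) x).
  have HJt j := HJ' _ (le_trans tK0 (tks j)).
  pose rem x := pairing m
    (fun j => post_coef t b j * expR (- post_node t j * (2 * x)))
    (fun j => Y1 (post_node t j) (l1 - x) * Y2 (post_node t j) (l2 - x) - 1).
  have cOm : continuous Om.
    apply: (@cont_sum R m (fun j x => post_coef t b j * J (post_node t j) x)) => j.
    by apply: contM; [exact: contc|have [] := HJt j].
  have dOm x : 0 < x < a -> is_derive x 1 Om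
      (p x * (laplace m (post_coef t b) (post_node t) (2 * x) + rem x)).
    move=> xa; have := @der_sum R m (fun j x => post_coef t b j * J (post_node t j) x)
      (fun j => post_coef t b j * (p x * (expR (- (2 * post_node t j) * x) *
         (Y1 (post_node t j) (l1 - x) * Y2 (post_node t j) (l2 - x))))) x.
    move=> /(_ _)/is_derive_eq; apply.
      by move=> j; apply: derZ; have [_ _ _ + _] := HJt j; exact.
    rewrite /laplace /rem /pairing -big_split/= mulr_sumr; apply: eq_bigr => j _.
    have -> : - (2 * post_node t j) * x = - post_node t j * (2 * x) by ring.
    ring.
  have err : `|Om a - Om 0| <= A * expR 2 * (27 / (2 * (a - b)) ^+ 3) / t.
    have -> : Om a - Om 0 = pairing m (post_coef t b)
        (fun j => J (post_node t j) a - J (post_node t j) 0).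
      by rewrite /Om /pairing -sumrB; apply: eq_bigr => j _; ring.
    apply: post_error => //; [exact: ltW|clear - ba eta0; lra|].
    by move=> j; have [] := HJt j.
  have lapE x : 0 < x < a ->
      `|laplace m (post_coef t b) (post_node t) (2 * x) - 1 / 2 * E' x| <= 1 / t.
    move=> /andP[x0 xa]; rewrite (_ : 1 / 2 * E' x = smooth_step' t b (2 * x)).
      by apply: Hm; rewrite mulr_ge0// ltW.
    by rewrite /E'; field.
  (* The functional is translated by [2 * x], so its step is centred at [2 * (b - x)]; what counts
     is the rise of the step beyond [x]. This is bounded everywhere and negligible for [x] to the
     right of the window. The slope [t^-1] in [om] covers the truncation of the series. *)
  have remE x : 0 < x < a -> `|rem x| <= C * (E (x + L) - E x + 2 * L / t).
    move=> xa; have [/andP[x0 x1] /andP[_ x2]] := xla x xa.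
    pose om s := smooth_step t b (2 * x + 1 * s) + t^-1 * s.
    have := HC m (fun j => post_coef t b j * expR (- post_node t j * (2 * x)))
      (post_node t) (fun j => Y1 (post_node t j)) (fun j => w1 (post_node t j))
      (fun j => Y2 (post_node t j)) (fun j => w2 (post_node t j)) om
      (fun s => 1 * smooth_step' t b (2 * x + 1 * s) + t^-1).
    move=> /(_ _ _ _ _ _ (l1 - x) (l2 - x) _ _) H.
    apply: le_trans (H _ _ _ _ _ _ _) _.
    - by apply: contD; [apply: cont_affine; exact: smooth_step_cont|exact: cont_lin].
    - by move=> j; have := tks j; split; [exact: lt_le_trans t0 _|exact: le_trans tQ1 _|
        exact: le_trans tQ2 _].
    - by move=> j; have [] := HJt j.
    - by move=> j; have [] := HJt j.
    - move=> s /andP[s0 sL]; split.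
        by apply: derD; [apply: der_affine; exact: smooth_step_der|exact: der_lin].
      rewrite laplace_shift !mul1r [s + _]addrC.
      have sx0 : 0 <= 2 * x + s by rewrite addr_ge0 ?mulr_ge0// ltW.
      have H2 := Hm _ sx0.
      have := ler_normD (laplace m (post_coef t b) (post_node t) (2 * x + s) -
        smooth_step' t b (2 * x + s)) (smooth_step' t b (2 * x + s)).
      rewrite subrK [in leRHS]addrC (ger0_norm (x := smooth_step' _ _ _)); last first.
        by rewrite !mulr_ge0 ?expR_ge0// ltW.
      by move=> /le_trans; apply; rewrite lerD2l -div1r.
    - by clear - x0 x1; lra.
    - by clear - x0 x2; lra.
    - rewrite ler_wpM2l// /om /E mulr0 addr0 mulr0 addr0.
      rewrite (_ : 2 * x + 1 * (2 * (l1 + l2)) = 2 * (x + L)); last by rewrite /L; ring.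
      by rewrite le_eqVlt; apply/orP; left; apply/eqP; rewrite /L; field; exact: lt0r_neq0.
  have Emon x y : x <= y -> E x <= E y.
    move=> xy; have := @le_increment R (fun=> 0) E (fun=> 0) E' x y xy (@contc R 0) cE.
    by rewrite subrr subr_ge0; apply.
  (* The comparison of [Om] with the step of height [c / 2], used with [c = p b] inside the window
     and [c = 0] on either side. *)
  have piece x y c D rho : 0 <= x -> x <= y -> y <= a ->
      (forall z, x < z < y -> `|p z - c| <= D) ->
      (forall z, x < z < y -> `|rem z| <= rho) ->
      `|(Om y - 1 / 2 * c * E y) - (Om x - 1 / 2 * c * E x)| <=
        1 / 2 * D * (E y - E x) + P / t * (y - x) + rho * (N y - N x).
    move=> x0 xy ya HD Hrho.
    have sub z : x < z < y -> 0 < z < a.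
      by move=> /andP[xz zy]; rewrite (le_lt_trans x0 xz) (lt_le_trans zy ya).
    have := @norm_increment R (fun z => Om z - 1 / 2 * c * E z)
      (fun z => 1 / 2 * D * E z + P / t * z + rho * N z)
      (fun z => p z * (laplace m (post_coef t b) (post_node t) (2 * z) + rem z) -
         1 / 2 * c * E' z)
      (fun z => 1 / 2 * D * E' z + P / t + rho * `|p z|) x y xy.
    move=> H; apply: le_trans (H _ _ _ _ _) _.
    - by apply: contB => //; apply: contM => //; exact: contc.
    - apply: contD; last by apply: contM => //; exact: contc.
      by apply: contD; [apply: contM => //; exact: contc|exact: cont_lin].
    - by move=> z zxy; apply: derB; apply: dOm; exact: sub.
    - move=> z zxy; have dNz := dN z (sub z zxy).
      exact: (derD (derD (derZ (1 / 2 * D) (dE z)) (der_lin z (P / t))) (derZ rho dNz)).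
    - move=> z zxy; have zz := sub z zxy; have h1 := lapE z zz.
      have h2 := HD z zxy; have h3 := Hrho z zxy; have h4 := pP z zz.
      set la := laplace _ _ _ _ in h1 *.
      have -> : p z * (la + rem z) - 1 / 2 * c * E' z =
        1 / 2 * (p z - c) * E' z + p z * (la - 1 / 2 * E' z) + p z * rem z by ring.
      apply: le_trans (ler_normD _ _) _; apply: lerD; last first.
        by rewrite normrM mulrC ler_wpM2r.
      apply: le_trans (ler_normD _ _) _; apply: lerD.
        rewrite normrM (ger0_norm (E'0 z)) ler_wpM2r// normrM.
        by rewrite ger0_norm ?divr_ge0// ler_wpM2l ?divr_ge0.
      by rewrite normrM ler_pM// -[leRHS]div1r.
    - by rewrite le_eqVlt; apply/orP; left; apply/eqP; ring.
  pose r1 : R := 1 / (2 * eta) / t.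
  have r10 : 0 <= r1 by rewrite !divr_ge0 ?mulr_ge0// ltW.
  have Eh : E (b - eta) <= r1 by exact: smooth_step_left.
  have Eg : 1 - E (b + eta) <= r1 by exact: smooth_step_right.
  have Lt0 : 0 <= 2 * L / t by rewrite divr_ge0 ?mulr_ge0// ltW.
  have LtL : 2 * L / t <= 2 * L by rewrite ler_pdivrMr// ler_peMr// mulr_ge0// ltW.
  have rem1 x : 0 < x < a -> `|rem x| <= C1.
    move=> xa; apply: le_trans (remE x xa) _; rewrite /C1 ler_wpM2l//.
    have /andP[_ ?] := E01 (x + L); have /andP[? _] := E01 x.
    apply: lerD => //; apply: le_trans (_ : E (x + L) <= 1); last by [].
    by rewrite gerBl ltW.
  have rem3 x : b + eta < x < a -> `|rem x| <= C * (r1 + 2 * L / t).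
    move=> /andP[bx xa]; have xa' : 0 < x < a by rewrite xa andbT (lt_trans _ bx)// addr_gt0.
    apply: le_trans (remE x xa') _; rewrite ler_wpM2l// lerD2r.
    apply: le_trans Eg; apply: lerB; first by case/andP: (E01 (x + L)).
    by apply: Emon; exact: ltW.
  have Na : N a - N (b + eta) <= P * a.
    have ga : b + eta <= a by exact: ltW.
    have g0 : 0 <= b + eta by rewrite addr_ge0// ltW.
    have := @le_increment R N (fun x => P * x) (fun x => `|p x|) (fun=> P)
      (b + eta) a ga cN (@cont_lin R P).
    move=> H; apply: le_trans (H _ _ _) _.
    - by move=> z /andP[gz za]; apply: dN; rewrite za (le_lt_trans g0 gz).
    - by move=> z _; exact: der_lin.
    - by move=> z /andP[gz za]; apply: pP; rewrite za (le_lt_trans g0 gz).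
    - by rewrite gerBl mulr_ge0.
  have h0 : 0 <= b - eta by rewrite subr_ge0 ltW.
  have hg : b - eta <= b + eta by clear - eta0; lra.
  have g0 : 0 <= b + eta by exact: le_trans h0 hg.
  have ga : b + eta <= a by exact: ltW.
  have ha : b - eta <= a by exact: le_trans hg ga.
  have A1 : `|Om (b - eta) - Om 0| <=
      1 / 2 * P * r1 + P * a / t + C1 * N (b - eta).
    have := piece 0 (b - eta) 0 P C1 (lexx 0) h0 ha.
    rewrite mulr0 !mul0r !subr0 N0 subr0 => H; apply: le_trans (H _ _) _.
    - by move=> z /andP[z0 zh]; rewrite subr0; apply: pP; rewrite z0 (lt_le_trans zh).
    - by move=> z /andP[z0 zh]; apply: rem1; rewrite z0 (lt_le_trans zh).
    apply: lerD => //; apply: lerD.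
      rewrite ler_wpM2l ?mulr_ge0 ?divr_ge0//; apply: le_trans Eh.
      by rewrite gerBl; case/andP: (E01 0) => /ltW.
    by rewrite mulrAC ler_wpM2r ?invr_ge0 ?(ltW t0)// ler_wpM2l.
  have A2 : `|(Om (b + eta) - beta * E (b + eta)) - (Om (b - eta) - beta * E (b - eta))|
      <= 1 / 2 * eps + P * a / t + C1 * (N (b + eta) - N (b - eta)).
    apply: le_trans (piece (b - eta) (b + eta) (p b) eps C1 h0 hg ga Hp _) _.
      move=> z /andP[hz zg]; apply: rem1.
      by rewrite (le_lt_trans h0 hz) (lt_le_trans zg ga).
    rewrite lerD2r; apply: lerD.
      rewrite ler_piMr ?mulr_ge0 ?divr_ge0 ?(ltW eps0)//.
      have /andP[_ E1] := E01 (b + eta); have /andP[E2 _] := E01 (b - eta).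
      by clear - E1 E2; lra.
    rewrite mulrAC ler_wpM2r ?invr_ge0 ?(ltW t0)// ler_wpM2l//.
    by clear - h0 ga; lra.
  have A3 : `|Om a - Om (b + eta)| <= 1 / 2 * P * r1 + P * a / t +
      C * (r1 + 2 * L / t) * (P * a).
    have := piece (b + eta) a 0 P (C * (r1 + 2 * L / t)) g0 ga (lexx a).
    rewrite mulr0 !mul0r !subr0 => H; apply: le_trans (H _ rem3) _.
      by move=> z /andP[gz za]; rewrite subr0; apply: pP; rewrite za (le_lt_trans g0 gz).
    apply: lerD; last by rewrite ler_wpM2l ?mulr_ge0 ?addr_ge0.
    apply: lerD.
      rewrite ler_wpM2l ?mulr_ge0 ?divr_ge0//; apply: le_trans Eg.
      by rewrite lerD2r; case/andP: (E01 a).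
    rewrite mulrAC ler_wpM2r ?invr_ge0 ?(ltW t0)// ler_wpM2l//.
    by clear - g0; lra.
  have betaE : 1 / 2 * `|p b| = `|beta|.
    by rewrite /beta normrM ger0_norm ?divr_ge0.
  have bP : `|beta| <= 1 / 2 * P by rewrite -betaE ler_wpM2l ?divr_ge0.
  have B1 : `|beta * (1 - E (b + eta))| <= 1 / 2 * P * r1.
    rewrite normrM ler_pM// ger0_norm//.
    by rewrite subr_ge0; case/andP: (E01 (b + eta)).
  have B2 : `|beta * E (b - eta)| <= 1 / 2 * P * r1.
    rewrite normrM ler_pM// ger0_norm//.
    by case/andP: (E01 (b - eta)) => /ltW.
  have -> : eps / 2 + C1 * N (b + eta) + Z / t = 
     1 / 2 * P * r1 + 1 / 2 * P * r1 +
     A * expR 2 * (27 / (2 * (a - b)) ^+ 3) / t +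
     (1 / 2 * P * r1 + P * a / t + C1 * N (b - eta)) +
     (1 / 2 * eps + P * a / t + C1 * (N (b + eta) - N (b - eta))) +
     (1 / 2 * P * r1 + P * a / t + C * (r1 + 2 * L / t) * (P * a)).
    rewrite /Z /r1 -/t; field; rewrite !lt0r_neq0//; clear - ba eta0; lra.
  rewrite betaE.
  have -> : beta = beta * (1 - E (b + eta)) + beta * E (b - eta) +
    (Om a - Om 0) - (Om (b - eta) - Om 0) -
    (Om (b + eta) - beta * E (b + eta) - (Om (b - eta) - beta * E (b - eta)))
    - (Om a - Om (b + eta)) by ring.
  have tri (x y cu cv : R) : `|x| <= cu -> `|y| <= cv -> `|x + y| <= cu + cv.
    by move=> Hu Hv; apply: le_trans (ler_normD _ _) (lerD Hu Hv).
  apply: (tri); last by rewrite normrN.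
  apply: (tri); last by rewrite normrN.
  apply: (tri); last by rewrite normrN.
  by apply: (tri) => //; exact: (tri).
(* Continuity of [p] and of [N] at [b] removes [eps] and [eta]. *)
have key b : 0 < b < a -> `|p b| <= 2 * C1 * N b.
  move=> ba; have [b0 ba'] := andP ba.
  apply/ler_addgt0Pr => e e0.
  pose e1 := e / (2 + 4 * C1).
  have c4 : 0 < 2 + 4 * C1 by clear - C10; lra.
  have e10 : 0 < e1 by rewrite divr_gt0.
  have /cvgrPdist_le/(_ _ e10)[d1 /= d10 Hd1] := cp b ba.
  have /cvgrPdist_le/(_ _ e10)[d2 /= d20 Hd2] := cN b.
  pose eta := Num.min (Num.min (d1 / 2) (d2 / 2)) (Num.min (b / 2) ((a - b) / 2)).
  have eta0 : 0 < eta by rewrite !lt_min !divr_gt0//= subr_gt0.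
  have [[ed1 ed2] [eb eab]] : (eta <= d1 / 2 /\ eta <= d2 / 2) /\
      (eta <= b / 2 /\ eta <= (a - b) / 2).
    by rewrite /eta !ge_min !lexx !orbT.
  have := main b e1 eta e10 eta0 _ _ _.
  move=> /(_ _ _ _)H.
  have {}H : 1 / 2 * `|p b| <= e1 / 2 + C1 * N (b + eta).
    apply: H.
    - by clear - eb b0; lra.
    - by clear - eab ba'; lra.
    - move=> x xb; rewrite distrC; apply: Hd1 => /=.
      by rewrite ltr_norml; clear - xb ed1 d10; lra.
  have HN : N (b + eta) <= N b + e1.
    have := Hd2 (b + eta); rewrite /= opprD addNKr normrN gtr0_norm// => /(_ _).
    by rewrite ler_norml => /(_ _)/andP[|]; [clear - ed2 d20; lra|lra].
  have : C1 * N (b + eta) <= C1 * N b + C1 * e1 by rewrite -mulrDr ler_wpM2l.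
  have : e = e1 * (2 + 4 * C1) by rewrite /e1 divfK// lt0r_neq0.
  have : 0 <= C1 * e1 by rewrite mulr_ge0// ltW.
  by clear - H e10; lra.
(* Gronwall: [expR (- (2 * C1) * x) * N x] is nonincreasing and vanishes at [0]. *)
have N_le0 b : 0 < b < a -> N b <= 0.
  move=> /andP[b0 ba].
  pose F x := expR (- (2 * C1) * x) * N x.
  have := @le_increment R F (fun=> 0) (fun x => - (2 * C1) *
    expR (- (2 * C1) * x) * N x + expR (- (2 * C1) * x) * `|p x|) (fun=> 0)
    0 b (ltW b0).
  move=> H; have : F b - F 0 <= 0 - 0.
    apply: H; [by apply: contM => //; exact/cont_exp/cont_lin|exact: contc| |].
    - move=> x /andP[x0 xb]; apply: derM; first exact/der_exp/der_lin.
      by apply: dN; rewrite x0 (lt_trans xb).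
    - move=> x /andP[x0 xb]; have xa : 0 < x < a by rewrite x0 (lt_trans xb).
      rewrite [X in X * _]mulrC -mulrA -mulrDr mulr_ge0_le0 ?expR_ge0//.
      by have := key x xa; clear; lra.
  by rewrite /F N0 mulr0 !subr0 pmulr_rle0 ?expR_gt0.
move=> x xa; apply/eqP; rewrite -subr_eq0 -normr_le0.
apply: le_trans (key x xa) _.
by apply: mulr_ge0_le0 (N_le0 x xa); rewrite mulr_ge0.
Qed.

End LocalUniqueness.

(** * Identification of an edge *)

Section EdgeUniqueness.
Context {R : realType}.
Implicit Types (f g u v q Y w : R -> R) (a b k l m x y A C K M Q s t : R).

(** Thresholds that place the amplitude [Y] in [[3 / 4, 5 / 4]] and the correction to the
    logarithmic derivative below [1 / 16]. *)
Definition large l Q k := [/\ 1 <= k, 4 * (Q * l) <= k & 16 * Q <= k].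

Lemma large_exists l Q : exists K, forall k, K <= k -> large l Q k.
Proof.
exists (1 + 4 * `|Q * l| + 16 * `|Q|) => k Kk.
have := ler_norm (Q * l); have := ler_norm Q.
have := normr_ge0 (Q * l); have := normr_ge0 Q.
by move=> *; split; lra.
Qed.

Lemma growing_large_bounds l Q q k Y w x : 0 < l -> cont_bounded l Q q ->
  large l Q k -> growing l q k Y w -> 0 <= x <= l ->
  [/\ 3 / 4 <= Y x <= 5 / 4, `|expR (- (2 * k) * x) * w x| <= Q / k &
    `|k * Y x + expR (- (2 * k) * x) * w x| <= 3 * k].
Proof.
move=> l0 qQ [k1 Qlk Qk] gY xl.
have Q0 := cont_bounded_ge0 l0 qQ.
have k0 : 0 < k by clear - k1; lra.
have Ql0 : 0 <= Q * l by rewrite mulr_ge0// ltW.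
have Qlk' : Q * l <= k by clear - Qlk Ql0; lra.
have [Y1 _ dY] := growing_bounds l0 qQ k0 Qlk' gY xl.
have h : Q * l / k <= 1 / 4 by rewrite ler_pdivrMr//; clear - Qlk; lra.
have Yb : 3 / 4 <= Y x <= 5 / 4.
  by move: (le_trans Y1 h); clear; rewrite ler_norml; lra.
split=> //; apply: le_trans (ler_normD _ _) _.
have Qk1 : Q / k <= k.
  rewrite ler_pdivrMr//; apply: (@le_trans _ _ k).
    by clear - Qk Q0; lra.
  by rewrite ler_peMl// ltW.
have : `|k * Y x| <= k * (5 / 4).
  rewrite normrM (ger0_norm (ltW k0)) ler_wpM2l// ?(ltW k0)//.
  by clear - Yb; rewrite ler_norml; lra.
by move: (le_trans dY Qk1); clear - k0; lra.
Qed.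

(* [u'(0) / u(0) = m], the solution is exponentially small at [l], and its
   logarithmic derivative at [l] stays away from [- k], as it does for a Kirchhoff
   vertex of degree three or a Dirichlet vertex. *)
Definition edge_cauchy l q k A m := exists u v,
  [/\ sol l (fun x => q x + k ^+ 2) u v, u 0 = 1, v 0 = m,
      `|u l| <= A * expR (- k * l) /\ `|v l| <= A * k * expR (- k * l) &
      3 / 4 * k * `|u l| <= `|v l + k * u l|].

Definition decaying k l Y : R -> R := fun x => expR (- k * x) * Y (l - x).
Definition decaying' k l Y w : R -> R := fun x => - (expR (- k * x) *
  (k * Y (l - x) + expR (- (2 * k) * (l - x)) * w (l - x))).

Lemma decaying_bounds l Q q k Y w x : 0 < l -> cont_bounded l Q q -> large l Q k ->
  growing l (fun x => q (l - x)) k Y w -> 0 <= x <= l ->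
  `|decaying k l Y x| <= 2 * expR (- k * x) /\
  `|decaying' k l Y w x| <= 3 * k * expR (- k * x).
Proof.
move=> l0 qQ lk gY /andP[x0 xl].
have xl' : 0 <= l - x <= l by clear - x0 xl; lra.
have [y1 _ d1] := growing_large_bounds l0 (cont_bounded_refl qQ) lk gY xl'.
rewrite /decaying /decaying' normrN !normrM (ger0_norm (expR_ge0 _)).
rewrite [leLHS]mulrC [X in _ /\ X <= _]mulrC; split; rewrite ler_wpM2r ?expR_ge0//.
by clear - y1; rewrite ler_norml; lra.
Qed.

Lemma wronskian_const l g u1 v1 u2 v2 x : 0 <= x <= l -> sol l g u1 v1 ->
  sol l g u2 v2 -> wronskian u1 v1 u2 v2 x = wronskian u1 v1 u2 v2 0.
Proof.
move=> /andP[x0 xl] s1 s2; apply: constant_increment => //.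
  exact: wronskian_cont s1 s2.
move=> t /andP[t0 tx]; have tl : 0 < t < l by rewrite t0 (lt_le_trans tx).
by have := wronskian_der s1 s2 tl; rewrite subrr mul0r.
Qed.

Lemma wronskian_small u1 v1 u2 v2 x a b c d :
  `|u1 x| <= a -> `|v1 x| <= b -> `|u2 x| <= c -> `|v2 x| <= d ->
  `|wronskian u1 v1 u2 v2 x| <= a * d + b * c.
Proof.
move=> *; apply: le_trans (ler_normB _ _) _.
by rewrite !normrM lerD// ler_pM.
Qed.

(* The decaying solution nearly has the same Cauchy data at [0] as the given one. *)
Lemma edge_cauchy_decaying l Q q k A Y w u v x : 0 < l -> cont_bounded l Q q ->
  large l Q k -> growing l (fun x => q (l - x)) k Y w -> 0 <= A ->
  sol l (fun x => q x + k ^+ 2) u v ->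
  `|u l| <= A * expR (- k * l) -> `|v l| <= A * k * expR (- k * l) ->
  0 <= x <= l ->
  `|wronskian u v (decaying k l Y) (decaying' k l Y w) x| <=
    5 * A * k * expR (- (2 * k) * l).
Proof.
move=> l0 qQ lk gY A0 s ul vl xl.
have sd := decaying_sol gY.
have ll : 0 <= l <= l by rewrite lexx ltW.
have [d1 d2] := decaying_bounds l0 qQ lk gY ll.
rewrite (wronskian_const xl s sd) -(wronskian_const ll s sd).
apply: le_trans (wronskian_small ul vl d1 d2) _.
rewrite (_ : expR (- (2 * k) * l) = expR (- k * l) * expR (- k * l)).
  by rewrite le_eqVlt; apply/orP; left; apply/eqP; ring.
by rewrite -expRD; congr expR; ring.
Qed.

(** [J] is the Wronskian of the two decaying solutions. At [l1] both factors are exponentially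
    small; at [0] both are nearly proportional to the Cauchy data [(1, m)], so the Wronskian is
    small there as well. The two estimates give the constants [12] and [20 * A]. *)
Lemma edge_unique_potential l1 Q1 q1 l2 Q2 q2 A K0 : 0 < l1 -> 0 < l2 -> l1 <= l2 ->
  cont_bounded l1 Q1 q1 -> cont_bounded l2 Q2 q2 -> 0 <= A ->
  (forall k, K0 <= k -> exists m, edge_cauchy l1 q1 k A m /\ edge_cauchy l2 q2 k A m) ->
  forall x, 0 < x < l1 -> q1 x = q2 x.
Proof.
move=> l10 l20 l12 qQ1 qQ2 A0 H.
have [K1 HK1] := large_exists l1 Q1; have [K2 HK2] := large_exists l2 Q2.
apply: (@local_borg_marchenko R l1 Q1 q1 l2 Q2 q2 l1 (12 + 20 * A)
  (Num.max K0 (Num.max K1 K2))) => // k.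
rewrite !ge_max => /andP[/H[m [[u1 [v1 [s1 u10 v10 [ul1 vl1] _]]]
  [u2 [v2 [s2 u20 v20 [ul2 vl2] _]]]]] /andP[/HK1 lk1 /HK2 lk2]].
have [Y1 [w1 g1]] := growing_exists k l10 (cont_bounded_refl qQ1).
have [Y2 [w2 g2]] := growing_exists k l20 (cont_bounded_refl qQ2).
have sd1 := decaying_sol g1; have sd2 := decaying_sol g2.
have sd2' := sol_sub l12 sd2.
exists Y1, w1, Y2, w2,
  (wronskian (decaying k l2 Y2) (decaying' k l2 Y2 w2)
    (decaying k l1 Y1) (decaying' k l1 Y1 w1)).
split=> //.
- exact: wronskian_cont sd2' sd1.
- move=> x xl; have := wronskian_der sd2' sd1 xl.
  move=> /is_derive_eq; apply.
  rewrite (_ : expR (- (2 * k) * x) = expR (- k * x) * expR (- k * x)).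
    ring.
  by rewrite -expRD; congr expR; ring.
- have k0 : 0 < k by have [? _ _] := lk1; apply: lt_le_trans ltr01 _.
  have l11 : 0 <= l1 <= l1 by rewrite lexx ltW.
  have l12' : 0 <= l1 <= l2 by rewrite l12 ltW.
  have l00 l : 0 < l -> 0 <= (0 : R) <= l by rewrite lexx => /ltW.
  have [d1 d1'] := decaying_bounds l10 qQ1 lk1 g1 l11.
  have [d2 d2'] := decaying_bounds l20 qQ2 lk2 g2 l12'.
  have [c1 _] := decaying_bounds l10 qQ1 lk1 g1 (l00 _ l10).
  have [c2 _] := decaying_bounds l20 qQ2 lk2 g2 (l00 _ l20).
  rewrite mulr0 expR0 mulr1 in c1 c2.
  have W1 := edge_cauchy_decaying l10 qQ1 lk1 g1 A0 s1 ul1 vl1 (l00 _ l10).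
  have W2 := edge_cauchy_decaying l20 qQ2 lk2 g2 A0 s2 ul2 vl2 (l00 _ l20).
  rewrite /wronskian u10 v10 in W1; rewrite /wronskian u20 v20 in W2.
  have Wa := wronskian_small d2 d2' d1 d1'.
  set e := expR (- (2 * k) * l1).
  have ee : expR (- k * l1) * expR (- k * l1) = e.
    by rewrite -expRD; congr expR; ring.
  have e0 : 0 < e by exact: expR_gt0.
  have {}Wa : `|wronskian (decaying k l2 Y2) (decaying' k l2 Y2 w2) (decaying k l1 Y1)
      (decaying' k l1 Y1 w1) l1| <= 12 * k * e.
    apply: le_trans Wa _; rewrite -ee le_eqVlt; apply/orP; left; apply/eqP; ring.
  have {}W2 : `|1 * decaying' k l2 Y2 w2 0 - m * decaying k l2 Y2 0| <= 5 * A * k * e.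
    apply: le_trans W2 _; rewrite ler_wpM2l ?mulr_ge0 ?(ltW k0)//.
    by rewrite ler_expR !mulNr lerN2 ler_wpM2l// mulr_ge0// ltW.
  have W0 : `|wronskian (decaying k l2 Y2) (decaying' k l2 Y2 w2) (decaying k l1 Y1)
      (decaying' k l1 Y1 w1) 0| <= 20 * A * k * e.
    rewrite /wronskian.
    have -> : decaying k l2 Y2 0 * decaying' k l1 Y1 w1 0 -
        decaying' k l2 Y2 w2 0 * decaying k l1 Y1 0 =
      decaying k l2 Y2 0 * (1 * decaying' k l1 Y1 w1 0 - m * decaying k l1 Y1 0) -
      decaying k l1 Y1 0 * (1 * decaying' k l2 Y2 w2 0 - m * decaying k l2 Y2 0) by ring.
    apply: le_trans (ler_normB _ _) _; rewrite normrM [X in _ + X]normrM.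
    rewrite (_ : 20 * A * k * e = 2 * (5 * A * k * e) + 2 * (5 * A * k * e)); last by ring.
    by apply: lerD; apply: ler_pM.
  apply: le_trans (ler_normB _ _) _; apply: le_trans (lerD Wa W0) _.
  by rewrite le_eqVlt; apply/orP; left; apply/eqP; ring.
Qed.

(** If [l1 < l2], both solutions agree up to [l1], an interior point of the longer edge. Closeness
    to the decaying solution pushes the logarithmic derivative at [l1] towards [- k], the end
    condition keeps it away, so both [u] and [v] are tiny there. The Wronskian with the growing
    solution then forces [m] close to [k], while decay forces [m] close to [- k]. *)
Lemma edge_unique_length l1 Q1 q1 l2 Q2 q2 A K0 : 0 < l1 -> 0 < l2 ->
  cont_bounded l1 Q1 q1 -> cont_bounded l2 Q2 q2 -> 0 <= A ->
  (forall x, 0 < x < l1 -> q1 x = q2 x) ->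
  (forall k, K0 <= k -> exists m, edge_cauchy l1 q1 k A m /\ edge_cauchy l2 q2 k A m) ->
  l2 <= l1.
Proof.
move=> l10 l20 qQ1 qQ2 A0 q12 H; rewrite leNgt; apply/negP => l12.
have d0 : 0 < l2 - l1 by rewrite subr_gt0.
have [K2 HK2] := large_exists l2 Q2.
(* The number [300] turns [expR (- x) <= x^-1] into [A * ed <= 1 / 600], small enough for the final
   contradiction. *)
pose k := Num.max K0 (Num.max K2 (300 * A / (l2 - l1))).
have [kK0 kK2 kd] : [/\ K0 <= k, K2 <= k & 300 * A / (l2 - l1) <= k].
  by split; rewrite /k !le_max lexx ?orbT.
have [m [[u1 [v1 [s1 u10 v10 _ endu]]]
  [u2 [v2 [s2 u20 v20 [ul2 vl2] _]]]]] := H k kK0.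
have lk := HK2 k kK2.
have [k1 Qlk Qk] := lk; have k0 : 0 < k by clear - k1; lra.
have Q0 := cont_bounded_ge0 l20 qQ2.
have l1l1 : 0 <= l1 <= l1 by rewrite lexx ltW.
have l1l2 : 0 <= l1 <= l2 by rewrite !ltW.
have l02 : 0 <= (0 : R) <= l2 by rewrite lexx ltW.
have l22 : 0 <= l2 <= l2 by rewrite lexx ltW.
have s2' : sol l1 (fun x => q1 x + k ^+ 2) u2 v2.
  by apply: sol_ext (sol_sub (ltW l12) s2) => x xl; rewrite q12.
have [ue ve] := sol_unique (cont_bounded_shift k qQ1) s1 s2'
  (etrans u10 (esym u20)) (etrans v10 (esym v20)) l1l1.
(* The end condition of the shorter edge is now a statement about [u2] at the interior point
   [l1]. *)
rewrite ue ve in endu.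
have [Y [w gY]] := growing_exists k l20 (cont_bounded_refl qQ2).
have [Z [z gZ]] := growing_exists k l20 qQ2.
have W1 := edge_cauchy_decaying l20 qQ2 lk gY A0 s2 ul2 vl2 l1l2.
have W0 := edge_cauchy_decaying l20 qQ2 lk gY A0 s2 ul2 vl2 l02.
have xl1 : 0 <= l2 - l1 <= l2 by clear - d0 l10; lra.
have xl0 : 0 <= l2 - 0 <= l2 by rewrite subr0.
have [y1 dl1 _] := growing_large_bounds l20 (cont_bounded_refl qQ2) lk gY xl1.
have [y0 dl0 _] := growing_large_bounds l20 (cont_bounded_refl qQ2) lk gY xl0.
have [z1 _ dz1] := growing_large_bounds l20 qQ2 lk gZ l1l2.
have W2 := wronskian_const l1l2 s2 (growing_sol gZ).
have [_ Z0 z0 _ _] := gZ.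
rewrite /wronskian /decaying /decaying' in W0 W1; rewrite /wronskian in W2.
set d := expR _ * w (l2 - l1) in W1 dl1.
set d' := expR _ * w (l2 - 0) in W0 dl0.
set D := expR _ * z l1 in W2 dz1.
set y := Y (l2 - l1) in W1 y1; set y' := Y (l2 - 0) in W0 y0.
rewrite u20 v20 mulr0 expR0 !mul1r in W0.
rewrite u20 v20 Z0 z0 !mulr0 expR0 addr0 !mul1r !mulr1 in W2.
set e1 := expR (- k * l1) in W1; set E1 := expR (k * l1) in W2.
set u := u2 l1 in W1 W2 endu; set v := v2 l1 in W1 W2 endu.
have e10 : 0 < e1 by exact: expR_gt0.
have E10 : 0 < E1 by exact: expR_gt0.
pose e2 := expR (- (2 * k) * l2).
rewrite -/e2 in W0 W1.
have e20 : 0 < e2 by exact: expR_gt0.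
pose ed := expR (- (2 * k * (l2 - l1))).
have eE : e1 * E1 = 1 by rewrite -expRD mulNr addNr expR0.
have edE : ed = e2 * E1 * E1.
  by rewrite -!expRD; congr expR; ring.
have e2d : e2 <= ed.
  by rewrite ler_expR mulNr lerN2 ler_wpM2l ?mulr_ge0 ?(ltW k0)//; clear - l10; lra.
have ed0 : 0 < ed by exact: expR_gt0.
have edA : A * ed <= 1 / 600.
  have x0 : 0 < 2 * k * (l2 - l1) by rewrite !mulr_gt0.
  apply: le_trans (ler_wpM2l A0 (expR_le_inv x0)) _.
  rewrite ler_pdivrMr//; move: kd; rewrite ler_pdivrMr// => kd.
  by clear - kd; lra.
have Qk16 : Q2 / k <= 1 / 16.
  by rewrite ler_pdivrMr//; clear - Qk; lra.
have {}W1 : `|y * (v + k * u) + d * u| <= 5 * A * k * e2 * E1.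
  have -> : y * (v + k * u) + d * u =
      - (u * - (e1 * (k * y + d)) - v * (e1 * y)) * E1.
    rewrite -[LHS]mul1r -eE; ring.
  by rewrite normrM normrN (ger0_norm (ltW E10)) ler_wpM2r// ltW.
have du : `|d * u| <= 1 / 12 * `|v + k * u|.
  rewrite normrM; apply: (@le_trans _ _ (1 / 16 * `|u|)).
    by rewrite ler_wpM2r//; apply: le_trans Qk16.
  have : `|u| <= k * `|u| by rewrite ler_peMl.
  by move: endu; rewrite -mulrA; clear; lra.
have yv : 3 / 4 * `|v + k * u| <= `|y * (v + k * u)|.
  rewrite normrM ler_wpM2r//; apply: le_trans (ler_norm _).
  by case/andP: y1.
have vku : `|v + k * u| <= 10 * A * k * e2 * E1.
  have := ler_normB (y * (v + k * u) + d * u) (d * u).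
  rewrite addrK; move: W1 du yv (normr_ge0 (v + k * u)); clear; lra.
have ub : k * `|u| <= 20 * A * k * e2 * E1.
  have Ae : 0 <= A * k * e2 * E1 by rewrite !mulr_ge0// ltW.
  by move: endu vku Ae; rewrite -mulrA; clear; lra.
have vb : `|v| <= 30 * A * k * e2 * E1.
  have := ler_normB (v + k * u) (k * u).
  rewrite addrK [`|k * u|]normrM (ger0_norm (ltW k0)).
  by move: ub vku; clear; lra.
have big : `|k - m| <= 120 * A * k * ed.
  rewrite -W2; apply: le_trans (ler_normB _ _) _.
  have h1 : `|u * (E1 * (k * Z l1 + D))| <= 60 * A * k * e2 * E1 * E1.
    rewrite mulrCA normrM (ger0_norm (ltW E10)) mulrC ler_wpM2r ?(ltW E10)//.
    rewrite normrM; apply: le_trans (ler_wpM2l (normr_ge0 _) dz1) _.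
    by move: ub; clear; lra.
  have h2 : `|v * (E1 * Z l1)| <= 60 * A * k * e2 * E1 * E1.
    rewrite mulrCA normrM (ger0_norm (ltW E10)) mulrC ler_wpM2r ?(ltW E10)//.
    rewrite normrM (_ : 60 * _ * _ * _ * _ = (30 * A * k * e2 * E1) * 2); last by ring.
    by apply: ler_pM => //; clear - z1; rewrite ler_norml; lra.
  apply: le_trans (lerD h1 h2) _.
  by rewrite edE le_eqVlt; apply/orP; left; apply/eqP; ring.
have km : `|k + m| <= 1 / 4 + 10 * A * k * e2.
  have h : 3 / 4 * `|k + m| <= `|y' * (k + m)|.
    rewrite normrM ler_wpM2r//; apply: le_trans (ler_norm _).
    by case/andP: y0.
  have : `|y' * (k + m)| <= 5 * A * k * e2 + 1 / 16.
    have -> : y' * (k + m) = - (- (k * y' + d') - m * y') - d' by ring.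
    apply: le_trans (ler_normB _ _) _; rewrite normrN; apply: lerD => //.
    exact: le_trans Qk16.
  have Ae : 0 <= A * k * e2 by rewrite !mulr_ge0// ltW.
  by move: h Ae; clear; lra.
have kb : 10 * A * k * e2 + 120 * A * k * ed <= k * (130 / 600).
  have : A * e2 <= A * ed by rewrite ler_wpM2l.
  move=> h; have h2 : k * (10 * (A * e2) + 120 * (A * ed)) <= k * (130 / 600).
    by rewrite ler_wpM2l ?(ltW k0)//; move: h edA; clear; lra.
  by move: h2; clear; lra.
have := ler_normD (k - m) (k + m).
rewrite (_ : k - m + (k + m) = 2 * k); last by ring.
rewrite ger0_norm ?mulr_ge0 ?(ltW k0)//.
by move: big km kb k1; clear; lra.
Qed.

Lemma edge_unique l1 Q1 q1 l2 Q2 q2 A K0 : 0 < l1 -> 0 < l2 ->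
  cont_bounded l1 Q1 q1 -> cont_bounded l2 Q2 q2 -> 0 <= A ->
  (forall k, K0 <= k -> exists m, edge_cauchy l1 q1 k A m /\ edge_cauchy l2 q2 k A m) ->
  l1 = l2 /\ forall x, 0 < x < l1 -> q1 x = q2 x.
Proof.
move=> + + + + A0.
wlog l12 : l1 Q1 q1 l2 Q2 q2 / l1 <= l2 => [W l10 l20 qQ1 qQ2 H|l10 l20 qQ1 qQ2 H].
  have [l12|/ltW l21] := leP l1 l2; first exact: (W l1 Q1 q1 l2 Q2 q2).
  have [|E q21] := W l2 Q2 q2 l1 Q1 q1 l21 l20 l10 qQ2 qQ1.
    by move=> k /H[m [? ?]]; exists m.
  by split=> // x; rewrite -E => /q21.
have q12 := edge_unique_potential l10 l20 l12 qQ1 qQ2 A0 H.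
have l21 := edge_unique_length l10 l20 qQ1 qQ2 A0 q12 H.
by split=> //; apply/eqP; rewrite eq_le l12 l21.
Qed.

End EdgeUniqueness.

(** * The graph at large negative energy *)

Section GraphSolutions.
Context {R : realType}.
Implicit Types (l al be ga : edge -> R) (q u v w : edge -> R -> R).
Implicit Types (f g s t k lam A C K : R).

(* A solution of the equation on every edge with Dirichlet datum [f] at [v1] and
   [0] at [v4], Kirchhoff conditions at [v2] and [v3], and a jump [g] at [v2] along
   [e3]; [s] and [t] are the values at [v2] and [v3]. *)
Record graph_sol l q lam f g u v s t : Prop := {
  gs_sol : forall j, sol (l j) (fun x => q j x - lam) (u j) (v j);
  gs_e1 : u e1 0 = f /\ u e1 (l e1) = s;
  gs_e2 : u e2 0 = s /\ u e2 (l e2) = t;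
  gs_e3 : u e3 0 = s + g /\ u e3 (l e3) = t;
  gs_e4 : u e4 0 = t /\ u e4 (l e4) = 0;
  gs_v2 : v e1 (l e1) = v e2 0 + v e3 0;
  gs_v3 : v e4 0 = v e2 (l e2) + v e3 (l e3)
}.

Lemma edgeP (P : edge -> Prop) : P e1 -> P e2 -> P e3 -> P e4 -> forall j, P j.
Proof.
move=> p1 p2 p3 p4 j.
have : j \in [:: e1; e2; e3; e4].
  by case: j => -[|[|[|[|]]]].
by rewrite !inE => /or4P[] /eqP ->.
Qed.

Definition dn_data l q k C al be ga := [/\ 1 <= k, 0 < C, 100 * C <= k,
  forall j, dn_map (l j) (fun x => q j x + k ^+ 2) (al j) (be j) (ga j) &
  forall j, dn_bounds (l j) k C (al j) (be j) (ga j)].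

(** These are the entries of the Kirchhoff system for the values at [v2] and [v3]. The diagonal ones
    are close to [3 * k], since three edges meet; the coupling [dn_v23] through the ring is
    exponentially small. *)
Definition dn_v2 al ga : R := ga e1 + al e2 + al e3.
Definition dn_v23 be : R := be e2 + be e3.
Definition dn_v3 al ga : R := ga e2 + ga e3 + al e4.

Lemma dn_edge_bounds l q k C al be ga : dn_data l q k C al be ga ->
  [/\ 0 < k, 0 < C / k, 100 * (C / k) <= k & forall j,
    [/\ k - C / k <= al j, al j <= k + C / k, k - C / k <= ga j,
        ga j <= k + C / k & 0 < be j <= C / k]].
Proof.
move=> [k1 C0 Ck _ bd]; have k0 : 0 < k := lt_le_trans ltr01 k1.
split=> //; first by rewrite divr_gt0.
  have : C / k <= C by rewrite ler_pdivrMr// ler_peMr// ltW.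
  by move: Ck; clear; lra.
move=> j; have [] := bd j; rewrite !ler_norml => /andP[? ?] /andP[? ?] -> _ ->.
by split=> //; clear bd; lra.
Qed.

Lemma dn_vertex_bounds l q k C al be ga : dn_data l q k C al be ga ->
  let a := dn_v2 al ga in let b := dn_v23 be in let d := dn_v3 al ga in
  [/\ 29 / 10 * k <= a <= 31 / 10 * k, 29 / 10 * k <= d <= 31 / 10 * k,
      0 < b <= 2 * (C / k), b <= k / 50 & 0 < a * d - b ^+ 2].
Proof.
move=> D a b d; have [k0 dl0 dlk bounds] := dn_edge_bounds D.
have ab : 29 / 10 * k <= a <= 31 / 10 * k.
  have [_ _ ? ? _] := bounds e1; have [? ? _ _ _] := bounds e2.
  have [? ? _ _ _] := bounds e3.
  by rewrite /a /dn_v2; clear D bounds a b d; lra.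
have db : 29 / 10 * k <= d <= 31 / 10 * k.
  have [_ _ ? ? _] := bounds e2; have [_ _ ? ? _] := bounds e3.
  have [? ? _ _ _] := bounds e4.
  by rewrite /d /dn_v3; clear D bounds ab a b d; lra.
have bb : 0 < b <= 2 * (C / k).
  have [_ _ _ _ ?] := bounds e2; have [_ _ _ _ ?] := bounds e3.
  by rewrite /b /dn_v23; clear D bounds ab db a b d; lra.
have bk : b <= k / 50.
  by have /andP[_] := bb; move: dlk; clear; lra.
split=> //.
have /andP[a1 _] := ab; have /andP[d1 _] := db; have /andP[b0 _] := bb.
have ba : b < a by move: bk k0; clear - a1; lra.
have bd' : b < d by move: bk k0; clear - d1; lra.
by rewrite subr_gt0 expr2 ltr_pM// ltW.
Qed.

Definition vertex_eqs al be ga f g s t :=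
  dn_v2 al ga * s = be e1 * f - al e3 * g + dn_v23 be * t /\
  dn_v3 al ga * t = dn_v23 be * s + be e3 * g.

Lemma vertex_eqs_solvable l q k C al be ga f g : dn_data l q k C al be ga ->
  exists s t, vertex_eqs al be ga f g s t.
Proof.
move=> D; have [_ _ _ _ det0] := dn_vertex_bounds D.
move: det0; rewrite /vertex_eqs.
move: (dn_v2 al ga) (dn_v23 be) (dn_v3 al ga) => a b d det0.
have D0 : a * d - b ^+ 2 != 0 by rewrite gt_eqF.
exists ((d * (be e1 * f - al e3 * g) + b * (be e3 * g)) / (a * d - b ^+ 2)).
exists ((b * (be e1 * f - al e3 * g) + a * (be e3 * g)) / (a * d - b ^+ 2)).
by split; field.
Qed.

Definition edge_derivs l al be ga f g s t v := [/\
  v e1 0 = - al e1 * f + be e1 * s /\ v e1 (l e1) = - be e1 * f + ga e1 * s,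
  v e2 0 = - al e2 * s + be e2 * t /\ v e2 (l e2) = - be e2 * s + ga e2 * t,
  v e3 0 = - al e3 * (s + g) + be e3 * t /\
    v e3 (l e3) = - be e3 * (s + g) + ga e3 * t &
  v e4 0 = - al e4 * t /\ v e4 (l e4) = - be e4 * t].

Lemma graph_sol_exists l q k C al be ga f g s t : dn_data l q k C al be ga ->
  vertex_eqs al be ga f g s t -> exists u v,
  graph_sol l q (- k ^+ 2) f g u v s t /\ edge_derivs l al be ga f g s t v.
Proof.
move=> [_ _ _ dn _] [eq1 eq2].
have [u1 [v1 [s1 u10 u1l v10 v1l]]] := dn e1 f s.
have [u2 [v2 [s2 u20 u2l v20 v2l]]] := dn e2 s t.
have [u3 [v3 [s3 u30 u3l v30 v3l]]] := dn e3 (s + g) t.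
have [u4 [v4 [s4 u40 u4l v40 v4l]]] := dn e4 t 0.
pose u (j : edge) := tnth [tuple u1; u2; u3; u4] j.
pose v (j : edge) := tnth [tuple v1; v2; v3; v4] j.
have D : edge_derivs l al be ga f g s t v.
  by split; split => //; rewrite (_ : v e4 = v4)// ?v40 ?v4l mulr0 addr0.
exists u, v; split=> //; case: D => [[D10 D1l] [D20 D2l] [D30 D3l] [D40 D4l]].
split=> //.
- by apply: edgeP; rewrite opprK.
- rewrite D1l D20 D30; move: eq1; rewrite /dn_v2 /dn_v23; clear; lra.
- rewrite D40 D2l D3l; move: eq2; rewrite /dn_v3 /dn_v23; clear; lra.
Qed.

(** The system is diagonally dominant with nonpositive off-diagonal entries, so a positive source
    yields positive values, obtained by Cramer's rule. *)
Lemma source_bounds l q k C al be ga s t : dn_data l q k C al be ga ->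
  vertex_eqs al be ga 1 0 s t -> [/\ 0 < s, 0 < t, t <= s & 2 * k * s <= be e1].
Proof.
move=> D [eq1 eq2]; have [k0 dl0 dlk bounds] := dn_edge_bounds D.
have [ab db bb bk det0] := dn_vertex_bounds D.
set a := dn_v2 al ga in eq1 ab det0; set d := dn_v3 al ga in eq2 db det0.
set b := dn_v23 be in eq1 eq2 bb bk det0.
rewrite mulr0 in eq2; rewrite mulr1 mulr0 in eq1.
have /andP[a1 _] := ab; have /andP[d1 _] := db; have /andP[b0 _] := bb.
have [_ _ _ _ /andP[b10 _]] := bounds e1.
have d0 : 0 < d by apply: lt_le_trans d1; rewrite mulr_gt0// divr_gt0.
have D0 : a * d - b ^+ 2 != 0 by rewrite gt_eqF.
have sE : s * (a * d - b ^+ 2) = d * be e1.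
  have : d * (a * s) = d * (be e1 + b * t) by rewrite eq1; ring.
  rewrite mulrDr [d * (b * t)]mulrCA eq2; move=> H.
  apply/eqP; rewrite -subr_eq0; apply/eqP.
  by rewrite [RHS](_ : 0 = d * (a * s) - (d * be e1 + b * (b * s + 0)));
    [ring|rewrite H; ring].
have s0 : 0 < s by rewrite -(pmulr_lgt0 _ det0) sE mulr_gt0.
have t0 : 0 < t by rewrite -(pmulr_rgt0 _ d0) eq2 addr0 mulr_gt0.
have ts : t <= s.
  rewrite -(ler_pM2l d0) eq2 addr0 ler_wpM2r ?(ltW s0)//.
  by move: bk k0; clear - d1; lra.
split=> //.
have h1 : 29 / 10 * k * s <= a * s by rewrite ler_wpM2r// ltW.
have h2 : b * t <= k / 50 * s by rewrite ler_pM// ltW.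
have h3 : 0 < k * s by rewrite mulr_gt0.
by move: eq1 h1 h2 h3; clear; lra.
Qed.

Lemma source_asymptotics l q k C al be ga s t v : dn_data l q k C al be ga ->
  vertex_eqs al be ga 1 0 s t -> edge_derivs l al be ga 1 0 s t v ->
  `|v e1 0 + k| <= 5 * (C / k) /\ `|v e3 0| <= 5 * (C / k).
Proof.
move=> D eqs [[-> _] _ [-> _] _]; have [s0 t0 ts sb] := source_bounds D eqs.
have [k0 dl0 dlk bounds] := dn_edge_bounds D.
set dl := C / k in dl0 dlk bounds *.
have [a1 a1' _ _ /andP[b10 b1]] := bounds e1.
have [a3 a3' _ _ /andP[b30 b3]] := bounds e3.
have s1 : s <= 1.
  rewrite -(ler_pM2l k0) mulr1; move: (mulr_gt0 k0 s0) sb b1 dlk dl0.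
  by clear; lra.
have h1 : be e1 * s <= dl * 1 by rewrite ler_pM// ltW.
have h1' : 0 <= be e1 * s by rewrite mulr_ge0// ltW.
have h3 : be e3 * t <= dl * 1 by rewrite ler_pM ?(ltW b30) ?(ltW t0)// (le_trans ts).
have h3' : 0 <= be e3 * t by rewrite mulr_ge0// ltW.
have h4 : al e3 * s <= 2 * k * s.
  by rewrite ler_wpM2r ?(ltW s0)//; move: dlk dl0 a3'; clear; lra.
have h4' : 0 <= al e3 * s.
  by rewrite mulr_ge0 ?(ltW s0)//; move: dlk dl0 a3; clear; lra.
split; rewrite ler_norml; move: h1 h1' h3 h3' h4 h4' sb a1 a1' b1 dl0; clear; lra.
Qed.

(** To leading order three edges of equal conductance [k] meet at [v2], and the jump is shared: [s]
    is near [- 1 / 3], the value on [e3] near [2 / 3], which gives the flux [- 2 / 3 * k]. *)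
Lemma jump_asymptotics l q k C al be ga s t v : dn_data l q k C al be ga ->
  vertex_eqs al be ga 0 1 s t -> edge_derivs l al be ga 0 1 s t v ->
  `|v e1 0| <= 5 * (C / k) /\ `|v e3 0 + 2 / 3 * k| <= 5 * (C / k).
Proof.
move=> D [eq1 eq2] [[-> _] _ [-> _] _].
have [k0 dl0 dlk bounds] := dn_edge_bounds D.
have [ab db bb bk det0] := dn_vertex_bounds D.
have aE : dn_v2 al ga = ga e1 + al e2 + al e3 by [].
set a := dn_v2 al ga in eq1 ab det0 aE; set d := dn_v3 al ga in eq2 db det0.
set b := dn_v23 be in eq1 eq2 bb bk det0.
set dl := C / k in dl0 dlk bounds bb *.
clearbody a b d.
have /andP[a1 a1'] := ab; have /andP[d1 _] := db; have /andP[b0 b2] := bb.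
have [x3 x3' _ _ /andP[b30 b3]] := bounds e3.
have [_ _ g1 g1' /andP[b10 b1]] := bounds e1.
have [x2 x2' _ _ _] := bounds e2.
have st : `|s| + `|t| <= 1.
  have h1 : 29 / 10 * k * `|s| <= 101 / 100 * k + k / 50 * `|t|.
    apply: (@le_trans _ _ (`|a * s|)).
      by rewrite normrM ler_wpM2r// (le_trans a1)// ler_norm.
    have -> : a * s = b * t - al e3 by rewrite eq1; ring.
    apply: le_trans (ler_normB _ _) _; rewrite addrC; apply: lerD.
      by rewrite ger0_norm; move: x3 x3' dlk dl0; clear; lra.
    by rewrite normrM (ger0_norm (ltW b0)) ler_wpM2r.
  have h2 : 29 / 10 * k * `|t| <= k / 100 + k / 50 * `|s|.
    apply: (@le_trans _ _ (`|d * t|)).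
      by rewrite normrM ler_wpM2r// (le_trans d1)// ler_norm.
    have -> : d * t = be e3 + b * s by rewrite eq2; ring.
    apply: le_trans (ler_normD _ _) _; apply: lerD.
      by rewrite ger0_norm ?(ltW b30)//; move: b3 dlk; clear; lra.
    by rewrite normrM (ger0_norm (ltW b0)) ler_wpM2r.
  rewrite -(ler_pM2l k0) mulrDr; move: h1 h2 k0; clear.
  have := normr_ge0 s; have := normr_ge0 t => ? ? *; lra.
have s1 : `|s| <= 1 by apply: le_trans st; rewrite lerDl.
have t1 : `|t| <= 1 by apply: le_trans st; rewrite lerDr.
have small c x y : `|c| <= x -> `|y| <= 1 -> `|c * y| <= x.
  move=> cx y1; rewrite normrM -[leRHS]mulr1 ler_pM//.
have H1 : `|be e1 * s| <= dl by apply: small => //; rewrite ger0_norm// ltW.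
have H2 : `|b * t| <= 2 * dl by apply: small => //; rewrite ger0_norm// ltW.
have H3 : `|(a - 3 * k) * s| <= 3 * dl.
  by apply: small => //; rewrite ler_norml aE;
    move: g1 g1' x2 x2' x3 x3'; clear; lra.
have H4 : `|be e3 * t| <= dl by apply: small => //; rewrite ger0_norm// ltW.
have H5 : `|(al e3 - k) * s| <= dl.
  by apply: small => //; rewrite ler_norml; move: x3 x3'; clear; lra.
split; first by rewrite mulr0 add0r (le_trans H1)//; move: dl0; clear; lra.
have -> : - al e3 * (s + 1) + be e3 * t + 2 / 3 * k =
  1 / 3 * ((a - 3 * k) * s) - 1 / 3 * (b * t) - 2 / 3 * (al e3 - k) 
  - (al e3 - k) * s + be e3 * t.
  have -> : b * t = a * s + al e3 by move: eq1; rewrite mulr0 mulr1; clear; lra.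
  by clear; lra.
have H6 : `|al e3 - k| <= dl by rewrite ler_norml; move: x3 x3'; clear; lra.
move: H2 H3 H4 H5 H6 dl0; rewrite !ler_norml; clear; lra.
Qed.

End GraphSolutions.

(** * Recovering the edges one after another from the response *)

Section Peeling.
Context {R : realType}.
Implicit Types (l al be ga : edge -> R) (q u v w : edge -> R -> R).
Implicit Types (f g s t k m lam A C K Q : R).

Definition regular l q := forall j : edge, 0 < l j /\ exists Q, cont_bounded (l j) Q (q j).

Lemma dn_data_exists l q : regular l q -> exists C K, 0 < C /\ forall k, K <= k ->
  exists al be ga, dn_data l q k C al be ga.
Proof.
move=> reg.
have /choice[C_ /choice[K_ H]] : forall j, exists C K, [/\ 0 < C, 0 < K &
    forall k, K <= k -> exists a b c : R,
    dn_map (l j) (fun x => q j x + k ^+ 2) a b c /\ dn_bounds (l j) k C a b c].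
  by move=> j; have [l0 [Q qQ]] := reg j; exact: edge_dn l0 qQ.
pose C := \sum_j C_ j; pose K := 1 + 100 * C + \sum_j K_ j.
have C_0 j : 0 < C_ j by have [] := H j.
have K_0 j : 0 < K_ j by have [] := H j.
have leC j : C_ j <= C by rewrite /C (bigD1 j)//= lerDl sumr_ge0// => i _; exact: ltW.
have leK j : K_ j <= \sum_j K_ j.
  by rewrite (bigD1 j)//= lerDl sumr_ge0// => i _; exact: ltW.
have C0 : 0 < C by exact: lt_le_trans (leC e1).
exists C, K; split=> // k Kk.
have KS : \sum_j K_ j <= k by move: Kk C0; rewrite /K; clear; lra.
have /choice[al /choice[be /choice[ga Hd]]] : forall j, exists a b c : R,
    dn_map (l j) (fun x => q j x + k ^+ 2) a b c /\ dn_bounds (l j) k (C_ j) a b c.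
  by move=> j; have [_ _] := H j; apply; exact: le_trans KS.
exists al, be, ga.
have KS0 : 0 <= \sum_j K_ j by apply: sumr_ge0 => i _; exact: ltW.
have k1 : 1 <= k by move: Kk C0 KS0; rewrite /K; clear; lra.
have k0 : 0 < k := lt_le_trans ltr01 k1.
split=> //; first by move: Kk KS0; rewrite /K; clear; lra.
- by move=> j; have [] := Hd j.
- move=> j; have [_ [h1 h2 h3 h4 h5]] := Hd j.
  have h : C_ j / k <= C / k by rewrite ler_wpM2r// invr_ge0 ltW.
  split=> //; try exact: le_trans h.
  by apply: le_trans h4 _; rewrite -!mulrA ler_wpM2r// mulr_ge0 ?expR_ge0// ltW.
Qed.

(** [D * T = be] is the balance at the far vertex of an edge carrying [1] at its near end, and
    [D - ga] is the conductance of everything beyond that vertex. Two further edges make it at least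
    [7 / 4 * k], so the logarithmic derivative at the far end lies at least [3 / 4 * k] below
    [- k]. *)
Lemma leaf_cauchy (L : R) (p u v : R -> R) k m C (be ga T D : R) :
  sol L (fun x => p x - (- k ^+ 2)) u v -> u 0 = 1 -> v 0 = m -> u L = T ->
  v L = - be + ga * T -> D * T = be -> 0 < k -> k <= D -> 0 <= ga ->
  7 / 4 * k <= D - ga -> 0 < be -> be <= C * k * expR (- k * L) ->
  edge_cauchy L p k C m.
Proof.
move=> s u0 v0 uL vL DT k0 kD ga0 Dga be0 beC.
have D0 : 0 < D by exact: lt_le_trans kD.
have T0 : 0 < T by rewrite -(pmulr_rgt0 _ D0) DT.
have vE : v L = - ((D - ga) * T) by rewrite vL -DT; ring.
have gT : 0 <= ga * T by rewrite mulr_ge0// ltW.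
exists u, v; split=> //.
- by apply: sol_ext s => x _; rewrite opprK.
- split; last first.
    rewrite vE normrN ger0_norm; last first.
      by rewrite mulr_ge0 ?(ltW T0)//; move: Dga k0; clear; lra.
    by apply: le_trans beC; rewrite -DT; move: gT; clear; lra.
  rewrite uL gtr0_norm// -(ler_pM2l k0) mulrA [k * C]mulrC.
  by apply: le_trans beC; rewrite -DT ler_wpM2r// ltW.
- rewrite vE uL (gtr0_norm T0).
  have h : 7 / 4 * k * T <= (D - ga) * T by rewrite ler_wpM2r// ltW.
  have kT : 0 < k * T by rewrite mulr_gt0.
  by rewrite ler0_norm; move: h kT; clear; lra.
Qed.

Lemma sol_combination l q lam f g u v s t f' g' u' v' s' t' x y j :
  graph_sol l q lam f g u v s t -> graph_sol l q lam f' g' u' v' s' t' ->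
  sol (l j) (fun z => q j z - lam) (fun z => x * u j z + y * u' j z)
    (fun z => x * v j z + y * v' j z).
Proof. move=> G G'; exact: sol_comb (gs_sol G j) (gs_sol G' j). Qed.

(** [u] answers a unit source at [v1], [z] a unit jump at [v2]. The combination for [e2] has the
    values [1] on [e2] and [0] on [e3] at [v2], the one for [e3] the values [0] and [1]; dividing
    [u] by [t] normalises it at [v3] for [e4]. The factors [-1], [1] and [0] keep all of them in the
    form of [sol_comb]. *)
Definition far_field l q C k := exists u v s t z w c d,
  [/\ graph_sol l q (- k ^+ 2) 1 0 u v s t,
      graph_sol l q (- k ^+ 2) 0 1 z w c d,
      [/\ `|v e1 0 + k| <= C / k, `|v e3 0| <= C / k,
          `|w e1 0| <= C / k & `|w e3 0 + 2 / 3 * k| <= C / k],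
      s != 0 /\ t != 0 &
      [/\ edge_cauchy (l e1) (q e1) k C (v e1 0),
          edge_cauchy (l e2) (q e2) k C ((c + 1) / s * v e2 0 + -1 * w e2 0),
          edge_cauchy (l e3) (q e3) k C (- (c / s) * v e3 0 + 1 * w e3 0) &
          edge_cauchy (l e4) (q e4) k C (t^-1 * v e4 0 + 0 * w e4 0)]].

Lemma far_field_exists l q : regular l q -> exists C K, 0 < C /\
  forall k, K <= k -> 0 < k /\ far_field l q C k.
Proof.
move=> reg; have [C [K [C0 H]]] := dn_data_exists reg.
exists (5 * C), K; split; first by rewrite mulr_gt0.
move=> k /H[al [be [ga D]]]; have [k0 dl0 dlk bounds] := dn_edge_bounds D.
split=> //.
have [s [t Ew]] := vertex_eqs_solvable 1 0 D.
have [c [d Ez]] := vertex_eqs_solvable 0 1 D.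
have [u [v [Gu Du]]] := graph_sol_exists D Ew.
have [z [w [Gz Dz]]] := graph_sol_exists D Ez.
have [v1a v3a] := source_asymptotics D Ew Du.
have [w1a w3a] := jump_asymptotics D Ez Dz.
have [s0 t0 ts sb] := source_bounds D Ew.
have s_neq0 : s != 0 by rewrite gt_eqF.
have t_neq0 : t != 0 by rewrite gt_eqF.
exists u, v, s, t, z, w, c, d; split=> //.
  by split; rewrite -[leRHS]mulrA.
have [_ _ _ _ bd] := D.
have beC j : be j <= 5 * C * k * expR (- k * l j).
  have [_ _ _ h _] := bd j; apply: le_trans h _; rewrite -!mulrA mulrCA.
  by rewrite mulrCA ler_peMl ?ler1n// !mulr_ge0 ?expR_ge0// ltW.
have be0 j : 0 < be j by have [_ _ _ _ /andP[]] := bounds j.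
have ga0 j : 0 <= ga j.
  by have [_ _ ? _ _] := bounds j; move: dlk dl0; clear D; lra.
have [ab db bb bk det0] := dn_vertex_bounds D.
have dE : dn_v3 al ga = ga e2 + ga e3 + al e4 by [].
have bE : dn_v23 be = be e2 + be e3 by [].
case: Ew => eqw1 eqw2; case: Ez => eqz1 eqz2.
have [[v10 v1l] [v20 v2l] [v30 v3l] [v40 v4l]] := Du.
have [[w10 w1l] [w20 w2l] [w30 w3l] [w40 w4l]] := Dz.
have /andP[d1 _] := db; have /andP[a1 _] := ab.
have kd : k <= dn_v3 al ga by move: d1 k0; clear; lra.
split.
(* For [e1] the far vertex is [v2]; the feedback of the ring through [v3] lowers the total
   conductance by [dn_v23 be * (t / s)], a small amount because [t <= s]. *)
- apply: (@leaf_cauchy _ _ _ _ _ _ _ (be e1) (ga e1) s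
    (dn_v2 al ga - dn_v23 be * (t / s)) (gs_sol Gu e1)) => //.
  + by have [] := gs_e1 Gu.
  + by have [] := gs_e1 Gu.
  + by rewrite v1l mulr1.
  + rewrite mulrBl eqw1; field; exact: s_neq0.
  + have : dn_v23 be * (t / s) <= k / 50 * 1.
      by apply: ler_pM => //; rewrite ?divr_ge0 ?(ltW s0) ?(ltW t0)//
        ?ler_pdivrMr ?mul1r//; have /andP[/ltW] := bb.
    by move: a1 k0; clear; lra.
  + have : dn_v23 be * (t / s) <= k / 50 * 1.
      by apply: ler_pM => //; rewrite ?divr_ge0 ?(ltW s0) ?(ltW t0)//
        ?ler_pdivrMr ?mul1r//; have /andP[/ltW] := bb.
    have [? ? _ _ _] := bounds e2; have [? ? _ _ _] := bounds e3.
    by rewrite /dn_v2; move: dlk k0; clear D; lra.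
- apply: (leaf_cauchy (be := be e2) (ga := ga e2) (T := (c + 1) / s * t + -1 * d)
    (D := dn_v3 al ga) (sol_combination ((c + 1) / s) (-1) e2 Gu Gz)) => //.
  + by have [-> _] := gs_e2 Gu; have [-> _] := gs_e2 Gz; field.
  + by have [_ ->] := gs_e2 Gu; have [_ ->] := gs_e2 Gz.
  + by rewrite v2l w2l; field.
  + rewrite mulrDr [X in X + _]mulrCA eqw2 [X in _ + X]mulrCA eqz2 bE.
    by field.
  + have [? ? _ _ _] := bounds e4; have [_ _ ? ? _] := bounds e3.
    by rewrite /dn_v3; move: dlk k0; clear D; lra.
- apply: (leaf_cauchy (be := be e3) (ga := ga e3) (T := - (c / s) * t + 1 * d)
    (D := dn_v3 al ga) (sol_combination (- (c / s)) 1 e3 Gu Gz)) => //.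
  + by have [-> _] := gs_e3 Gu; have [-> _] := gs_e3 Gz; field.
  + by have [_ ->] := gs_e3 Gu; have [_ ->] := gs_e3 Gz.
  + by rewrite v3l w3l; field.
  + rewrite mulrDr [X in X + _]mulrCA eqw2 [X in _ + X]mulrCA eqz2 bE.
    by field.
  + have [? ? _ _ _] := bounds e4; have [_ _ ? ? _] := bounds e2.
    by rewrite /dn_v3; move: dlk k0; clear D; lra.
(* The far end of [e4] is a Dirichlet vertex: the solution vanishes there and the end condition
   holds with left side zero. *)
- have E4 : t^-1 * v e4 (l e4) + 0 * w e4 (l e4) = - be e4.
    by rewrite v4l; field.
  have U4 : t^-1 * u e4 (l e4) + 0 * z e4 (l e4) = 0.
    by have [_ ->] := gs_e4 Gu; rewrite mulr0 mul0r addr0.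
  exists (fun x => t^-1 * u e4 x + 0 * z e4 x), (fun x => t^-1 * v e4 x + 0 * w e4 x).
  split=> //.
  + by apply: sol_ext (sol_combination (t^-1) 0 e4 Gu Gz) => x _; rewrite opprK.
  + by have [-> _] := gs_e4 Gu; rewrite mulVf// mul0r addr0.
  + rewrite U4 normr0 E4 normrN gtr0_norm//; split=> //.
    by rewrite !mulr_ge0 ?expR_ge0// ltW.
  + by rewrite U4 normr0 mulr0.
Qed.

(** Quantified over all pairs of solutions, so that the data can be read off whichever solutions are
    at hand. *)
Definition same_response l q l' q' k f g := forall u v s t u' v' s' t',
  graph_sol l q (- k ^+ 2) f g u v s t -> graph_sol l' q' (- k ^+ 2) f g u' v' s' t' ->
  v e1 0 = v' e1 0 /\ v e3 0 = v' e3 0.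

Lemma edge_unique_from l q l' q' C C' K (j : edge) :
  regular l q -> regular l' q' -> 0 < C -> 0 < C' ->
  (forall k, K <= k -> 0 < k /\ exists m, edge_cauchy (l j) (q j) k C m /\
     edge_cauchy (l' j) (q' j) k C' m) ->
  l j = l' j /\ forall x, 0 < x < l j -> q j x = q' j x.
Proof.
move=> reg reg' C0 C'0 H.
have [l0 [Q qQ]] := reg j; have [l0' [Q' qQ']] := reg' j.
have CC0 : 0 <= C + C' by rewrite addr_ge0// ltW.
apply: (edge_unique (K0 := K) l0 l0' qQ qQ' CC0) => k /H[k0 [m [E E']]]; exists m.
have weak L p A B : 0 <= A -> 0 <= B -> edge_cauchy L p k A m -> edge_cauchy L p k (A + B) m.
  move=> A0 B0 [u [v [su u0 v0 [h1 h2] hl]]]; exists u, v; split=> //; split.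
    by apply: le_trans h1 _; rewrite ler_wpM2r ?expR_ge0// lerDl.
  apply: le_trans h2 _; rewrite ler_wpM2r ?expR_ge0// ler_wpM2r ?(ltW k0)//.
  by rewrite lerDl.
by split; [exact: weak (ltW C0) (ltW C'0) E|rewrite addrC; exact: weak (ltW C'0) (ltW C0) E'].
Qed.

Lemma sol_transfer l q l' q' k f g u v s t f' g' u' v' s' t' j :
  regular l q ->
  graph_sol l q (- k ^+ 2) f g u v s t -> graph_sol l' q' (- k ^+ 2) f' g' u' v' s' t' ->
  l j = l' j -> (forall x, 0 < x < l j -> q j x = q' j x) ->
  u j 0 = u' j 0 -> v j 0 = v' j 0 ->
  u j (l j) = u' j (l' j) /\ v j (l j) = v' j (l' j).
Proof.
move=> reg G G' ll qq u0 v0; have [l0 [Q qQ]] := reg j.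
have S := gs_sol G j; have S' := gs_sol G' j; rewrite -ll in S' *.
have {}S : sol (l j) (fun x => q j x + k ^+ 2) (u j) (v j).
  by apply: sol_ext S => x _; rewrite opprK.
have {}S' : sol (l j) (fun x => q j x + k ^+ 2) (u' j) (v' j).
  by apply: sol_ext S' => x xl; rewrite opprK qq.
apply: (sol_unique (cont_bounded_shift k qQ) S S') => //.
by rewrite lexx ltW.
Qed.

Lemma response_determines_graph l q l' q' K0 : regular l q -> regular l' q' ->
  (forall k, K0 <= k -> same_response l q l' q' k 1 0 /\ same_response l q l' q' k 0 1) ->
  forall j, l j = l' j /\ forall x, 0 < x < l j -> q j x = q' j x.
Proof.
move=> reg reg' Hresp.
have [C [K [C0 far]]] := far_field_exists reg.
have [C' [K' [C'0 far']]] := far_field_exists reg'.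
pose M := Num.max K0 (Num.max K K').
have big k : M <= k -> [/\ K0 <= k, K <= k & K' <= k].
  by rewrite !ge_max => /andP[-> /andP[-> ->]].
have E1 : l e1 = l' e1 /\ forall x, 0 < x < l e1 -> q e1 x = q' e1 x.
  apply: (edge_unique_from (C := C) (C' := C') (K := M)) => // k /big[k0 kK kK'].
  have [kp [u [v [s [t [z [w [c [d [G _ _ _ [cau _ _ _]]]]]]]]]]] := far k kK.
  have [_ [u' [v' [s' [t' [z' [w' [c' [d' [G' _ _ _ [cau' _ _ _]]]]]]]]]]] := far' k kK'.
  split=> //; exists (v e1 0); split=> //.
  by have [-> _] := (Hresp k k0).1 _ _ _ _ _ _ _ _ G G'.
have [l1 q1] := E1.
(* The known edge [e1] carries the Cauchy data from [v1] to [v2]; there the Kirchhoff condition and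
   the known flux into [e3] yield the flux into [e2]. *)
have star k u v s t z w c d u' v' s' t' z' w' c' d' : K0 <= k ->
    graph_sol l q (- k ^+ 2) 1 0 u v s t -> graph_sol l q (- k ^+ 2) 0 1 z w c d ->
    graph_sol l' q' (- k ^+ 2) 1 0 u' v' s' t' ->
    graph_sol l' q' (- k ^+ 2) 0 1 z' w' c' d' ->
    [/\ s = s', c = c', v e2 0 = v' e2 0, w e2 0 = w' e2 0 &
        v e3 0 = v' e3 0 /\ w e3 0 = w' e3 0].
  move=> k0 G Z G' Z'.
  have [v1 v3] := (Hresp k k0).1 _ _ _ _ _ _ _ _ G G'.
  have [w1 w3] := (Hresp k k0).2 _ _ _ _ _ _ _ _ Z Z'.
  have [] := sol_transfer (j := e1) reg G G' l1 q1 _ v1.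
    by have [-> _] := gs_e1 G; have [-> _] := gs_e1 G'.
  have [_ ->] := gs_e1 G; have [_ ->] := gs_e1 G' => ss vl.
  have [] := sol_transfer (j := e1) reg Z Z' l1 q1 _ w1.
    by have [-> _] := gs_e1 Z; have [-> _] := gs_e1 Z'.
  have [_ ->] := gs_e1 Z; have [_ ->] := gs_e1 Z' => cc wl.
  move: vl wl; rewrite (gs_v2 G) (gs_v2 G') (gs_v2 Z) (gs_v2 Z') v3 w3.
  by move=> /addIr -> /addIr ->.
have E2 : l e2 = l' e2 /\ forall x, 0 < x < l e2 -> q e2 x = q' e2 x.
  apply: (edge_unique_from (C := C) (C' := C') (K := M)) => // k /big[k0 kK kK'].
  have [kp [u [v [s [t [z [w [c [d [G Z _ _ [_ cau _ _]]]]]]]]]]] := far k kK.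
  have [_ [u' [v' [s' [t' [z' [w' [c' [d' [G' Z' _ _ [_ cau' _ _]]]]]]]]]]] := far' k kK'.
  have [ss cc vv ww _] := star k _ _ _ _ _ _ _ _ _ _ _ _ _ _ _ _ k0 G Z G' Z'.
  split=> //; exists ((c + 1) / s * v e2 0 + -1 * w e2 0); split=> //.
  by rewrite ss cc vv ww.
have E3 : l e3 = l' e3 /\ forall x, 0 < x < l e3 -> q e3 x = q' e3 x.
  apply: (edge_unique_from (C := C) (C' := C') (K := M)) => // k /big[k0 kK kK'].
  have [kp [u [v [s [t [z [w [c [d [G Z _ _ [_ _ cau _]]]]]]]]]]] := far k kK.
  have [_ [u' [v' [s' [t' [z' [w' [c' [d' [G' Z' _ _ [_ _ cau' _]]]]]]]]]]] := far' k kK'.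
  have [ss cc _ _ [vv ww]] := star k _ _ _ _ _ _ _ _ _ _ _ _ _ _ _ _ k0 G Z G' Z'.
  split=> //; exists (- (c / s) * v e3 0 + 1 * w e3 0); split=> //.
  by rewrite ss cc vv ww.
(* The data are carried along [e2] and [e3] to [v3], where the Kirchhoff condition gives the flux
   into [e4]. *)
have E4 : l e4 = l' e4 /\ forall x, 0 < x < l e4 -> q e4 x = q' e4 x.
  apply: (edge_unique_from (C := C) (C' := C') (K := M)) => // k /big[k0 kK kK'].
  have [kp [u [v [s [t [z [w [c [d [G Z _ _ [_ _ _ cau]]]]]]]]]]] := far k kK.
  have [_ [u' [v' [s' [t' [z' [w' [c' [d' [G' Z' _ _ [_ _ _ cau']]]]]]]]]]] := far' k kK'.
  have [ss _ vv2 _ [vv3 _]] := star k _ _ _ _ _ _ _ _ _ _ _ _ _ _ _ _ k0 G Z G' Z'.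
  have [l2 q2] := E2; have [l3 q3] := E3.
  have [] := sol_transfer (j := e2) reg G G' l2 q2 _ vv2.
    by have [-> _] := gs_e2 G; have [-> _] := gs_e2 G'.
  have [_ ->] := gs_e2 G; have [_ ->] := gs_e2 G' => tt vl2.
  have [] := sol_transfer (j := e3) reg G G' l3 q3 _ vv3.
    by have [-> _] := gs_e3 G; have [-> _] := gs_e3 G'; rewrite ss.
  move=> _ vl3.
  split=> //; exists (t^-1 * v e4 0 + 0 * w e4 0); split=> //.
  have v4 : v e4 0 = v' e4 0 by rewrite (gs_v3 G) vl2 vl3 -(gs_v3 G').
  by move: cau'; rewrite tt v4 !mul0r.
exact: edgeP.
Qed.

End Peeling.

(** * Eigenfunctions and spectral expansions *)

Section Eigenfunctions.
Context {R : realType}.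
Implicit Types (l : edge -> R) (q phi u v : edge -> R -> R) (mu L M : R).

(** The derivative is known only inside; its continuous extension [v] and the mean value inequality
    identify the one-sided limit at [0]. *)
Lemma right_derivative (u v : R -> R) L : 0 < L -> continuous u -> continuous v ->
  (forall x, 0 < x < L -> is_derive x 1 u (v x)) ->
  h^-1 * (u h - u 0) @[h --> 0^'+] --> v 0.
Proof.
move=> L0 cu cv du; apply/cvgrPdist_le => e e0.
have /cvgrPdist_le/(_ e e0)[d /= d0 Hd] := cv 0.
near=> h; have h0 : 0 < h by near: h; exact: nbhs_right_gt.
have hL : h < L by near: h; exact: nbhs_right_lt.
have hd : h < d by near: h; exact: nbhs_right_lt.
have : `|(u h - v 0 * h) - (u 0 - v 0 * 0)| <= e * (h - 0).
  apply: (@lipschitz_increment _ (fun x => u x - v 0 * x) (fun x => v x - v 0)).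
  - exact: ltW.
  - by apply: contB => //; exact: cont_lin.
  - move=> x /andP[x0 xh]; apply: derB; last exact: der_lin.
    by apply: du; rewrite x0 (lt_trans xh).
  - move=> x /andP[x0 xh]; rewrite distrC; apply: Hd => /=.
    by rewrite sub0r normrN gtr0_norm// (lt_trans xh).
rewrite !subr0 mulr0 subr0 => H.
rewrite -(ler_pM2r h0) -[X in _ * X](gtr0_norm h0) -normrM.
rewrite mulrBl mulrAC mulVf ?gt_eqF// mul1r distrC.
by rewrite (_ : u h - u 0 - v 0 * h = u h - v 0 * h - u 0)//; ring.
Unshelve. all: by end_near. Qed.

Lemma constant_on_open (f : R -> R) L : (forall x, 0 < x < L -> is_derive x 1 f 0) ->
  forall x y, 0 < x < L -> 0 < y < L -> f x = f y.
Proof.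
move=> df x y; wlog xy : x y / x < y => [H xL yL|xL yL].
  have [xy|yx|->//] := ltgtP x y; first exact: H.
  by apply/esym; exact: H.
have sub z : x <= z <= y -> 0 < z < L.
  by case/andP: xL => ? ?; case/andP: yL => ? ?; clear df; lra.
have [| |z _] := @MVT _ f (fun=> 0) x y xy.
- by move=> z; rewrite in_itv/= => /andP[? ?]; apply: df; apply: sub; rewrite !ltW.
- apply: derivable_within_continuous => z; rewrite in_itv/= => zxy.
  exact: (@ex_derive _ _ _ _ _ _ _ (df z (sub z zxy))).
- by rewrite mul0r => /eqP; rewrite subr_eq0 => /eqP.
Qed.

Lemma cont_bounded_mul L Q (p h : R -> R) : 0 < L -> cont_bounded L Q p ->
  continuous h -> exists M, cont_bounded L M (fun x => p x * h x).
Proof.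
move=> L0 pQ ch; have [A A0 HA] := bounded_on_segment (ltW L0) ch.
exists (Q * A) => x xL; have [cp bp] := pQ x xL; split.
  by apply: continuousM => //; exact: ch.
rewrite normrM ler_pM//; apply: HA; by case/andP: xL => *; rewrite !ltW.
Qed.

(** The derivative of an eigenfunction has to be extended to the closed edge. Its own derivative is
    bounded and has a continuous primitive [F]; the difference is constant inside, so [F] plus that
    constant, read off at [L / 2], is the extension. *)
Lemma edge_eigen_sol (L mu Q : R) (p phi : R -> R) : 0 < L -> cont_bounded L Q p ->
  {within `[0, L], continuous phi} ->
  (forall x, x \in `]0, L[ -> [/\ derivable phi x 1, derivable (derive1 phi) x 1 &
     - derive1 (derive1 phi) x + p x * phi x = mu * phi x]) ->
  exists v : R -> R, sol L (fun x => p x - mu) (fun x => phi (clamp L x)) v.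
Proof.
move=> L0 pQ cphi eqn; pose u x := phi (clamp L x).
have cu : continuous u by exact: clamp_ext_cont (ltW L0) cphi.
have uphi x : 0 < x < L -> \forall t \near x, phi t = u t.
  move=> xL; have := near_itv_oo xL; apply: filterS => t /andP[t0 tL].
  by rewrite /u clamp_id// !ltW.
have pQ' : cont_bounded L (Q + `|mu|) (fun x => p x - mu).
  move=> x xL; have [cp bp] := pQ x xL; split.
    by apply: continuousB => //; exact: cvg_cst.
  by rewrite (le_trans (ler_normB _ _))// lerD2r.
have [M HM] := cont_bounded_mul L0 pQ' cu.
have [F [cF _ dF]] := exists_primitive L0 (fun x xL => (HM x xL).1) (fun x xL => (HM x xL).2).
pose d x := derive1 phi x - F x.
have dd x : 0 < x < L -> is_derive x 1 d 0.
  move=> xL; have [|_ d2 E] := eqn x; first by rewrite in_itv.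
  have d2' : is_derive x 1 (derive1 phi) (derive1 (derive1 phi) x).
    exact: DeriveDef d2 (esym (derive1E _ _)).
  have := derB d2' (dF x xL) => /is_derive_eq; apply.
  have -> : derive1 (derive1 phi) x = p x * phi x - mu * phi x by rewrite -E; ring.
  rewrite -(nbhs_singleton (uphi x xL)); ring.
have L2 : 0 < L / 2 < L by lra.
pose v x := F x + d (L / 2).
have cv : continuous v by apply: contD => //; exact: contc.
exists v; split=> // x xL.
- apply: der_near (uphi x xL) _.
  have [|d1 _ _] := eqn x; first by rewrite in_itv.
  apply: DeriveDef => //; rewrite -derive1E.
  by rewrite /v (constant_on_open dd L2 xL) /d; ring.
- have := derD (dF x xL) (derc (d (L / 2)) x).
  by rewrite addr0.
Qed.

Lemma sum_edges (F : edge -> R) : \sum_j F j = F e1 + F e2 + F e3 + F e4.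
Proof.
rewrite !big_ord_recl big_ord0 addr0 !addrA.
by congr (_ + _ + _ + _); congr F; apply: val_inj.
Qed.

Lemma regular_admissible l q : admissible l q -> regular l q.
Proof.
move=> adm j; have [l0 cq [M [_ HM]]] := adm j; split=> //.
exists (M + 1) => x xl; have xj : x \in `]0, l j[ by rewrite in_itv.
by split; [exact: cq|apply: HM => //; rewrite ltrDl].
Qed.

Lemma vertex_deriv_src l phi (v : R -> R) (j : edge) i : 0 < l j -> src j = i ->
  {within `[0, l j], continuous (phi j)} -> continuous v ->
  (forall x, 0 < x < l j -> is_derive x 1 (fun x => phi j (clamp (l j) x)) (v x)) ->
  vertex_deriv l phi j i = v 0.
Proof.
move=> l0 ji cphi cv du; apply/cvg_lim; first exact: Rhausdorff.
have H := right_derivative l0 (clamp_ext_cont (ltW l0) cphi) cv du.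
apply: cvg_trans H; apply: near_eq_cvg; near=> h.
have h0 : 0 < h by near: h; exact: nbhs_right_gt.
have hl : h < l j by near: h; exact: nbhs_right_lt.
rewrite /diff_quotient /endpoint /away ji eqxx add0r mul1r.
by rewrite !clamp_id ?lexx ?(ltW h0) ?(ltW hl)// ltW.
Unshelve. all: by end_near. Qed.

(** Reflection reduces this to the right derivative at [0]. At a target [x] decreases when moving
    away from the vertex, whence the sign. *)
Lemma vertex_deriv_tgt l phi (v : R -> R) (j : edge) i : 0 < l j -> src j != i ->
  {within `[0, l j], continuous (phi j)} -> continuous v ->
  (forall x, 0 < x < l j -> is_derive x 1 (fun x => phi j (clamp (l j) x)) (v x)) ->
  vertex_deriv l phi j i = - v (l j).
Proof.
move=> l0 ji cphi cv du; apply/cvg_lim; first exact: Rhausdorff.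
have E (f : R -> R) : (fun x => f (l j - x)) = (fun x => f (l j + (-1) * x)).
  by apply/funext => x; rewrite mulN1r.
have cu := clamp_ext_cont (ltW l0) cphi.
have H := right_derivative (u := fun x => phi j (clamp (l j) (l j + (-1) * x)))
  (v := fun x => - v (l j + (-1) * x)) l0
  (cont_affine (c := -1) (d := l j) cu) (contN (cont_affine (c := -1) (d := l j) cv)).
rewrite mulr0 addr0 in H.
apply: cvg_trans (H _); last first.
  move=> x xl; have xl' : 0 < l j + (-1) * x < l j.
    by case/andP: xl; clear; lra.
  have := der_affine (f := fun x => phi j (clamp (l j) x)) (du _ xl').
  by move=> /is_derive_eq; apply; ring.
apply: near_eq_cvg; near=> h.
have h0 : 0 < h by near: h; exact: nbhs_right_gt.
have hl : h < l j by near: h; exact: nbhs_right_lt.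
rewrite /diff_quotient /endpoint /away (negbTE ji).
by rewrite !clamp_id// ?lexx ?ltW//; move: h0 hl; clear; lra.
Unshelve. all: by end_near. Qed.

Lemma eigen_graph_sol l q mu phi : regular l q -> eigen_solution l q mu phi ->
  exists v s t, graph_sol l q mu 0 0 (fun j x => phi j (clamp (l j) x)) v s t /\
    v e1 0 = vertex_deriv l phi e1 v1 /\ v e3 0 = vertex_deriv l phi e3 v2.
Proof.
move=> reg [eqn [cphi vtx] _ kir dir].
have l0 j : 0 < l j by have [] := reg j.
have /choice[v Hv] : forall j, exists v : R -> R,
    sol (l j) (fun x => q j x - mu) (fun x => phi j (clamp (l j) x)) v.
  move=> j; have [_ [Q qQ]] := reg j.
  exact: edge_eigen_sol (l0 j) qQ (cphi j) (eqn j).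
have vsrc j i : src j = i -> vertex_deriv l phi j i = v j 0.
  by move=> ji; have [_ cv du _] := Hv j; exact: vertex_deriv_src ji (cphi j) cv du.
have vtgt j i : src j != i -> vertex_deriv l phi j i = - v j (l j).
  by move=> ji; have [_ cv du _] := Hv j; exact: vertex_deriv_tgt ji (cphi j) cv du.
have c0 j : clamp (l j) 0 = 0 by rewrite clamp_id// lexx ltW.
have cl j : clamp (l j) (l j) = l j by rewrite clamp_id// lexx ltW.
have mem (j : edge) i : (j \in incident i) = (src j == i) || (tgt j == i) by rewrite inE.
have k2 : v e1 (l e1) = v e2 0 + v e3 0.
  have := kir v2; rewrite !inE => /(_ isT); rewrite big_mkcond sum_edges !mem /=.
  rewrite (vtgt e1 v2)// (vsrc e2 v2)// (vsrc e3 v2)//; clear; lra.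
have k3 : v e4 0 = v e2 (l e2) + v e3 (l e3).
  have := kir v3; rewrite !inE => /(_ isT); rewrite big_mkcond sum_edges !mem /=.
  rewrite (vtgt e2 v3)// (vtgt e3 v3)// (vsrc e4 v3)//; clear; lra.
have d1 : phi e1 0 = 0 by apply: (dir v1 e1); rewrite !inE.
have d4 : phi e4 (l e4) = 0 by apply: (dir v4 e4); rewrite !inE.
have v21 : phi e1 (l e1) = phi e2 0 by apply: (vtx v2 e1 e2); rewrite !inE.
have v22 : phi e3 0 = phi e2 0 by apply: (vtx v2 e3 e2); rewrite !inE.
have v31 : phi e3 (l e3) = phi e2 (l e2) by apply: (vtx v3 e3 e2); rewrite !inE.
have v32 : phi e4 0 = phi e2 (l e2) by apply: (vtx v3 e4 e2); rewrite !inE.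
exists v, (phi e2 0), (phi e2 (l e2)); split.
  by split=> //; rewrite ?c0 ?cl ?addr0.
by rewrite (vsrc e1 v1)// (vsrc e3 v2).
Qed.

End Eigenfunctions.

(** * Integrals of continuous functions over an edge *)

Section Integration.
Context {R : realType}.
Implicit Types (h H : R -> R) (L : R).

Lemma cont_integrable h L : continuous h ->
  lebesgue_measure.-integrable `[0, L] (EFin \o h).
Proof.
move=> ch; apply: continuous_compact_integrable; first exact: segment_compact.
exact: continuous_subspaceT.
Qed.

Lemma integral_ftc h H L : 0 < L -> continuous h -> continuous H ->
  (forall x, 0 < x < L -> is_derive x 1 H (h x)) ->
  \int[lebesgue_measure]_(x in `]0, L[) h x = H L - H 0.
Proof.
move=> L0 ch cH dH.
have ih := cont_integrable L ch.
rewrite Rintegral_itv_bndo_bndc; last first.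
  by apply: integrableS ih => //; exact: subset_itv_oo_cc.
rewrite Rintegral_itv_obnd_cbnd; last first.
  by apply: integrableS ih => //; exact: subset_itv_oc_cc.
rewrite /Rintegral (@continuous_FTC2 R h H 0 L L0) //.
- exact: continuous_subspaceT.
- split.
  + move=> x; rewrite in_itv/= => xL; exact: (@ex_derive _ _ _ _ _ _ _ (dH x xL)).
  + by apply: cvg_at_right_filter; exact: cH.
  + by apply: cvg_at_left_filter; exact: cH.
- move=> x; rewrite in_itv/= => xL; rewrite derive1E.
  exact: (@derive_val _ _ _ _ _ _ _ (dH x xL)).
Qed.

Lemma cont_Lfun2 h L : 0 < L -> continuous h ->
  (h \_ `]0, L[ : R -> R) \in Lfun lebesgue_measure 2%:E.
Proof.
move=> L0 ch; rewrite inE; apply/andP; split.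
  rewrite inE; apply/(measurable_restrictT h) => //.
  by apply: measurable_funTS; exact: measurable_realfun.continuous_measurable_fun.
rewrite inE /finite_norm unlock/=.
apply: poweR_lty.
have ch2 : continuous (fun x => `|h x| ^+ 2).
  under eq_fun do rewrite expr2.
  by apply: contM; exact: cont_norm.
have ih := cont_integrable L ch2.
have /integrableP[_] : lebesgue_measure.-integrable `]0, L[ (EFin \o (fun x => `|h x| ^+ 2)).
  by apply: integrableS ih => //; exact: subset_itv_oo_cc.
apply: le_lt_trans.
rewrite [leRHS]integral_mkcond le_eqVlt; apply/orP; left; apply/eqP.
apply: eq_integral => x _ /=; rewrite !patchE; case: ifPn => _ /=.
  by rewrite powR_mulrn// normrX normr_id.
by rewrite normr0 powR0// pnatr_eq0.
Qed.

End Integration.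

(** * Parseval, Green's formula and the common response *)

Section Spectral.
Context {R : realType}.
Implicit Types (l : edge -> R) (q F G u v : edge -> R -> R) (e phi : nat -> edge -> R -> R).
Implicit Types (f g s t k lam mu a b : R).

Definition cont_family F := forall j, continuous (F j).

Lemma cont_integrable_oo (h : R -> R) (L : R) : continuous h ->
  lebesgue_measure.-integrable `]0, L[ (EFin \o h).
Proof.
move=> ch; apply: integrableS (cont_integrable L ch) => //.
exact: subset_itv_oo_cc.
Qed.

Lemma L2dot_sym l F G : L2dot l F G = L2dot l G F.
Proof.
by apply: eq_bigr => j _; apply: eq_Rintegral => x _; rewrite mulrC.
Qed.

Lemma L2dot_ext l F F' G G' : (forall j x, 0 < x < l j -> F j x = F' j x) ->
  (forall j x, 0 < x < l j -> G j x = G' j x) -> L2dot l F G = L2dot l F' G'.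
Proof.
move=> FF GG; apply: eq_bigr => j _; apply: eq_Rintegral => x.
by rewrite inE/= in_itv/= => xl; rewrite FF// GG.
Qed.

Lemma L2dot_linear l F F' G a b : cont_family F -> cont_family F' -> cont_family G ->
  L2dot l (fun j x => a * F j x + b * F' j x) G = a * L2dot l F G + b * L2dot l F' G.
Proof.
move=> cF cF' cG; rewrite /L2dot !mulr_sumr -big_split/=; apply: eq_bigr => j _.
have iF := cont_integrable_oo (l j) (contM (cF j) (cG j)).
have iF' := cont_integrable_oo (l j) (contM (cF' j) (cG j)).
have iaF := cont_integrable_oo (l j) (contM (@contc R a) (contM (cF j) (cG j))).
have ibF := cont_integrable_oo (l j) (contM (@contc R b) (contM (cF' j) (cG j))).
rewrite -RintegralZl// -RintegralZl// -RintegralD//.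
by apply: eq_Rintegral => x _; ring.
Qed.

Lemma L2dot_ge0 l F : 0 <= L2dot l F F.
Proof.
by apply: sumr_ge0 => j _; apply: Rintegral_ge0 => x _; rewrite -expr2 sqr_ge0.
Qed.

Lemma L2dot_sum l e G (c : nat -> R) N : (forall n, cont_family (e n)) ->
  cont_family G ->
  L2dot l (fun j x => \sum_(n < N) c n * e n j x) G =
  \sum_(n < N) c n * L2dot l (e n) G.
Proof.
move=> ce cG; elim: N => [|N IH].
  rewrite big_ord0; apply: big1 => j _.
  rewrite (_ : (fun _ => _) = cst 0); first by rewrite Rintegral_cst// mul0r.
  by apply/funext => x; rewrite big_ord0 mul0r.
rewrite big_ord_recr/= -IH -[X in X + _]mul1r -L2dot_linear//.
- by apply: L2dot_ext => // j x _; rewrite big_ord_recr/= mul1r.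
- move=> j; apply: (@cont_sum R N (fun n x => c n * e n j x)) => n.
  by apply: contM; [exact: contc|exact: ce].
Qed.

(** Nonnegativity of the squared norms of [F + t * G] and [F - t * G]; this takes the place of the
    Cauchy-Schwarz inequality. *)
Lemma L2dot_young l F G t : cont_family F -> cont_family G -> 0 < t ->
  2 * t * `|L2dot l F G| <= L2dot l F F + t ^+ 2 * L2dot l G G.
Proof.
move=> cF cG t0.
have H b : 0 <= L2dot l F F + 2 * b * L2dot l F G + b ^+ 2 * L2dot l G G.
  have cFG : cont_family (fun j x => 1 * F j x + b * G j x).
    by move=> j; apply: contD; apply: contM; try exact: contc; [exact: cF|exact: cG].
  have := L2dot_ge0 l (fun j x => 1 * F j x + b * G j x).
  rewrite L2dot_linear// [X in 1 * X]L2dot_sym [X in b * X]L2dot_sym !L2dot_linear//.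
  rewrite [L2dot l G F]L2dot_sym => H; apply: le_trans H _.
  by rewrite le_eqVlt; apply/orP; left; apply/eqP; ring.
have := H t; have := H (- t); rewrite sqrrN.
by case: (ger0P (L2dot l F G)) => _; clear; lra.
Qed.

(** The family [e] is a continuous representative of [phi]. The basis property makes the remainder
    of [F] small in norm, and its inner product with [G] is exactly the error of the partial sum. *)
Lemma parseval l phi e F G : (forall j, 0 < l j) -> orthonormal_basis l phi ->
  (forall n, cont_family (e n)) ->
  (forall n j x, 0 < x < l j -> e n j x = phi n j x) ->
  cont_family F -> cont_family G ->
  \sum_(n < N) L2dot l F (e n) * L2dot l G (e n) @[N --> \oo] --> L2dot l F G.
Proof.
move=> l0 [_ _ basis] ce ephi cF cG.
pose r N : edge -> R -> R := fun j x =>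
  1 * F j x + -1 * \sum_(n < N) L2dot l F (e n) * e n j x.
have cS N : cont_family (fun j x => \sum_(n < N) L2dot l F (e n) * e n j x).
  move=> j; apply: (@cont_sum R N (fun n x => L2dot l F (e n) * e n j x)) => n.
  by apply: contM; [exact: contc|exact: ce].
have cr N : cont_family (r N).
  move=> j; apply: contD; apply: contM; try exact: contc; first exact: cF.
  exact: cS.
have FL2 : in_L2 l F by move=> j; exact: cont_Lfun2.
have r0 : L2dot l (r N) (r N) @[N --> \oo] --> (0 : R).
  have := basis F FL2; apply: cvg_trans; apply: near_eq_cvg; near=> N.
  have E j x : 0 < x < l j -> r N j x = F j x - fourier_sum l phi F N j x.
    move=> xl; rewrite /r mul1r mulN1r; congr (_ - _); apply: eq_bigr => n _.
    rewrite ephi//; congr (_ * _); apply: L2dot_ext => // i y yl; exact: ephi.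
  by apply: L2dot_ext => j x xl; rewrite E.
have rG N : L2dot l (r N) G = L2dot l F G - \sum_(n < N) L2dot l F (e n) * L2dot l G (e n).
  rewrite L2dot_linear// (L2dot_sum l (fun n => L2dot l F (e n)) N ce cG).
  rewrite mul1r mulN1r; congr (_ - _).
  by apply: eq_bigr => n _; rewrite [L2dot l (e n) G]L2dot_sym.
apply/cvgrPdist_le => d d0; pose GG := L2dot l G G.
have GG0 : 0 <= GG by exact: L2dot_ge0.
(* With this weight both terms on the right of the Young inequality are at most [t * d]. *)
pose t := d / (GG + 1).
have GG1 : 0 < GG + 1 by clear - GG0; lra.
have t0 : 0 < t by rewrite divr_gt0.
have td0 : 0 < t * d by rewrite mulr_gt0.
have /cvgrPdist_le/(_ _ td0) := r0; apply: filterS => N.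
rewrite sub0r normrN ger0_norm ?L2dot_ge0// => Hr.
rewrite -rG.
have := L2dot_young l (cr N) cG t0; rewrite -/GG => Y.
have : t * GG <= d.
  by rewrite /t mulrAC ler_pdivrMr// ler_wpM2l ?(ltW d0)//; clear; lra.
move=> tGG; rewrite -(ler_pM2l t0).
have : t ^+ 2 * GG <= t * d by rewrite expr2 -mulrA ler_wpM2l// ltW.
by move: Y Hr; rewrite -!mulrA; clear; lra.
Unshelve. all: by end_near. Qed.

(** On each edge the integral is an increment of the Wronskian. The boundary terms at inner vertices
    cancel by continuity and Kirchhoff, up to those caused by the jumps. *)
Lemma green l q lam f g u v s t lam' f' g' u' v' s' t' : (forall j, 0 < l j) ->
  graph_sol l q lam f g u v s t -> graph_sol l q lam' f' g' u' v' s' t' ->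
  (lam - lam') * L2dot l u u' =
    - f * v' e1 0 + f' * v e1 0 - g * v' e3 0 + g' * v e3 0.
Proof.
move=> l0 G G'.
have E j : (lam - lam') * (\int[lebesgue_measure]_(x in `]0, l j[) (u j x * u' j x)) =
    wronskian (u j) (v j) (u' j) (v' j) (l j) - wronskian (u j) (v j) (u' j) (v' j) 0.
  have S := gs_sol G j; have S' := gs_sol G' j.
  have [cu _ _ _] := S; have [cu' _ _ _] := S'.
  rewrite -RintegralZl//; last exact: cont_integrable_oo (contM cu cu').
  apply: integral_ftc => //.
  - by apply: contM; [exact: contc|exact: contM].
  - exact: wronskian_cont S S'.
  - move=> x xl; have := wronskian_der S S' xl.
    by move=> /is_derive_eq; apply; ring.
rewrite /L2dot mulr_sumr (eq_bigr _ (fun j _ => E j)) sum_edges /wronskian.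
have [-> ->] := gs_e1 G; have [-> ->] := gs_e1 G'.
have [-> ->] := gs_e2 G; have [-> ->] := gs_e2 G'.
have [-> ->] := gs_e3 G; have [-> ->] := gs_e3 G'.
have [-> ->] := gs_e4 G; have [-> ->] := gs_e4 G'.
rewrite (gs_v2 G) (gs_v2 G') (gs_v3 G) (gs_v3 G'); ring.
Qed.

Lemma graph_sol_cont l q lam f g u v s t :
  graph_sol l q lam f g u v s t -> cont_family u.
Proof. by move=> G j; have [] := gs_sol G j. Qed.

Lemma spectral_expansion l q (lam : nat -> R) phi mu mu' f g u v s t f' g' u' v' s' t' :
  regular l q -> spectral_system l q lam phi ->
  (forall n : nat, mu < lam n) -> (forall n : nat, mu' < lam n) ->
  graph_sol l q mu f g u v s t -> graph_sol l q mu' f' g' u' v' s' t' ->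
  let a n := vertex_deriv l (phi n) e1 v1 in
  let b n := vertex_deriv l (phi n) e3 v2 in
  \sum_(n < N) ((f * a n + g * b n) / (lam n - mu)) *
    ((f' * a n + g' * b n) / (lam n - mu')) @[N --> \oo] --> L2dot l u u'.
Proof.
move=> reg [_ eig basis] mul mul' G G' a b.
have l0 j : 0 < l j by have [] := reg j.
pose e n : edge -> R -> R := fun j x => phi n j (clamp (l j) x).
have /choice[w /choice[c /choice[d Hw]]] : forall n,
    exists (w : edge -> R -> R) (c d : R),
    graph_sol l q (lam n) 0 0 (e n) w c d /\ w e1 0 = a n /\ w e3 0 = b n.
  by move=> n; exact: eigen_graph_sol (eig n).
have ce n : cont_family (e n) by have [H _] := Hw n; exact: graph_sol_cont H.
have ephi n j x : 0 < x < l j -> e n j x = phi n j x.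
  by move=> /andP[x0 xl]; rewrite /e clamp_id// !ltW.
have coef nu f0 g0 u0 v0 s0 t0 n : nu < lam n -> graph_sol l q nu f0 g0 u0 v0 s0 t0 ->
    (f0 * a n + g0 * b n) / (lam n - nu) = L2dot l u0 (e n).
  move=> nul G0; have [H [<- <-]] := Hw n.
  have E := green l0 G0 H.
  have nz : lam n - nu != 0 by rewrite subr_eq0 gt_eqF.
  apply: (mulIf nz); rewrite divfK//.
  by transitivity (- ((nu - lam n) * L2dot l u0 (e n))); [rewrite E; ring|ring].
have := parseval l0 basis ce ephi (graph_sol_cont G) (graph_sol_cont G').
apply: cvg_trans; apply: near_eq_cvg; near=> N; apply: eq_bigr => n _.
by rewrite -(coef _ _ _ _ _ _ _ _ (mul n) G) -(coef _ _ _ _ _ _ _ _ (mul' n) G').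
Unshelve. all: by end_near. Qed.

Lemma eq_of_norm_le_inv (x y C K : R) : 0 <= C ->
  (forall k, K <= k -> 0 < k /\ `|x - y| <= C / k) -> x = y.
Proof.
move=> C0 H; apply/eqP; rewrite -subr_eq0 -normr_le0.
apply/ler_addgt0Pr => d d0; rewrite add0r.
have [|k0 Hk] := H (Num.max K (C / d)); first by rewrite le_max lexx.
apply: le_trans Hk _; rewrite ler_pdivrMr// mulrC -ler_pdivrMr//.
by rewrite le_max lexx orbT.
Qed.

Lemma spectral_data_same_response l q (lam : nat -> R) phi l' q' phi' :
  regular l q -> regular l' q' ->
  spectral_system l q lam phi -> spectral_system l' q' lam phi' ->
  (forall n, vertex_deriv l (phi n) e1 v1 = vertex_deriv l' (phi' n) e1 v1) ->
  (forall n, vertex_deriv l (phi n) e3 v2 = vertex_deriv l' (phi' n) e3 v2) ->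
  exists K0, forall k, K0 <= k ->
    same_response l q l' q' k 1 0 /\ same_response l q l' q' k 0 1.
Proof.
move=> reg reg' sp sp' Ha Hb.
have l0 j : 0 < l j by have [] := reg j.
have l0' j : 0 < l' j by have [] := reg' j.
have [C [K [C0 far]]] := far_field_exists reg.
have [C' [K' [C'0 far']]] := far_field_exists reg'.
have CC : 0 <= C + C' by rewrite addr_ge0// ltW.
(* For [k >= K1], [k ^ 2 >= k] exceeds [|lam 0|], so [- k ^ 2] lies below the whole spectrum. *)
pose K1 := 1 + `|lam 0%N|.
have lamk k n : K1 <= k -> - k ^+ 2 < lam n.
  move=> Kk; have : lam 0%N <= lam n.
    elim: n => // n IH; apply: le_trans IH _; exact: spectral_nondecreasing sp n.
  apply: lt_le_trans; have := ler_norm (- lam 0%N); rewrite normrN.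
  have := normr_ge0 (lam 0%N); move: Kk; rewrite /K1; clear => Kk n0 H.
  have : k * 1 <= k ^+ 2 by rewrite expr2 ler_wpM2l; lra.
  lra.
pose K0 := Num.max K1 (Num.max K K').
have big k : K0 <= k -> [/\ K1 <= k, K <= k & K' <= k].
  by rewrite !ge_max => /andP[-> /andP[-> ->]].
(* Green's formula turns the common expansion of the inner products into equality
   of the boundary pairings at two spectral parameters. *)
have pair k m f g u v s t f' g' u' v' s' t' z w c d z' w' c' d' :
    K1 <= k -> K1 <= m ->
    graph_sol l q (- k ^+ 2) f g u v s t ->
    graph_sol l' q' (- k ^+ 2) f g u' v' s' t' ->
    graph_sol l q (- m ^+ 2) f' g' z w c d ->
    graph_sol l' q' (- m ^+ 2) f' g' z' w' c' d' ->
    - f * w e1 0 + f' * v e1 0 - g * w e3 0 + g' * v e3 0 =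
    - f * w' e1 0 + f' * v' e1 0 - g * w' e3 0 + g' * v' e3 0.
  move=> kK mK G G' Z Z'.
  rewrite -(green l0 G Z) -(green l0' G' Z'); congr (_ * _).
  have L := spectral_expansion reg sp (fun n => lamk k n kK) (fun n => lamk m n mK) G Z.
  have L' := spectral_expansion reg' sp' (fun n => lamk k n kK) (fun n => lamk m n mK) G' Z'.
  apply: (cvg_unique _ L); first exact: Rhausdorff.
  apply: cvg_trans L'; apply: near_eq_cvg; near=> N; apply: eq_bigr => n _.
  by rewrite Ha Hb.
have tri (x y x' y' m : R) : x + y = x' + y' -> `|y| <= C / m -> `|y'| <= C' / m ->
    `|x - x'| <= (C + C') / m.
  move=> E h h'; rewrite (_ : x - x' = y' - y); last by move: E; clear; lra.
  by rewrite mulrDl [leRHS]addrC; apply: le_trans (ler_normB _ _) _; apply: lerD.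
exists K0 => k Kk; have [kK1 _ _] := big k Kk.
(* Here [k] is fixed and [m] tends to infinity. Pairing with the unit source at [m] isolates the
   derivative at [v1], pairing with the unit jump the one at [v2] along [e3]; the terms at [m] agree
   for both graphs up to [O(1 / m)]. *)
split=> u v s t u' v' s' t' G G'; split;
  apply: (eq_of_norm_le_inv (K := K0) CC) => m /big[mK1 mK mK'];
  have [m0 [z [w [c [d [y [x [a [b [Z Y [z1 z3 y1 y3] _ _]]]]]]]]]] := far m mK;
  have [_ [z' [w' [c' [d' [y' [x' [a' [b' [Z' Y' [z1' z3' y1' y3'] _ _]]]]]]]]]] := far' m mK';
  split=> //.
- apply: (tri _ (- (w e1 0 + m)) _ (- (w' e1 0 + m))); rewrite ?normrN//.
  by have := pair _ _ _ _ _ _ _ _ _ _ _ _ _ _ _ _ _ _ _ _ _ _ kK1 mK1 G G' Z Z'; clear; lra.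
- apply: (tri _ (- x e1 0) _ (- x' e1 0)); rewrite ?normrN//.
  by have := pair _ _ _ _ _ _ _ _ _ _ _ _ _ _ _ _ _ _ _ _ _ _ kK1 mK1 G G' Y Y'; clear; lra.
- apply: (tri _ (- w e3 0) _ (- w' e3 0)); rewrite ?normrN//.
  by have := pair _ _ _ _ _ _ _ _ _ _ _ _ _ _ _ _ _ _ _ _ _ _ kK1 mK1 G G' Z Z'; clear; lra.
- apply: (tri _ (- (x e3 0 + 2 / 3 * m)) _ (- (x' e3 0 + 2 / 3 * m))); rewrite ?normrN//.
  by have := pair _ _ _ _ _ _ _ _ _ _ _ _ _ _ _ _ _ _ _ _ _ _ kK1 mK1 G G' Y Y'; clear; lra.
Unshelve. all: by end_near. Qed.

End Spectral.

Theorem theorem1 (R : realType)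
    (l l' : edge -> R) (q q' : edge -> R -> R)
    (lam lam' : nat -> R) (phi phi' : nat -> edge -> R -> R) :
  admissible l q -> admissible l' q' ->
  spectral_system l q lam phi -> spectral_system l' q' lam' phi' ->
  (forall n : nat, lam n = lam' n) ->
  (forall n : nat,
     vertex_deriv l (phi n) e1 v1 = vertex_deriv l' (phi' n) e1 v1) ->
  (forall n : nat,
     vertex_deriv l (phi n) e3 v2 = vertex_deriv l' (phi' n) e3 v2) ->
  forall j : edge, l j = l' j /\ {in `]0, l j[, q j =1 q' j}.
Proof.
move=> /regular_admissible reg /regular_admissible reg' sp sp'.
move=> /funext lamE; rewrite -lamE in sp'; move=> Ha Hb j.
have [K0 H] := spectral_data_same_response reg reg' sp sp' Ha Hb.
have [-> qq] := response_determines_graph reg reg' H j.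
by split=> // x; rewrite in_itv/= => xl; exact: qq.
Qed.
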